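(* Let $n\ge 2$, let $\theta$ be a real antisymmetric $n\times n$ matrix, let $g\in\mathrm{GL}_n^+(\mathcal{A}_\theta^{\mathbb{R}})$ be (the matrix of) a Riemannian metric and let $k\in\mathcal{A}_\theta^{++}$ be such that $[k,g]=0$ (i.e., $k$ commutes with all the entries of $g$). Set $\hat g=kgk=k^2g$. Then $$\Delta_{\hat g}u=k^{-2}\Delta_gu-\nu(g)^{-1}k^{-n}\Big(\sqrt{\nu(g)}\,du,\ \sqrt{\nu(g)}\,d(k^{n-2})\Big)_{g^{-1}}\qquad\text{for all }u\in\mathcal{A}_\theta.$$ In particular, when $n=2$ we have $\Delta_{\hat g}=k^{-2}\Delta_g$.
   Context: Noncommutative torus. Let $n\ge2$ and let $\theta=(\theta_{jk})$ be a real antisymmetric $n\times n$ matrix with columns $\theta_1,\dots,\theta_n$. On $L^2(\mathbb{T}^n)$, $\mathbb{T}^n=\mathbb{R}^n/(2\pi\mathbb{Z})^n$, with inner product $\langle\xi|\eta\rangle=(2\pi)^{-n}\int_{\mathbb{T}^n}\xi\bar\eta\,dx$, let $(U_j\xi)(x)=e^{ix_j}\xi(x+\pi\theta_j)$ (unitary). $A_\theta$ is the $C^*$-algebra generated by $U_1,\dots,U_n$. Put $(V_s\xi)(x)=\xi(x+s)$ and $\alpha_s(T)=V_sTV_s^{-1}$ for $s\in\mathbb{R}^n$. The smooth noncommutative torus is $\mathcal{A}_\theta=\{u\in A_\theta:\ s\mapsto\alpha_s(u)\in C^\infty(\mathbb{R}^n;A_\theta)\}$, with commuting derivations $\partial_j(u)=\partial_{s_j}\alpha_s(u)|_{s=0}$.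 $\mathcal{A}_\theta$ and all $M_m(\mathcal{A}_\theta)$ are closed under holomorphic functional calculus. Positivity and Riemannian metrics. $\mathcal{A}_\theta^{++}$ is the set of positive invertible elements of $\mathcal{A}_\theta$. $\mathrm{GL}_n^+(\mathcal{A}_\theta^{\mathbb{R}})$ is the set of positive invertible $g=(g_{ij})\in M_n(\mathcal{A}_\theta)$ such that both $g$ and $g^{-1}=(g^{ij})$ have selfadjoint entries; its elements are (identified with) the Riemannian metrics on $\mathcal{A}_\theta$. Riemannian density. $\det(g)=\exp(\mathrm{Tr}[\log g])\in\mathcal{A}_\theta^{++}$, where $\log g\in M_n(\mathcal{A}_\theta)$ is given by holomorphic functional calculus and $\mathrm{Tr}[a]=\sum_i a_{ii}\in\mathcal{A}_\theta$. $\nu(g)=\sqrt{\det(g)}\in\mathcal{A}_\theta^{++}$. Forms. $\mathcal{X}_\theta$ is the free left $\mathcal{A}_\theta$-module generated by $\partial_1,\dots,\partial_n$, and $\Omega^1_\theta=\mathrm{Hom}_{\mathcal{A}_\theta}(\mathcal{X}_\theta,\mathcal{A}_\theta)$ is a free right $\mathcal{A}_\theta$-module with dual basis $\theta^1,\dots,\theta^n$; every $\omega\in\Omega^1_\theta$ is uniquely $\sum_i\theta^i\omega_i$ with $\omega_i\in\mathcal{A}_\theta$. The left action is $a\omega=\sum_i\theta^i(a\omega_i)$. The differential is $du=\sum_i\theta^i\partial_i(u)$. For $g\in\mathrm{GL}_n^+(\mathcal{A}_\theta^{\mathbb{R}})$ (so that $g^{-1}$ is symmetric) and 1-forms $\omega,\zeta$,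 $(\omega,\zeta)_{g^{-1}}=\sum_{i,j}\zeta_i^*g^{ij}\omega_j\in\mathcal{A}_\theta$. Laplace-Beltrami operator. For a Riemannian metric $g$, $\Delta_g:\mathcal{A}_\theta\to\mathcal{A}_\theta$ is $\Delta_gu=-\delta(du)$ with $\delta\omega=\nu(g)^{-1}\sum_{i,j}\partial_i\big(\nu(g)^{1/2}g^{ij}\nu(g)^{1/2}\omega_j\big)$ for $\omega=\sum_i\theta^i\omega_i$. *)

(* Defs.v *)
From HB Require Import structures.
From mathcomp Require Import all_boot all_order all_algebra.
From mathcomp Require Import all_classical all_reals all_analysis.
From mathcomp Require Import measurable_realfun.
From mathcomp Require Import complex.
From mathcomp Require Import ring lra.
Set Implicit Arguments.
Unset Strict Implicit.
Unset Printing Implicit Defensive.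
Import Order.TTheory GRing.Theory Num.Theory.
Import numFieldNormedType.Exports.
Local Open Scope classical_set_scope.
Local Open Scope ring_scope.

Section Torus.
Variable R : realType.

Lemma twopi_gt0 : (0 : R) < 2 * pi.
Proof. by rewrite mulr_gt0 ?pi_gt0. Qed.

(* dx / (2 pi) on [0, 2 pi], and its n-fold product. *)
Definition circle : probability (measurableTypeR R) R := uniform_prob twopi_gt0.

Definition tcons n (p : measurableTypeR R * n.-tuple (measurableTypeR R)) :
  n.+1.-tuple (measurableTypeR R) := [tuple of p.1 :: p.2].

Lemma measurable_tcons n : measurable_fun setT (@tcons n).
Proof. exact: measurable_cons. Qed.

HB.instance Definition _ n := isMeasurableFun.Build _ _ _ _ _ (@measurable_tcons n).

Fixpoint torus (n : nat) : probability (n.-tuple (measurableTypeR R)) R :=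
  match n with
  | 0%N => \d_ [tuple]
  | m.+1 => distribution (circle \x torus m)%E (@tcons m)
  end.

End Torus.

Section CircleShift.
Variable R : realType.
Notation T1 := (measurableTypeR R).
Local Notation mu := (@lebesgue_measure R).
Implicit Types F : T1 -> \bar R.

Definition shiftR (r : R) (x : T1) : T1 := x + r.

Lemma measurable_shiftR (r : R) : measurable_fun setT (shiftR r).
Proof. by apply: measurable_funD => //; exact: measurable_cst. Qed.

HB.instance Definition _ (r : R) :=
  isMeasurableFun.Build _ _ _ _ _ (measurable_shiftR r).

Lemma lebesgue_shift (r : R) (A : set T1) : measurable A ->
  mu A = pushforward mu (shiftR r) A.
Proof.
move=> mA.
have H := @lebesgue_measure_unique R
   (pushforward mu (shiftR r) : {measure set T1 -> \bar R}).
apply: H => // _ [[a b] /= ab <-].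
rewrite /pushforward.
have -> : (shiftR r) @^-1` `]a, b] = `]a - r, b - r]%classic.
  by apply/seteqP; split => x /=; rewrite !in_itv/= ltrBlDr lerBrDr.
rewrite !lebesgue_measure_itv/= !lte_fin.
rewrite ltrD2r; case: ifP => // _; rewrite -!EFinB; congr (_%:E); by rewrite opprB addrA subrK.
Qed.

Lemma ge0_integral_shiftR (r : R) F : measurable_fun setT F ->
  (forall x, 0 <= F x)%E -> (\int[mu]_x F (shiftR r x) = \int[mu]_x F x)%E.
Proof.
move=> mF F0.
rewrite [RHS](eq_measure_integral (pushforward mu (shiftR r))); last first.
  by move=> A mA _; exact: lebesgue_shift.
by rewrite ge0_integral_pushforward//= => *; exact: F0.
Qed.

Lemma ge0_integral_shift (r a b : R) F : measurable_fun setT F ->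
  (forall x, 0 <= F x)%E ->
  (\int[mu]_(x in (`[a, b[%classic : set R)) F (shiftR r x) = \int[mu]_(x in (`[(a + r)%R, (b + r)%R[%classic : set R)) F x)%E.
Proof.
move=> mF F0.
rewrite integral_mkcond [RHS]integral_mkcond.
rewrite -[RHS](ge0_integral_shiftR r); last 2 first.
- by apply/(measurable_restrictT _ _).1 => //; exact: measurable_funTS.
- by move=> x; apply: erestrict_ge0.
apply: eq_integral => x _; rewrite !patchE.
have -> : (shiftR r x \in (`[a + r, b + r[%classic : set R)) = (x \in (`[a, b[%classic : set R)).
  by apply/idP/idP; rewrite !inE/= !in_itv/= /shiftR => /andP[? ?]; lra.
by [].
Qed.

Lemma ge0_integral_periodic (p a : R) F : 0 < p -> 0 <= a < p ->
  measurable_fun setT F ->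
  (forall x, 0 <= F x)%E -> (forall x, F (shiftR p x) = F x) ->
  (\int[mu]_(x in (`[0%R, p[%classic : set R)) F (shiftR a x) = \int[mu]_(x in (`[0%R, p[%classic : set R)) F x)%E.
Proof.
move=> p0 /andP[a0 ap] mF F0 pF.
rewrite ge0_integral_shift// add0r.
have -> : `[a, p + a[%classic = `[a, p[%classic `|` `[p, p + a[%classic.
  apply/seteqP; split => x /=; rewrite !in_itv/=.
    by move=> /andP[? ?]; case: (ltP x p) => ?; [left|right]; lra.
  by move=> [] /andP[? ?]; lra.
have -> : `[0%R, p[%classic = `[a, p[%classic `|` `[0%R, a[%classic.
  apply/seteqP; split => x /=; rewrite !in_itv/=.
    by move=> /andP[? ?]; case: (ltP x a) => ?; [right|left]; lra.
  by move=> [] /andP[? ?]; lra.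
rewrite !ge0_integral_setU//=; last 4 first.
- exact: measurable_funTS.
- apply/disj_setPS => x /=; rewrite !in_itv/= => -[/andP[? ?] /andP[? ?]]; lra.
- exact: measurable_funTS.
- apply/disj_setPS => x /=; rewrite !in_itv/= => -[/andP[? ?] /andP[? ?]]; lra.
congr (_ + _)%E.
have -> : (`[p, p + a[%classic : set R) = `[0 + p, a + p[%classic.
  by rewrite add0r addrC.
rewrite -ge0_integral_shift//.
by under eq_integral do rewrite pF.
Qed.

Lemma circle_shift (s : R) F : measurable_fun setT F ->
  (forall x, 0 <= F x)%E -> (forall x (z : int), F (shiftR (2 * pi * z%:~R) x) = F x) ->
  (\int[circle R]_x F (shiftR s x) = \int[circle R]_x F x)%E.
Proof.
move=> mF F0 pF.
pose p : R := 2 * pi.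
have p0 : 0 < p := twopi_gt0 R.
rewrite !integral_uniform//; last first.
  exact: measurableT_comp mF (measurable_shiftR s).
congr (_ * _)%E.
rewrite -!integral_itv_bndo_bndc; last 2 first.
- exact: measurable_funTS.
- apply: measurable_funTS.
  exact: measurableT_comp mF (measurable_shiftR s).
pose z : int := Num.floor (s / p).
have /andP[zs sz] := floor_itv (s / p).
pose a := s - p * z%:~R.
rewrite -(@ge0_integral_periodic p a F)//; last 2 first.
- have h1 : z%:~R * p <= s by rewrite -ler_pdivlMr.
  have : s < (z + 1)%:~R * p by rewrite -ltr_pdivrMr.
  rewrite intrD mulrDl mul1r => h2.
  by apply/andP; split; rewrite /a (mulrC p); lra.
- by move=> x; have := pF x 1; rewrite mulr1.
apply: eq_integral => x _.
by rewrite -(pF (shiftR a x) z) /a -/p; congr F; rewrite /shiftR; ring.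
Qed.
End CircleShift.

Section TorusShift.
Variable R : realType.
Notation T1 := (measurableTypeR R).
Notation Tn n := (n.-tuple T1).

Definition tshift n (s : 'rV[R]_n) (x : Tn n) : Tn n :=
  [tuple shiftR (s 0 i) (tnth x i) | i < n].

Lemma measurable_tshift n (s : 'rV[R]_n) : measurable_fun setT (tshift s).
Proof.
apply/measurable_fun_tnthP => i.
rewrite (_ : _ \o _ = shiftR (s 0 i) \o (fun x : Tn n => tnth x i)); last first.
  by apply/funext => x /=; rewrite tnth_mktuple.
apply: measurableT_comp; first exact: measurable_shiftR.
exact: measurable_tnth.
Qed.

Lemma tshift0 n (x : Tn n) : tshift 0 x = x.
Proof. by apply: eq_from_tnth => i; rewrite tnth_mktuple /shiftR mxE addr0. Qed.

Lemma tshiftD n (s t : 'rV[R]_n) (x : Tn n) : tshift s (tshift t x) = tshift (s + t) x.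
Proof.
by apply: eq_from_tnth => i; rewrite !tnth_mktuple /shiftR mxE -addrA (addrC (s 0 i)).
Qed.

(* The vectors of (2 pi Z)^n. *)
Definition lattice n (z : 'rV[int]_n) : 'rV[R]_n :=
  map_mx (fun k => 2 * pi * k%:~R) z.

Definition lattice_periodic n (S : Type) (f : Tn n -> S) :=
  forall (z : 'rV[int]_n) x, f (tshift (lattice z) x) = f x.

Lemma tshift_cons n (s : 'rV[R]_n.+1) a (y : Tn n) :
  tshift s (tcons (a, y)) =
  tcons (shiftR (s 0 0) a, tshift (\row_i s 0 (lift ord0 i)) y).
Proof.
apply: eq_from_tnth => i; rewrite tnth_mktuple.
have [j ->|->] := unliftP ord0 i.
  by rewrite /tcons !tnthS tnth_mktuple mxE.
by rewrite /tcons !tnth0.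
Qed.

Lemma torus_shift n (s : 'rV[R]_n) (f : Tn n -> \bar R) :
  measurable_fun setT f -> (forall x, 0 <= f x)%E -> lattice_periodic f ->
  (\int[torus R n]_x f (tshift s x) = \int[torus R n]_x f x)%E.
Proof.
elim: n s f => [|n IH] s f mf f0 pf.
  by apply: eq_integral => x _; congr f; apply: eq_from_tnth => -[].
have mfc : measurable_fun setT (f \o @tcons R n).
  exact: measurableT_comp mf (@measurable_tcons R n).
have mfs : measurable_fun setT (fun x => f (tshift s x)).
  exact: measurableT_comp mf (measurable_tshift s).
rewrite /= !ge0_integral_distribution//.
pose G := fubini_F (torus R n) (f \o @tcons R n).
have mG : measurable_fun setT G 
  by apply: measurable_fun_fubini_tonelli_F => // x; exact: f0.
rewrite !fubini_tonelli1//; last 3 first.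
- by move=> ?; exact: f0.
- exact: measurableT_comp mfs (@measurable_tcons R n).
- by move=> ?; exact: f0.
rewrite -[RHS](circle_shift (s 0 0)) => //.
- apply: eq_integral => a _; rewrite /fubini_F/=.
  under eq_integral do rewrite tshift_cons.
  apply: (IH (\row_i s 0 (lift ord0 i))
    (fun y => f (tcons (shiftR (s 0 0) a, y)))) => //.
    apply: measurableT_comp mfc _ => //.
  move=> z y.
  rewrite -[RHS](pf (\row_i oapp (z 0) 0 (unlift ord0 i))) tshift_cons.
  congr (f (tcons (_, tshift _ _))).
    by rewrite !mxE unlift_none/= mulr0 /shiftR addr0.
  by apply/rowP => i; rewrite !mxE liftK.
- by move=> a; apply: integral_ge0 => y _; exact: f0.
- move=> a z; apply: eq_integral => y _ /=.
  rewrite -[RHS](pf (\row_i oapp (fun=> 0) z (unlift ord0 i))) tshift_cons.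
  congr (f (tcons (_, _))); first by rewrite !mxE unlift_none.
  rewrite -[LHS]tshift0; congr tshift; apply/rowP => i.
  by rewrite !mxE liftK/= mulr0.
Qed.
End TorusShift.

Section L2.
Variables (R : realType) (n : nat).
Notation T1 := (measurableTypeR R).
Notation Tn n := (n.-tuple T1).
Local Open Scope complex_scope.

Definition csq (z : R[i]) : R := (complex.Re z) ^+ 2 + (complex.Im z) ^+ 2.

Lemma cReD (a b : R[i]) : complex.Re (a + b) = complex.Re a + complex.Re b.
Proof. by case: a b => [? ?] []. Qed.
Lemma cImD (a b : R[i]) : complex.Im (a + b) = complex.Im a + complex.Im b.
Proof. by case: a b => [? ?] []. Qed.
Lemma cReM (a b : R[i]) :
  complex.Re (a * b) = complex.Re a * complex.Re b - complex.Im a * complex.Im b.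
Proof. by case: a b => [? ?] []. Qed.
Lemma cImM (a b : R[i]) :
  complex.Im (a * b) = complex.Re a * complex.Im b + complex.Im a * complex.Re b.
Proof. by case: a b => [? ?] []. Qed.

Lemma csq_ge0 z : 0 <= csq z. Proof. by rewrite addr_ge0 ?sqr_ge0. Qed.

Lemma csqM a b : csq (a * b) = csq a * csq b.
Proof. by case: a b => [a b] [c d]; rewrite /csq/=; ring. Qed.

Lemma csqD_le t a b : 0 < t -> csq (a + b) <= (1 + t) * csq a + (1 + t^-1) * csq b.
Proof.
case: a b => [a b] [c d] t0; rewrite /csq/= -subr_ge0.
have -> : (1 + t) * (a ^+ 2 + b ^+ 2) + (1 + t^-1) * (c ^+ 2 + d ^+ 2) -
  ((a + c) ^+ 2 + (b + d) ^+ 2) = t^-1 * ((t * a - c) ^+ 2 + (t * b - d) ^+ 2).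
  by field; rewrite gt_eqF.
by rewrite mulr_ge0 ?invr_ge0 ?(ltW t0)// addr_ge0 ?sqr_ge0.
Qed.

Lemma csq_eq0 z : csq z = 0 -> z = 0.
Proof.
case: z => a b; rewrite /csq/= => /eqP.
by rewrite paddr_eq0 ?sqr_ge0// !sqrf_eq0 => /andP[/eqP-> /eqP->].
Qed.

Implicit Types f g : Tn n -> R[i].

(* Functions on T^n = R^n / (2 pi Z)^n are represented by (2 pi Z)^n-periodic
   functions on R^n. *)
Definition l2_prop f : Prop :=
  [/\ lattice_periodic f, measurable_fun setT (@complex.Re R \o f), measurable_fun setT (@complex.Im R \o f)
    & (\int[torus R n]_x (csq (f x))%:E < +oo)%E].

Definition l2_pred : {pred Tn n -> R[i]} := fun f => `[< l2_prop f >].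

Lemma measurable_csq f : measurable_fun setT (@complex.Re R \o f) ->
  measurable_fun setT (@complex.Im R \o f) -> measurable_fun setT (fun x => csq (f x)).
Proof. by move=> mr mi; apply: measurable_funD; exact: measurable_funX. Qed.

Lemma l2_submod : submod_closed l2_pred.
Proof.
split=> [|a f g]; rewrite !unfold_in.
  apply/asboolP; split; first by [].
  - rewrite (_ : _ \o _ = cst 0)//.
  - rewrite (_ : _ \o _ = cst 0)//.
  - under eq_integral do rewrite /csq/= expr0n addr0.
    by rewrite integral0 ltry.
move=> /asboolP[pf rf jf lf] /asboolP[pg rg jg lg]; apply/asboolP.
have mr : measurable_fun setT (@complex.Re R \o (a *: f + g)).
  rewrite (_ : _ \o _ = ((cst (complex.Re a) \* (@complex.Re R \o f)) \- (cst (complex.Im a) \* (@complex.Im R \o f)))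
     \+ (@complex.Re R \o g)); last first.
    by apply/funext => x /=; rewrite -cReM -cReD.
  apply: measurable_funD => //; apply: measurable_funB; exact: measurable_funM.
have mi : measurable_fun setT (@complex.Im R \o (a *: f + g)).
  rewrite (_ : _ \o _ = ((cst (complex.Re a) \* (@complex.Im R \o f)) \+ (cst (complex.Im a) \* (@complex.Re R \o f)))
     \+ (@complex.Im R \o g)); last first.
    by apply/funext => x /=; rewrite -cImM -cImD.
  apply: measurable_funD => //; apply: measurable_funD; exact: measurable_funM.
split=> [z x| | |]; [by rewrite -[LHS]/(a * f _ + g _) pf pg|exact: mr|exact: mi|].
have mcf := @measurable_csq f rf jf.
have mcg := @measurable_csq g rg jg.
have c0 (h : Tn n -> R[i]) x : (0 <= (csq (h x))%:E)%E by rewrite lee_fin csq_ge0.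
have k0 : (0 <= (2 * csq a)%:E)%E by rewrite lee_fin mulr_ge0 ?csq_ge0.
have mEf : measurable_fun setT (fun x => (csq (f x))%:E) by exact/measurable_EFinP.
have mEg : measurable_fun setT (fun x => (csq (g x))%:E) by exact/measurable_EFinP.
have mEf' := measurable_funeM (2 * csq a)%:E mEf.
have mEg' := measurable_funeM 2%:E mEg.
apply: (@le_lt_trans _ _ (\int[torus R n]_x
  ((2 * csq a)%:E * (csq (f x))%:E + 2%:E * (csq (g x))%:E))%E).
  apply: ge0_le_integral => //.
  - by apply/measurable_EFinP; exact: measurable_csq.
  - exact: emeasurable_funD.
  - move=> x _; rewrite -!EFinM -EFinD lee_fin.
    have := @csqD_le 1 (a * f x) (g x) ltr01.
    by rewrite invr1 csqM mulrA.
rewrite ge0_integralD//; last 2 first.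
- by move=> x _; rewrite mule_ge0.
- by move=> x _; rewrite mule_ge0.
rewrite !ge0_integralZl// lte_add_pinfty// lte_mul_pinfty//.
Qed.

HB.instance Definition _ := GRing.isSubmodClosed.Build _ _ l2_pred l2_submod.

Record l2fun := L2Fun { l2val :> Tn n -> R[i] ; _ : l2val \in l2_pred }.
HB.instance Definition _ := [isSub for l2val].
HB.instance Definition _ := [Choice of l2fun by <:].
HB.instance Definition _ := [SubChoice_isSubLmodule of l2fun by <:].

Implicit Types u v : l2fun.

Lemma l2funP u : l2_prop u. Proof. exact/asboolP/(valP u). Qed.

Lemma l2funDE u v x : (u + v) x = u x + v x. Proof. by []. Qed.
Lemma l2funNE u x : (- u) x = - u x. Proof. by []. Qed.
Lemma l2funZE a u x : (a *: u) x = a * u x. Proof. by []. Qed.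
Lemma l2fun0E x : (0 : l2fun) x = 0. Proof. by []. Qed.

Definition sqint u : R := fine (\int[torus R n]_x (csq (u x))%:E)%E.

Lemma measurable_csqE u : measurable_fun setT (fun x => (csq (u x))%:E).
Proof. by apply/measurable_EFinP; case: (l2funP u) => ? ? ? ?; exact: measurable_csq. Qed.

Lemma csqE_ge0 u x : (0 <= (csq (u x))%:E)%E.
Proof. by rewrite lee_fin csq_ge0. Qed.

Hint Resolve measurable_csqE csqE_ge0 : core.

Lemma sqintE u : (\int[torus R n]_x (csq (u x))%:E)%E = (sqint u)%:E.
Proof.
rewrite /sqint fineK// ge0_fin_numE; first by case: (l2funP u).
exact: integral_ge0.
Qed.

Lemma sqint_ge0 u : 0 <= sqint u.
Proof. by rewrite -lee_fin -sqintE integral_ge0. Qed.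

Lemma sqintZ a u : sqint (a *: u) = csq a * sqint u.
Proof.
apply: EFin_inj; rewrite -sqintE EFinM -sqintE -ge0_integralZl ?lee_fin ?csq_ge0//.
by apply: eq_integral => x _; rewrite l2funZE csqM.
Qed.

Lemma sqintD_le t u v : 0 < t ->
  sqint (u + v) <= (1 + t) * sqint u + (1 + t^-1) * sqint v.
Proof.
move=> t0; rewrite -lee_fin EFinD !EFinM -!sqintE.
have h1 : (0 <= (1 + t)%:E)%E by rewrite lee_fin addr_ge0// ltW.
have h2 : (0 <= (1 + t^-1)%:E)%E by rewrite lee_fin addr_ge0// invr_ge0 ltW.
rewrite -!ge0_integralZl// -ge0_integralD//; last 4 first.
- by move=> x _; rewrite mule_ge0.
- exact: measurable_funeM.
- by move=> x _; rewrite mule_ge0.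
- exact: measurable_funeM.
apply: ge0_le_integral => //.
  by apply: emeasurable_funD; exact: measurable_funeM.
by move=> x _; rewrite -!EFinM -EFinD lee_fin csqD_le.
Qed.

Definition l2norm u := Num.sqrt (sqint u).

Lemma sq_l2norm u : l2norm u ^+ 2 = sqint u.
Proof. by rewrite sqr_sqrtr ?sqint_ge0. Qed.

Lemma l2norm_ge0 u : 0 <= l2norm u. Proof. exact: sqrtr_ge0. Qed.

Lemma l2normD u v : l2norm (u + v) <= l2norm u + l2norm v.
Proof.
have := sqintD_le u v; rewrite -!sq_l2norm.
move: (l2norm_ge0 (u + v)) (l2norm_ge0 u) (l2norm_ge0 v).
move: (l2norm (u + v)) (l2norm u) (l2norm v) => c a b c0 a0 b0 h.
apply/ler_addgt0Pr => e e0.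
pose a' := a + e / 2; pose b' := b + e / 2.
have a'0 : 0 < a' by rewrite /a'; lra.
have b'0 : 0 < b' by rewrite /b'; lra.
suff : c <= a' + b' by rewrite /a' /b'; lra.
have t0 : 0 < b' / a' by rewrite divr_gt0.
rewrite -(@ler_pXn2r _ 2)// ?nnegrE//; last by lra.
apply: (le_trans (h _ t0)).
apply: (@le_trans _ _ ((1 + b' / a') * a' ^+ 2 + (1 + (b' / a')^-1) * b' ^+ 2)).
  apply: lerD; apply: ler_pM => //; rewrite ?addr_ge0 ?invr_ge0 ?(ltW t0) ?sqr_ge0//;
    rewrite ler_pXn2r ?nnegrE// /a' /b'; lra.
rewrite le_eqVlt; apply/orP; left; apply/eqP; field.
by rewrite !gt_eqF.
Qed.

Lemma l2normZ a u : l2norm (a *: u) = Num.sqrt (csq a) * l2norm u.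
Proof. by rewrite /l2norm sqintZ sqrtrM ?csq_ge0. Qed.

Definition l2null u : Prop := {ae torus R n, forall x, u x = 0}.

Lemma l2nullP u : l2null u <-> l2norm u = 0.
Proof.
have -> : l2norm u = 0 <-> (\int[torus R n]_x `|(csq (u x))%:E| = 0)%E.
  under eq_integral do rewrite gee0_abs//.
  rewrite sqintE; split => [h|[h]]; last by rewrite /l2norm h sqrtr0.
  by rewrite -sq_l2norm h expr0n.
split => [h|/ae_eq_integral_abs h].
  apply/ae_eq_integral_abs => //.
  by apply: filterS h => x -> _; rewrite /csq expr0n addr0.
by apply: filterS (h _ _) => // x /(_ I) [] /csq_eq0.
Qed.

Definition l2null_pred : {pred l2fun} := fun u => `[< l2null u >].

Lemma l2null_zmod : zmod_closed l2null_pred.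
Proof.
split=> [|u v]; rewrite !unfold_in.
  by apply/asboolP; exact: aeW.
move=> /asboolP hu /asboolP hv; apply/asboolP.
by move: hu hv; apply: filterS2 => x; rewrite l2funDE l2funNE => -> ->; rewrite subr0.
Qed.

HB.instance Definition _ := GRing.isZmodClosed.Build _ l2null_pred l2null_zmod.

(* L^2(T^n): square-integrable functions modulo almost everywhere equality. *)
Definition L2 : Type := Quotient.quot (l2null_pred : zmodClosed l2fun).
HB.instance Definition _ := Choice.on L2.
HB.instance Definition _ := GRing.Zmodule.on L2.
HB.instance Definition _ := EqQuotient.on L2.

End L2.

Section L2space.
Variables (R : realType) (n : nat).
Notation T1 := (measurableTypeR R).
Notation Tn := (n.-tuple T1).
Notation L2 := (L2 R n).
Local Open Scope quotient_scope.
Implicit Types (u v : l2fun R n) (xi eta : L2).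

Definition class u : L2 := \pi_L2 u.

Lemma class_eq u v : class u = class v <-> l2null (u - v).
Proof.
split=> [/eqP|h].
  by rewrite -Quotient.idealrBE => /asboolP.
by apply/eqP; rewrite -Quotient.idealrBE; apply/asboolP.
Qed.

Lemma class_repr xi : class (repr xi) = xi.
Proof. exact: reprK. Qed.

Lemma repr_class u : l2null (repr (class u) - u).
Proof. by apply/class_eq; exact: class_repr. Qed.

Lemma classD u v : class (u + v) = class u + class v.
Proof. exact: (raddfD (\pi_L2 : {additive _ -> _})). Qed.

Definition L2scale (a : R[i]) xi : L2 := class (a *: repr xi).

Lemma L2scale_class a u : L2scale a (class u) = class (a *: u).
Proof.
apply/class_eq; rewrite -scalerBr.
apply: filterS (repr_class u) => x; rewrite l2funZE => ->; exact: mulr0.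
Qed.

Lemma L2ind (P : L2 -> Prop) : (forall u, P (class u)) -> forall xi, P xi.
Proof. by move=> h xi; rewrite -(class_repr xi). Qed.

Lemma L2scaleA a b xi : L2scale a (L2scale b xi) = L2scale (a * b) xi.
Proof. by elim/L2ind: xi => u; rewrite !L2scale_class scalerA. Qed.
Lemma L2scale1 xi : L2scale 1 xi = xi.
Proof. by elim/L2ind: xi => u; rewrite !L2scale_class scale1r. Qed.
Lemma L2scaleDr a : {morph L2scale a : xi eta / xi + eta}.
Proof.
by elim/L2ind => u; elim/L2ind => v; rewrite -classD !L2scale_class scalerDr classD.
Qed.
Lemma L2scaleDl xi : {morph L2scale^~ xi : a b / a + b}.
Proof. by elim/L2ind: xi => u a b; rewrite !L2scale_class scalerDl classD. Qed.

HB.instance Definition _ := GRing.Zmodule_isLmodule.Build R[i] L2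
  L2scaleA L2scale1 L2scaleDr L2scaleDl.

Lemma classZ a u : class (a *: u) = a *: class u.
Proof. by rewrite -L2scale_class. Qed.

Definition L2norm xi : R := l2norm (repr xi).

Lemma L2norm_class u : L2norm (class u) = l2norm u.
Proof.
have h u1 u2 : l2null (u1 - u2) -> l2norm u1 <= l2norm u2.
  move=> /l2nullP h; rewrite -(subrK u2 u1).
  by apply: le_trans (l2normD _ _) _; rewrite h add0r.
apply/eqP; rewrite eq_le; apply/andP; split; apply: h; first exact: repr_class.
by apply/class_eq; rewrite class_repr.
Qed.

Lemma L2norm_ge0 xi : 0 <= L2norm xi. Proof. exact: l2norm_ge0. Qed.

Lemma L2normD xi eta : L2norm (xi + eta) <= L2norm xi + L2norm eta.
Proof.
elim/L2ind: xi => u; elim/L2ind: eta => v.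
by rewrite -classD !L2norm_class l2normD.
Qed.

Lemma L2normZ a xi : L2norm (a *: xi) = Num.sqrt (csq a) * L2norm xi.
Proof. by elim/L2ind: xi => u; rewrite -classZ !L2norm_class l2normZ. Qed.

Lemma class0 : class 0 = 0.
Proof. exact: (raddf0 (\pi_L2 : {additive _ -> _})). Qed.

Lemma L2norm_eq0 xi : L2norm xi = 0 -> xi = 0.
Proof.
elim/L2ind: xi => u; rewrite L2norm_class => /l2nullP h.
by rewrite -class0; apply/class_eq; rewrite subr0.
Qed.

Lemma L2norm0 : L2norm 0 = 0.
Proof. by rewrite -(scale0r (0 : L2)) L2normZ /csq/= expr0n addr0 sqrtr0 mul0r. Qed.

(* (2 pi)^-n \int_(T^n) xi(x) conj(eta(x)) dx, linear in xi. *)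
Definition L2inner xi eta : R[i] :=
  Complex (\int[torus R n]_x complex.Re (repr xi x * (repr eta x)^*))%R
          (\int[torus R n]_x complex.Im (repr xi x * (repr eta x)^*))%R.

End L2space.

Section BoundedOperators.
Variables (R : realType) (n : nat).
Notation L2 := (L2 R n).
Local Open Scope complex_scope.
Implicit Types (xi eta : L2).

Definition bop_prop (T : L2 -> L2) : Prop :=
  (forall (a : R[i]) xi eta, T (a *: xi + eta) = a *: T xi + T eta) /\
  exists M : R, forall xi, L2norm (T xi) <= M * L2norm xi.

Definition bop_pred : {pred L2 -> L2} := fun T => `[< bop_prop T >].

Lemma bop_zmod : zmod_closed bop_pred.
Proof.
split=> [|S T]; rewrite !unfold_in.
  apply/asboolP; split => [a xi eta|]; first by rewrite /= scaler0 addr0.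
  by exists 0 => xi; rewrite mul0r L2norm0.
move=> /asboolP[lS [M bS]] /asboolP[lT [N bT]]; apply/asboolP; split => [a xi eta|].
  rewrite -[LHS]/(S _ - T _) -[(S - T) xi]/(S xi - T xi) -[(S - T) eta]/(S eta - T eta).
  by rewrite lS lT scalerBr opprD addrACA.
exists (M + N) => xi; rewrite -[(S - T) xi]/(S xi - T xi) mulrDl.
apply: le_trans (L2normD _ _) _; rewrite lerD//.
by rewrite -scaleN1r L2normZ /csq/= oppr0 expr0n addr0 sqrrN expr1n sqrtr1 mul1r.
Qed.

HB.instance Definition _ := GRing.isZmodClosed.Build _ bop_pred bop_zmod.

(* Bounded operators on L^2(T^n). *)
Record bop := Bop { bopf :> L2 -> L2 ; _ : bopf \in bop_pred }.
HB.instance Definition _ := [isSub for bopf].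
HB.instance Definition _ := [Choice of bop by <:].
HB.instance Definition _ := [SubChoice_isSubZmodule of bop by <:].

Implicit Types S T : bop.

Lemma bopP T : bop_prop T. Proof. exact/asboolP/(valP T). Qed.

Lemma bop_ext S T : S =1 T -> S = T.
Proof. by move=> h; apply/val_inj/funext. Qed.

Lemma bop_lin T a xi eta : T (a *: xi + eta) = a *: T xi + T eta.
Proof. exact: (bopP T).1. Qed.

Lemma bopD T xi eta : T (xi + eta) = T xi + T eta.
Proof. by have := bop_lin T 1 xi eta; rewrite !scale1r. Qed.

Lemma bop0 T : T 0 = 0.
Proof. by apply: (addrI (T 0)); rewrite -bopD !addr0. Qed.

Lemma bopZ T a xi : T (a *: xi) = a *: T xi.
Proof. by have := bop_lin T a xi 0; rewrite bop0 !addr0. Qed.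

Lemma bopDE S T xi : (S + T) xi = S xi + T xi. Proof. by []. Qed.
Lemma bopNE S xi : (- S) xi = - S xi. Proof. by []. Qed.
Lemma bop0E xi : (0 : bop) xi = 0. Proof. by []. Qed.

Definition mkbop (T : L2 -> L2) (h : bop_prop T) : bop :=
  Bop (asboolT h : T \in bop_pred).

Lemma bop_one_subproof : bop_prop id.
Proof. by split => //; exists 1 => xi; rewrite mul1r. Qed.
Definition bop_one : bop := mkbop bop_one_subproof.

Lemma bop_mul_subproof S T : bop_prop (S \o T).
Proof.
have [[_ [M bS]] [_ [N bT]]] := (bopP S, bopP T).
split => [a xi eta|]; first by rewrite /= !bop_lin.
exists (`|M| * `|N|) => xi /=.
have le_abs (K x : R) : 0 <= x -> K * x <= `|K| * x.
  by move=> x0; rewrite ler_wpM2r// ler_norm.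
apply: le_trans (bS _) _; apply: le_trans (le_abs _ _ (L2norm_ge0 _)) _.
rewrite -mulrA ler_wpM2l//.
by apply: le_trans (bT _) _; apply: le_abs; exact: L2norm_ge0.
Qed.
Definition bop_mul S T : bop := mkbop (bop_mul_subproof S T).

Lemma bop_mulA : associative bop_mul. Proof. by move=> S T U; exact: bop_ext. Qed.
Lemma bop_mul1 : left_id bop_one bop_mul. Proof. by move=> T; exact: bop_ext. Qed.
Lemma bop_1mul : right_id bop_one bop_mul. Proof. by move=> T; exact: bop_ext. Qed.
Lemma bop_mulDl : left_distributive bop_mul +%R.
Proof. by move=> S T U; exact: bop_ext. Qed.
Lemma bop_mulDr : right_distributive bop_mul +%R.
Proof. by move=> S T U; apply: bop_ext => xi; rewrite /= bopD. Qed.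

HB.instance Definition _ := GRing.Zmodule_isPzRing.Build bop
  bop_mulA bop_mul1 bop_1mul bop_mulDl bop_mulDr.

Lemma bopME S T xi : (S * T) xi = S (T xi). Proof. by []. Qed.
Lemma bop1E xi : (1 : bop) xi = xi. Proof. by []. Qed.

Lemma cscalar_subproof (z : R[i]) : bop_prop (fun xi => z *: xi).
Proof.
split => [a xi eta|]; first by rewrite scalerDr !scalerA mulrC.
by exists (Num.sqrt (csq z)) => xi; rewrite L2normZ.
Qed.
Definition cscalar (z : R[i]) : bop := mkbop (cscalar_subproof z).

(* bop carries the lmodType structure over R, so that the derivatives of maps
   from R^n to bop are those of the library; complex scalars act by left
   multiplication by `cscalar z`. *)
Definition bop_scale (c : R) T : bop := cscalar c%:C * T.

Lemma bop_scaleE c T xi : bop_scale c T xi = c%:C *: T xi. Proof. by []. Qed.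

Lemma bop_scaleA a b T : bop_scale a (bop_scale b T) = bop_scale (a * b) T.
Proof. by apply: bop_ext => xi; rewrite !bop_scaleE scalerA rmorphM. Qed.
Lemma bop_scale1 : left_id 1 bop_scale.
Proof. by move=> T; apply: bop_ext => xi; rewrite !bop_scaleE scale1r. Qed.
Lemma bop_scaleDr : right_distributive bop_scale +%R.
Proof. by move=> a S T; apply: bop_ext => xi; rewrite !bop_scaleE !bopDE scalerDr. Qed.
Lemma bop_scaleDl T : {morph bop_scale^~ T : a b / a + b}.
Proof. by move=> a b; apply: bop_ext => xi; rewrite bopDE !bop_scaleE rmorphD scalerDl. Qed.

HB.instance Definition _ := GRing.Zmodule_isLmodule.Build R bop
  bop_scaleA bop_scale1 bop_scaleDr bop_scaleDl.

Definition opnorm T : R := sup [set L2norm (T xi) | xi in [set xi | L2norm xi <= 1]].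

Lemma opnorm_has_sup T : has_sup [set L2norm (T xi) | xi in [set xi | L2norm xi <= 1]].
Proof.
split; first by exists (L2norm (T 0)); exists 0 => //=; rewrite L2norm0.
have [_ [M bT]] := bopP T; exists `|M| => _ [xi /= x1 <-].
apply: le_trans (bT _) _; apply: le_trans (_ : `|M| * L2norm xi <= _).
  by rewrite ler_wpM2r ?L2norm_ge0// ler_norm.
by rewrite -[leRHS]mulr1 ler_wpM2l.
Qed.

Lemma opnorm_ub T xi : L2norm xi <= 1 -> L2norm (T xi) <= opnorm T.
Proof. by move=> x1; apply: ub_le_sup; [exact: (opnorm_has_sup T).2|exists xi]. Qed.

Lemma opnorm_le T M : (forall xi, L2norm xi <= 1 -> L2norm (T xi) <= M) -> opnorm T <= M.
Proof.
by move=> h; apply: ge_sup; [exact: (opnorm_has_sup T).1|move=> _ [xi x1 <-]; exact: h].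
Qed.

Lemma opnorm_ge0 T : 0 <= opnorm T.
Proof. by apply: le_trans (opnorm_ub _ (_ : L2norm 0 <= 1)); rewrite ?L2norm_ge0// L2norm0. Qed.

Lemma L2normZr (c : R) xi : L2norm (c%:C *: xi) = `|c| * L2norm xi.
Proof. by rewrite L2normZ /csq/= expr0n addr0 sqrtr_sqr. Qed.

Lemma le_opnorm T xi : L2norm (T xi) <= opnorm T * L2norm xi.
Proof.
have [x0|x0] := eqVneq (L2norm xi) 0.
  by rewrite (L2norm_eq0 x0) bop0 L2norm0 mulr0.
have xgt0 : 0 < L2norm xi by rewrite lt_neqAle eq_sym x0 L2norm_ge0.
rewrite -ler_pdivrMr//.
rewrite mulrC -[(L2norm xi)^-1]ger0_norm ?invr_ge0 ?L2norm_ge0//.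
rewrite -L2normZr -bopZ; apply: opnorm_ub.
by rewrite L2normZr ger0_norm ?invr_ge0 ?L2norm_ge0// mulVf.
Qed.

Lemma opnormD S T : opnorm (S + T) <= opnorm S + opnorm T.
Proof.
apply: opnorm_le => xi x1; rewrite bopDE.
by apply: le_trans (L2normD _ _) _; rewrite lerD// opnorm_ub.
Qed.

Lemma opnormZ_le (c : R) T : opnorm (c *: T) <= `|c| * opnorm T.
Proof.
apply: opnorm_le => xi x1; rewrite -[(c *: T) xi]/(c%:C *: T xi) L2normZr.
by rewrite ler_wpM2l// opnorm_ub.
Qed.

Lemma opnormZ (c : R) T : opnorm (c *: T) = `|c| * opnorm T.
Proof.
apply/eqP; rewrite eq_le opnormZ_le/=.
have [->|c0] := eqVneq c 0; first by rewrite normr0 mul0r opnorm_ge0.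
rewrite -[X in _ * opnorm X](scalerK c0).
apply: le_trans (_ : `|c| * (`|c^-1| * opnorm (c *: T)) <= _).
  by rewrite ler_wpM2l// opnormZ_le.
by rewrite mulrA -normrM mulfV// normr1 mul1r.
Qed.

Lemma opnorm_eq0 T : opnorm T = 0 -> T = 0.
Proof.
move=> T0; apply: bop_ext => xi; apply: L2norm_eq0; apply/eqP.
by rewrite eq_le L2norm_ge0 andbT -(mul0r (L2norm xi)) -T0 le_opnorm.
Qed.

HB.instance Definition _ := Lmodule_isNormed.Build R bop opnormD opnormZ opnorm_eq0.


End BoundedOperators.

Section WeightedTranslations.
Variables (R : realType) (n : nat).
Notation T1 := (measurableTypeR R).
Notation Tn := (n.-tuple T1).
Notation L2 := (L2 R n).
Local Open Scope complex_scope.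
Implicit Types (u v : l2fun R n) (xi eta : L2).

Definition is_phase (p : Tn -> R[i]) : Prop :=
  [/\ lattice_periodic p, measurable_fun setT (@complex.Re R \o p),
      measurable_fun setT (@complex.Im R \o p) & forall x, csq (p x) = 1].

Variables (p : Tn -> R[i]) (hp : is_phase p) (s : 'rV[R]_n).

(* f |-> p(x) f(x + s) with |p| = 1: translations and the generators U_j are of
   this form. *)
Definition wtrans_fun (f : Tn -> R[i]) : Tn -> R[i] := fun x => p x * f (tshift s x).

Lemma csq_wtrans f x : csq (wtrans_fun f x) = csq (f (tshift s x)).
Proof. by case: hp => _ _ _ h; rewrite /wtrans_fun csqM h mul1r. Qed.

Lemma integral_csq_wtrans u :
  (\int[torus R n]_x (csq (wtrans_fun u x))%:E = \int[torus R n]_x (csq (u x))%:E)%E.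
Proof.
under eq_integral do rewrite csq_wtrans.
have [pu _ _ _] := l2funP u.
apply: (@torus_shift R n s (fun x => (csq (u x))%:E)).
- exact: measurable_csqE.
- by move=> x; exact: csqE_ge0.
- by move=> z x; rewrite pu.
Qed.

Lemma wtrans_subproof u : wtrans_fun u \in @l2_pred R n.
Proof.
have [pp mpr mpi p1] := hp; have [pu mur mui iu] := l2funP u.
have mr : measurable_fun setT ((@complex.Re R \o u) \o tshift s).
  exact: measurableT_comp mur (measurable_tshift s).
have mi : measurable_fun setT ((@complex.Im R \o u) \o tshift s).
  exact: measurableT_comp mui (measurable_tshift s).
apply/asboolP; split.
- move=> z x; rewrite /wtrans_fun pp; congr (_ * _).
  by rewrite tshiftD addrC -tshiftD pu.
- rewrite (_ : _ \o _ = (@complex.Re R \o p) \* ((@complex.Re R \o u) \o tshift s)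
      \- (@complex.Im R \o p) \* ((@complex.Im R \o u) \o tshift s)).
    by apply: measurable_funB; exact: measurable_funM.
  by apply/funext => x /=; rewrite -cReM.
- rewrite (_ : _ \o _ = (@complex.Re R \o p) \* ((@complex.Im R \o u) \o tshift s)
      \+ (@complex.Im R \o p) \* ((@complex.Re R \o u) \o tshift s)).
    by apply: measurable_funD; exact: measurable_funM.
  by apply/funext => x /=; rewrite -cImM.
- by rewrite integral_csq_wtrans.
Qed.

Definition wtrans u : l2fun R n := L2Fun (wtrans_subproof u).

Lemma wtransE u x : wtrans u x = p x * u (tshift s x). Proof. by []. Qed.

Lemma l2norm_wtrans u : l2norm (wtrans u) = l2norm u.
Proof. by rewrite /l2norm /sqint -[in RHS]integral_csq_wtrans. Qed.

Lemma wtrans_lin a u v : wtrans (a *: u + v) = a *: wtrans u + wtrans v.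
Proof.
apply/val_inj/funext => x; rewrite -[RHS]/(a * (p x * u _) + p x * v _).
by rewrite -[LHS]/(p x * (a * u _ + v _)) mulrDr mulrCA.
Qed.

Lemma wtransB u v : wtrans (u - v) = wtrans u - wtrans v.
Proof. by rewrite -(scaleN1r v) addrC wtrans_lin scaleN1r addrC. Qed.

Definition L2wtrans xi : L2 := class (wtrans (repr xi)).

Lemma L2wtrans_class u : L2wtrans (class u) = class (wtrans u).
Proof.
apply/class_eq/l2nullP; rewrite -wtransB l2norm_wtrans.
exact/l2nullP/repr_class.
Qed.

Lemma L2wtrans_bop : bop_prop L2wtrans.
Proof.
split => [a|].
  elim/L2ind => u; elim/L2ind => v.
  by rewrite -classZ -classD !L2wtrans_class wtrans_lin classD classZ.
exists 1 => xi; elim/L2ind: xi => u.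
by rewrite L2wtrans_class !L2norm_class l2norm_wtrans mul1r.
Qed.

Definition bop_wtrans : bop R n := mkbop L2wtrans_bop.

End WeightedTranslations.

Section NCTorus.
Variables (R : realType) (n : nat).
Notation T1 := (measurableTypeR R).
Notation Tn := (n.-tuple T1).
Notation B := (bop R n).
Local Open Scope complex_scope.

Lemma phase1 : is_phase (fun _ : Tn => 1 : R[i]).
Proof.
split => //.
- exact: measurable_cst.
- exact: measurable_cst.
- by move=> x; rewrite /csq/= expr1n expr0n addr0.
Qed.

Definition expi (t : R) : R[i] := cos t +i* sin t.

Lemma expiDint (t : R) (z : int) : expi (t + 2 * pi * z%:~R) = expi t.
Proof.
have E (m : nat) (w : R) : expi (w + 2 * pi * m%:R) = expi w.
  elim: m w => [|m IH] w; first by rewrite mulr0 addr0.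
  rewrite -[m.+1%:R]natr1 mulrDr mulr1 addrA -[RHS]IH /expi.
  rewrite [X in _ + X](_ : 2 * pi = pi *+ 2); last by rewrite mulr_natl.
  by rewrite cosD2pi sinD2pi.
case: z => m; first exact: E.
by rewrite NegzE mulrNz mulrN -[LHS](E m.+1) subrK.
Qed.

Lemma phase_coord (j : 'I_n) : is_phase (fun x : Tn => expi (tnth x j : R)).
Proof.
split.
- by move=> z x; rewrite tnth_mktuple /shiftR /lattice mxE expiDint.
- apply: (@measurableT_comp _ _ _ _ _ _ (@cos R)); last exact: measurable_tnth.
  by apply: continuous_measurable_fun; exact: continuous_cos.
- apply: (@measurableT_comp _ _ _ _ _ _ (@sin R)); last exact: measurable_tnth.
  by apply: continuous_measurable_fun; exact: continuous_sin.
- by move=> x; rewrite /csq/= cos2Dsin2.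
Qed.

(* (V_s xi)(x) = xi(x + s); V_s^-1 = V_{-s}. *)
Definition translation (s : 'rV[R]_n) : B := bop_wtrans phase1 s.

Lemma translationE s (u : l2fun R n) : translation s (class u) = class (wtrans phase1 s u).
Proof. exact: L2wtrans_class. Qed.

Lemma translation_invr s : translation s * translation (- s) = 1.
Proof.
apply: bop_ext; elim/L2ind => u; rewrite bopME !translationE bop1E; congr class.
apply/val_inj/funext => x; rewrite -[LHS]/(1 * (1 * u _)) !mul1r.
by rewrite tshiftD addNr tshift0.
Qed.

(* (U_j xi)(x) = e^{i x_j} xi(x + pi theta_j), theta_j the j-th column. *)
Definition generator (theta : 'M[R]_n) (j : 'I_n) : B :=
  bop_wtrans (phase_coord j) (\row_k (pi * theta k j)).

Lemma generatorE theta j (u : l2fun R n) :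
  generator theta j (class u) = class (wtrans (phase_coord j) (\row_k (pi * theta k j)) u).
Proof. exact: L2wtrans_class. Qed.

End NCTorus.

Section Inverse.
Variable A : pzRingType.

Definition is_inverse (a b : A) : Prop := a * b = 1 /\ b * a = 1.

Definition inverse (a : A) : A := xget 0 [set b | is_inverse a b].

Lemma is_inverse_uniq a b c : is_inverse a b -> is_inverse a c -> b = c.
Proof. by move=> [_ ba] [ac _]; rewrite -[b]mulr1 -ac mulrA ba mul1r. Qed.

Lemma inverseE a b : is_inverse a b -> inverse a = b.
Proof.
move=> ab; apply: (is_inverse_uniq _ ab).
by rewrite /inverse; case: xgetP => [c -> //|/(_ b)].
Qed.

End Inverse.

Section SmoothTorus.
Variables (R : realType) (n : nat).
Notation B := (bop R n).
Implicit Types (T S a b : B) (theta : 'M[R]_n).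
Local Open Scope complex_scope.

Definition is_adjoint T S : Prop :=
  forall xi eta, L2inner (T xi) eta = L2inner xi (S eta).

(* Adjoints of bounded operators exist and are unique (Riesz), so the default
   value 0 is never used; the same holds for `inverse`, `sqrtop` and `mxlog`
   below on the arguments to which they are applied. *)
Definition adj T : B := xget 0 [set S | is_adjoint T S].

Definition selfadjoint T : Prop := is_adjoint T T.

Definition cstar_subalgebra (A : set B) : Prop :=
  [/\ closed A,
      forall S T, A S -> A T -> A (S + T),
      forall S T, A S -> A T -> A (S * T),
      forall (z : R[i]) T, A T -> A (cscalar n z * T)
    & forall T, A T -> A (adj T)].

(* The C*-algebra A_theta generated by U_1, ..., U_n; it contains 1 because
   U_j is unitary. *)
Definition nct theta : set B :=
  smallest cstar_subalgebra [set generator theta j | j in [set: 'I_n]].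

Definition torus_action (s : 'rV[R]_n) T : B := translation s * T * translation (- s).

Definition dpartial (j : 'I_n) (F : 'rV[R]_n -> B) : 'rV[R]_n -> B :=
  'D_(delta_mx 0 j) F.

(* All iterated partial derivatives, in operator norm, exist and are
   continuous. As A_theta is norm-closed, they take their values in A_theta as
   soon as F does. *)
Definition Cinfty (F : 'rV[R]_n -> B) : Prop :=
  forall l : seq 'I_n, let G := foldr dpartial F l in
    continuous G /\ forall j s, derivable G s (delta_mx 0 j).

Definition smooth_nct theta : set B :=
  [set u | nct theta u /\ Cinfty (fun s => torus_action s u)].

Definition deriv (j : 'I_n) (u : B) : B := dpartial j (fun s => torus_action s u) 0.

(* In the order of R[i], 0 <= z means that z is real and nonnegative; on a
   complex Hilbert space such operators are selfadjoint. *)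
Definition op_positive T : Prop := forall xi, 0 <= L2inner (T xi) xi.

(* M_m(A_theta) acts on the direct sum of m copies of L^2(T^n). *)
Definition mx_positive m (g : 'M[B]_m) : Prop :=
  forall xi : 'I_m -> L2 R n,
    0 <= \sum_(i < m) \sum_(j < m) L2inner (g i j (xi j)) (xi i).

(* A_theta^{++}. *)
Definition positive_invertible theta (k : B) : Prop :=
  [/\ smooth_nct theta k, op_positive k
    & exists2 b, smooth_nct theta b & is_inverse k b].

(* GL_n^+(A_theta^R). *)
Definition riemannian_metric theta (g : 'M[B]_n) : Prop :=
  [/\ forall i j, smooth_nct theta (g i j) /\ selfadjoint (g i j),
      mx_positive g
    & exists2 h : 'M[B]_n, is_inverse g h &
        forall i j, smooth_nct theta (h i j) /\ selfadjoint (h i j)].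

Definition spectrum m (a : 'M[B]_m) : set R[i] :=
  [set z | ~ exists b : 'M[B]_m, is_inverse ((cscalar n z)%:M - a) b].

(* The principal logarithm; only its values on the half-plane Re z > 0 are used,
   where the argument of z is atan (Im z / Re z). *)
Definition clog (z : R[i]) : R[i] :=
  ln (Num.sqrt (csq z)) +i* atan (complex.Im z / complex.Re z).

(* The N-th Riemann sum, over equally spaced points, of
     (2 i pi)^-1 \oint_{|z - c| = r} f(z) (z - a)^-1 dz
       = (2 pi)^-1 \int_0^{2 pi} f(z_t) (z_t - c) (z_t - a)^-1 dt,
   where z_t = c + r e^{it}. When the circle avoids the spectrum of a, the
   integrand is continuous and 2 pi-periodic in t. *)
Definition cauchy_sum (f : R[i] -> R[i]) m (a : 'M[B]_m) (c r : R) (N : nat) :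
    'M[B]_m :=
  \sum_(k < N) let z := c%:C + r%:C * expi (2 * pi * k%:R / N%:R) in
    cscalar n (N%:R^-1 * f z * (z - c%:C)) *: inverse ((cscalar n z)%:M - a).

(* Holomorphic functional calculus. The spectrum of a positive invertible a is a
   compact subset of ]0, +oo[, hence it is enclosed by a circle contained in the
   half-plane Re z > 0, on which the principal logarithm is holomorphic. *)
Definition is_mxlog m (a L : 'M[B]_m) : Prop :=
  exists c r : R, [/\ 0 < r < c,
    forall z, spectrum a z -> `|z - c%:C| < r%:C
    & cauchy_sum clog a c r @ \oo --> L].

Definition mxlog m (a : 'M[B]_m) : 'M[B]_m := xget 0 [set L | is_mxlog a L].

Definition expop a : B := limn (series (fun k => (k`!%:R : R)^-1 *: a ^+ k)).

Definition sqrtop a : B := xget 0 [set b | op_positive b /\ b * b = a].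

Definition det_metric (g : 'M[B]_n) : B := expop (\tr (mxlog g)).

Definition nu (g : 'M[B]_n) : B := sqrtop (det_metric g).

(* The 1-form \sum_i theta^i w_i, given by its coordinates w_i in the dual
   basis. *)
Definition form := 'rV[B]_n.

Definition form_scale a (w : form) : form := \row_i (a * w 0 i).

Definition differential (u : B) : form := \row_i deriv i u.

(* (w, z)_h = \sum_(i, j) z_i^* h^{ij} w_j, to be used with h = g^-1. *)
Definition pairing (h : 'M[B]_n) (w z : form) : B :=
  \sum_(i < n) \sum_(j < n) adj (z 0 i) * h i j * w 0 j.

Definition codifferential (g : 'M[B]_n) (w : form) : B :=
  inverse (nu g) * \sum_(i < n) \sum_(j < n)
    deriv i (sqrtop (nu g) * inverse g i j * sqrtop (nu g) * w 0 j).

Definition laplace_beltrami (g : 'M[B]_n) (u : B) : B :=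
  - codifferential g (differential u).

Definition conformal (k : B) (g : 'M[B]_n) : 'M[B]_n :=
  \matrix_(i, j) (k * g i j * k).

End SmoothTorus.

(* Main.v *)
(* Since k commutes with the entries of g, log (k^2 g) = 2 log k + log g, so that
   Tr log (k g k) = 2n log k + Tr log g and nu (k g k) = k^n nu g. The inverse of
   k g k is k^-2 g^-1, hence the operand of the i-th derivative in the codifferential
   is multiplied by k^(n - 2); the Leibniz rule then yields k^-2 times the
   Laplacian of g, plus a term in d (k^(n - 2)).

   The logarithm is a limit of Riemann sums of a Cauchy integral over a circle of
   center c and radius r < c. Write the positive element as a = c + T with T
   selfadjoint and |T| < r. The averages of z^(p+1) (z - T)^-1 over the points
   z = r e^(2 i pi k / N) tend to T^p, so the Riemann sums converge to the power
   series of log (c + T). Its sum is selfadjoint, and its exponential is a: for a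
   selfadjoint T, |p(T)| is at most the supremum of |p| over [-|T|, |T|], which
   reduces the claim to real numbers. As the exponential is injective on
   selfadjoint elements, this characterises log a, whatever the circle. Moreover
   the derivations, being closed, pass to the limit in the power series of exp and
   log, so that nu g and its square root are differentiable. *)
From mathcomp Require Import all_boot all_order all_algebra.
From mathcomp Require Import all_classical all_reals all_analysis.
From mathcomp Require Import measurable_realfun.
From mathcomp Require Import complex.
From mathcomp Require Import ring lra.
Require Import Defs.
Set Implicit Arguments.
Unset Strict Implicit.
Unset Printing Implicit Defensive.
Import Order.TTheory GRing.Theory Num.Theory.
Import numFieldNormedType.Exports Normc.
Local Open Scope classical_set_scope.
Local Open Scope ring_scope.

(** * Power series of the principal logarithm *)

Section ComplexLog.
Variable R : realType.
Local Open Scope complex_scope.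
Implicit Types (z w : R[i]) (a b c r t x y : R).

(** The entries of [g] need not commute with one another, so the density is reached only through
    [mxlog], a Cauchy integral over some circle of which nothing is known but that it encloses the
    spectrum and stays in the right half-plane. Logarithms and exponentials are needed both for
    operators (log k) and for matrices of operators (log g): the calculus is developed for an
    abstract [opAlg] and instantiated twice. Selfadjointness is symmetry for the real part of the
    inner product, a condition stable under norm limits; the only adjoint to compute, that of
    sqrt(nu) times a derivative of k^(n - 2), belongs to a product of two selfadjoint factors.
    Inverses come from lower bounds on quadratic forms, through the Neumann series around a large
    scalar. Derivations are handled through one estimate: the difference quotients of x along a
    group of contractions are bounded by the norm of the derivative of x, uniformly in the step. It
    yields both the Leibniz rule and closedness. *)

Lemma normc_ge0 z : 0 <= normc z.
Proof. by case: z => ? ?; exact: sqrtr_ge0. Qed.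

Lemma normcR a : normc a%:C = `|a|.
Proof. by rewrite /= expr0n addr0 sqrtr_sqr. Qed.

Lemma normc_Re z : `|complex.Re z| <= normc z.
Proof. by case: z => a b /=; rewrite -sqrtr_sqr ler_wsqrtr// lerDl sqr_ge0. Qed.

Lemma normc_Im z : `|complex.Im z| <= normc z.
Proof. by case: z => a b /=; rewrite -sqrtr_sqr ler_wsqrtr// lerDr sqr_ge0. Qed.

Lemma normc_le_ReIm z : normc z <= `|complex.Re z| + `|complex.Im z|.
Proof.
case: z => a b /=; rewrite -(@ler_pXn2r _ 2)// ?nnegrE ?sqrtr_ge0 ?addr_ge0//.
rewrite sqr_sqrtr ?addr_ge0 ?sqr_ge0// sqrrD !real_normK ?num_real//.
by rewrite lerD2r lerDl mulrn_wge0// mulr_ge0.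
Qed.

Lemma Re_sum (I : Type) (s : seq I) (P : pred I) (F : I -> R[i]) :
  complex.Re (\sum_(i <- s | P i) F i) = \sum_(i <- s | P i) complex.Re (F i).
Proof. by elim/big_rec2: _ => //= i y z _ <-; rewrite cReD. Qed.

Lemma Im_sum (I : Type) (s : seq I) (P : pred I) (F : I -> R[i]) :
  complex.Im (\sum_(i <- s | P i) F i) = \sum_(i <- s | P i) complex.Im (F i).
Proof. by elim/big_rec2: _ => //= i y z _ <-; rewrite cImD. Qed.

Lemma Re_realM a z : complex.Re (a%:C * z) = a * complex.Re z.
Proof. by rewrite cReM/= mul0r subr0. Qed.

Lemma Im_realM a z : complex.Im (a%:C * z) = a * complex.Im z.
Proof. by rewrite cImM/= mul0r addr0. Qed.

Lemma normcX z k : normc (z ^+ k) = normc z ^+ k.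
Proof. by elim: k => [|k IH]; rewrite ?expr0 ?normc1// !exprS normcM IH. Qed.

Definition log_coeff c (k : nat) : R := (-1) ^+ k / (k.+1%:R * c ^+ k.+1).

Definition clog_part c w (N : nat) : R[i] :=
  (ln c)%:C + \sum_(0 <= k < N) (log_coeff c k)%:C * w ^+ k.+1.

(** The derivative in t of [clog_part c (t w) N], that is, the truncated geometric series of w / (c
    + t w). *)
Definition dclog_part c w t (N : nat) : R[i] :=
  \sum_(0 <= k < N) ((-1) ^+ k / c ^+ k.+1 * t ^+ k)%:C * w ^+ k.+1.

Lemma dclog_partE c w t N : c%:C + t%:C * w != 0 -> c != 0 ->
  w / (c%:C + t%:C * w) - dclog_part c w t N =
  w / (c%:C + t%:C * w) * (- (t%:C * w / c%:C)) ^+ N.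
Proof.
move=> h c0; have c0' : c%:C != 0 by rewrite eq_complex/= (negbTE c0).
apply: (mulIf h); rewrite mulrBl [X in _ = X]mulrAC !divfK//.
elim: N => [|N IH]; first by rewrite /dclog_part big_nil mul0r subr0 expr0 mulr1.
rewrite /dclog_part big_nat_recr//= -/(dclog_part c w t N) mulrDl opprD addrA IH.
have -> : ((-1) ^+ N / c ^+ N.+1 * t ^+ N)%:C * w ^+ N.+1 =
    w / c%:C * (- (t%:C * w / c%:C)) ^+ N.
  rewrite -[- (_ / _)]mulN1r !exprMn exprVn !rmorphM/= fmorphV !rmorphXn/= rmorphN1 !exprS.
  by field; rewrite c0' expf_neq0.
by rewrite exprS; move: (_ ^+ N) => q; field.
Qed.

Lemma is_derive_affine a b t : is_derive t 1 (fun s => a + s * b) b.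
Proof.
have H := is_deriveD (is_derive_cst a t 1)
  (is_deriveM (is_derive_id t (1 : R)) (is_derive_cst b t 1)).
apply: (is_derive_eq H).
by rewrite add0r scaler0 add0r [_ *: _]mulr1.
Qed.

Lemma is_derive_scale b t : is_derive t 1 (fun s => s * b) b.
Proof.
have -> : (fun s => s * b) = (fun s => 0 + s * b) by apply/funext => s; rewrite add0r.
exact: is_derive_affine.
Qed.

(** Only derivatives along the segment from c to c + w are taken, one real component at a time,
    which reduces holomorphy of the logarithm to the derivatives of [ln], [Num.sqrt] and [atan]. *)
Lemma is_derive_Re_clog c w t : 0 < c + t * complex.Re w ->
  is_derive t 1 (fun s => complex.Re (clog (c%:C + s%:C * w)))
    (complex.Re (w / (c%:C + t%:C * w))).
Proof.
case: w => x y /= h.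
have -> : (fun s => complex.Re (clog (c%:C + s%:C * (x +i* y)))) =
    (@ln R) \o (Num.sqrt \o (fun s => (c + s * x) ^+ 2 + (s * y) ^+ 2)).
  by apply/funext => s; rewrite /clog /csq/=; congr (ln (Num.sqrt (_ ^+ 2 + _ ^+ 2))); ring.
have u0 : 0 < (c + t * x) ^+ 2 + (t * y) ^+ 2 by rewrite ltr_pwDl ?exprn_gt0 ?sqr_ge0.
have s0 : 0 < Num.sqrt ((c + t * x) ^+ 2 + (t * y) ^+ 2) by rewrite sqrtr_gt0.
have hu : is_derive t 1 (fun s => (c + s * x) ^+ 2 + (s * y) ^+ 2)
    (2 * (c + t * x) * x + 2 * (t * y) * y).
  exact: is_derive_eq (is_deriveD (is_deriveX 2 (is_derive_affine c x t))
    (is_deriveX 2 (is_derive_scale y t))) _.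
have h1 := @is_derive1_comp R Num.sqrt _ t _ _ (is_derive1_sqrt u0) hu.
have h2 := @is_derive1_comp R (@ln R) _ t _ _ (is_derive1_ln s0) h1.
apply: (is_derive_eq h2).
set u := (c + t * x) ^+ 2 + _ in u0 s0 *.
have su : Num.sqrt u ^+ 2 = u by rewrite sqr_sqrtr// ltW.
have -> : (Num.sqrt u)^-1 * ((2 * Num.sqrt u)^-1 * (2 * (c + t * x) * x + 2 * (t * y) * y)) =
   ((c + t * x) * x + t * y * y) / u.
  by rewrite -[in RHS]su; field; rewrite gt_eqF.
rewrite /= (_ : c + (t * x - 0 * y) = c + t * x); last by ring.
rewrite (_ : 0 + (t * y + 0 * x) = t * y); last by ring.
by rewrite -/u; field; rewrite gt_eqF.
Qed.

Lemma is_derive_Im_clog c w t : 0 < c + t * complex.Re w ->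
  is_derive t 1 (fun s => complex.Im (clog (c%:C + s%:C * w)))
    (complex.Im (w / (c%:C + t%:C * w))).
Proof.
case: w => x y /= h.
have -> : (fun s => complex.Im (clog (c%:C + s%:C * (x +i* y)))) =
    atan \o (fun s => (s * y) / (c + s * x)).
  by apply/funext => s; rewrite /clog/=; congr (atan (_ / _)); ring.
have h0 : c + t * x != 0 by rewrite gt_eqF.
have hv : is_derive t 1 (fun s => (s * y) / (c + s * x))
   (y * c / (c + t * x) ^+ 2).
  have H := is_deriveM (is_derive_scale y t)
    (@is_deriveV _ (fun s => c + s * x) t _ 1 h0 (is_derive_affine c x t)).
  apply: (is_derive_eq H).
  by rewrite -![_ *: _]/(_ * _); field.
apply: (is_derive_eq (@is_derive1_comp R atan _ t _ _ (is_derive1_atan _) hv)).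
rewrite /= (_ : c + (t * x - 0 * y) = c + t * x); last by ring.
rewrite (_ : 0 + (t * y + 0 * x) = t * y); last by ring.
have u0 : (c + t * x) ^+ 2 + (t * y) ^+ 2 != 0.
  by rewrite gt_eqF// ltr_pwDl ?exprn_gt0 ?sqr_ge0.
by field; rewrite h0 u0.
Qed.

Lemma MVT_unit_interval (f df : R -> R) :
  (forall t, t \in `[0, 1] -> is_derive t 1 f (df t)) ->
  exists2 t, t \in `[0, 1] & f 1 - f 0 = df t.
Proof.
move=> hf; have cf : {within `[0, 1], continuous f}.
  by apply: derivable_within_continuous => t /hf[].
have hf' t : t \in `]0, 1[ -> is_derive t 1 f (df t).
  by rewrite in_itv/= => /andP[t0 t1]; apply: hf; rewrite in_itv/= !ltW.
have [t t01] := MVT_segment ler01 hf' cf.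
by rewrite subr0 mulr1; exists t.
Qed.

(** * Taylor remainder of the logarithm; [phi] is the real or the imaginary part *)

Section Part.
Variables (phi : R[i] -> R).
Hypothesis phiD : forall z w, phi (z + w) = phi z + phi w.
Hypothesis phiZ : forall a z, phi (a%:C * z) = a * phi z.
Hypothesis phi_le : forall z, `|phi z| <= normc z.

Lemma is_derive_clog_part c w t N : c != 0 ->
  is_derive t 1 (fun s => phi (clog_part c (s%:C * w) N)) (phi (dclog_part c w t N)).
Proof.
move=> c0; elim: N => [|N IH].
  have -> : (fun s => phi (clog_part c (s%:C * w) 0)) = cst (phi (ln c)%:C).
    by apply/funext => s; rewrite /clog_part big_nil addr0.
  rewrite /dclog_part big_nil (_ : phi 0 = 0); first exact: is_derive_cst.
  by have := phiZ 0 0; rewrite mulr0 mul0r.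
have -> : (fun s => phi (clog_part c (s%:C * w) N.+1)) =
    (fun s => phi (clog_part c (s%:C * w) N)) + 
    (fun s => s ^+ N.+1 * (log_coeff c N * phi (w ^+ N.+1))).
  apply/funext => s; rewrite /clog_part big_nat_recr//= addrA phiD; congr (_ + _).
  by rewrite exprMn mulrCA -rmorphXn/= !phiZ.
rewrite /dclog_part big_nat_recr//= phiD; apply: is_deriveD => //.
have -> : (fun s => s ^+ N.+1 * (log_coeff c N * phi (w ^+ N.+1))) =
    (id : R -> R) ^+ N.+1 * cst (log_coeff c N * phi (w ^+ N.+1)).
  by apply/funext => s; rewrite !fctE.
have H := is_deriveM (is_deriveX N.+1 (is_derive_id t (1 : R)))
  (is_derive_cst (log_coeff c N * phi (w ^+ N.+1)) t 1).
apply: (is_derive_eq H).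
rewrite -![_ *: _]/(_ * _) mulr0 add0r phiZ /log_coeff /=.
by field; rewrite expf_neq0//= addrC natr1 pnatr_eq0.
Qed.

(** Mean value theorem for the difference between the logarithm and its partial sum along t w: it
    vanishes at t = 0, and its derivative is the geometric remainder w / (c + t w) (- t w / c)^N,
    where |c + t w| >= c - r. The theorem holds for real functions only, hence the component
    [phi]. *)
Lemma clog_approx_part c r w N : 0 < r < c -> normc w <= r ->
  (forall t, t \in `[0, 1] -> is_derive t 1 (fun s => phi (clog (c%:C + s%:C * w)))
    (phi (w / (c%:C + t%:C * w)))) ->
  `|phi (clog (c%:C + w) - clog_part c w N)| <= r / (c - r) * (r / c) ^+ N.
Proof.
move=> /andP[r0 rc] wr hd; have c0 : 0 < c by apply: lt_trans rc.
have cn0 : c != 0 by rewrite gt_eqF.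
have phiN z : phi (- z) = - phi z.
  by rewrite -mulN1r -(rmorphN1 (real_complex R)) phiZ mulN1r.
pose f s := phi (clog (c%:C + s%:C * w)) - phi (clog_part c (s%:C * w) N).
pose df t := phi (w / (c%:C + t%:C * w)) - phi (dclog_part c w t N).
have hf t : t \in `[0, 1] -> is_derive t 1 f (df t).
  by move=> t01; apply: is_deriveB; [exact: hd|exact: is_derive_clog_part].
have [t t01] := MVT_unit_interval hf.
have -> : f 1 = phi (clog (c%:C + w) - clog_part c w N).
  by rewrite /f rmorph1 mul1r phiD phiN.
have -> : f 0 = 0.
  rewrite /f rmorph0 mul0r addr0 /clog_part big1 ?addr0 => [|k _]; last first.
    by rewrite expr0n mulr0.
  by rewrite /clog /csq/= expr0n addr0 sqrtr_sqr ger0_norm ?(ltW c0)// mul0r atan0 subrr.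
rewrite !subr0 => ->.
move: t01; rewrite in_itv/= => /andP[t0 t1].
have tw : normc (t%:C * w) <= r.
  rewrite normcM /= expr0n addr0 sqrtr_sqr ger0_norm//; apply: le_trans wr.
  by rewrite ler_piMl// normc_ge0.
have low : c - r <= normc (c%:C + t%:C * w).
  have e : normc (c%:C + t%:C * w - t%:C * w) = c.
    by rewrite addrK normcR ger0_norm// ltW.
  rewrite lerBlDr -[leLHS]e; apply: le_trans (le_normcD _ _) _.
  by rewrite normcN lerD2l.
have cr0 : 0 < c - r by rewrite subr_gt0.
have lowp : 0 < normc (c%:C + t%:C * w) by apply: lt_le_trans low.
have nz : c%:C + t%:C * w != 0.
  by apply/eqP => h; move: lowp; rewrite h normc0 ltxx.
rewrite /df -phiN -phiD dclog_partE//; apply: le_trans (phi_le _) _.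
rewrite !normcM normcX normcN normcV normcM normcV normcR (ger0_norm (ltW c0)).
apply: ler_pM; rewrite ?mulr_ge0 ?invr_ge0 ?exprn_ge0 ?normc_ge0 ?mulr_ge0 ?invr_ge0 ?normc_ge0 ?(ltW c0)//.
  by apply: ler_pM; rewrite ?invr_ge0 ?normc_ge0// lef_pV2 ?posrE.
rewrite lerXn2r ?nnegrE ?mulr_ge0 ?invr_ge0 ?normc_ge0 ?(ltW c0) ?(ltW r0)//.
by rewrite ler_wpM2r ?invr_ge0 ?(ltW c0).
Qed.

End Part.

(** The bound is uniform on the disc |w| <= r, as needed to exchange the Riemann sums with the power
    series. The factor 2 counts the real and imaginary parts. *)
Lemma clog_approx c r w N : 0 < r < c -> normc w <= r ->
  normc (clog (c%:C + w) - clog_part c w N) <= 2 * (r / (c - r) * (r / c) ^+ N).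
Proof.
move=> rc wr; have pos t : t \in `[0, 1] -> 0 < c + t * complex.Re w.
  rewrite in_itv/= => /andP[t0 t1]; have := le_trans (normc_Re w) wr.
  rewrite ler_norml => /andP[h1 h2]; move/andP: rc => [r0 rc].
  have : t * (- r) <= t * complex.Re w by rewrite ler_wpM2l.
  have : t * r <= r by rewrite ler_piMl// ltW.
  lra.
apply: le_trans (normc_le_ReIm _) _; rewrite mulr2n mulrDl mul1r; apply: lerD.
- apply: clog_approx_part rc wr _.
  + exact: cReD.
  + exact: Re_realM.
  + exact: normc_Re.
  + by move=> t /pos; exact: is_derive_Re_clog.
- apply: clog_approx_part rc wr _.
  + exact: cImD.
  + exact: Im_realM.
  + exact: normc_Im.
  + by move=> t /pos; exact: is_derive_Im_clog.
Qed.

Lemma clog_approx_cvg0 c r : 0 < r < c ->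
  (fun N => 2 * (r / (c - r) * (r / c) ^+ N)) @ \oo --> (0 : R).
Proof.
move=> /andP[r0 rc]; have c0 : 0 < c by apply: lt_trans rc.
have -> : (fun N => 2 * (r / (c - r) * (r / c) ^+ N)) =
    (fun N => 2 * (r / (c - r)) * (r / c) ^+ N) by apply/funext => N; rewrite mulrA.
have h : (fun N => (r / c) ^+ N) @ \oo --> (0 : R).
  apply: cvg_expr; rewrite ger0_norm ?divr_ge0 ?(ltW r0) ?(ltW c0)//.
  by rewrite ltr_pdivrMr// mul1r.
have := cvgM (cvg_cst (2 * (r / (c - r)))) h.
by rewrite mulr0; apply.
Qed.

Lemma ln_approx c r x N : 0 < r < c -> `|x| <= r ->
  `|ln (c + x) - (ln c + \sum_(0 <= k < N) log_coeff c k * x ^+ k.+1)|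
     <= 2 * (r / (c - r) * (r / c) ^+ N).
Proof.
move=> rc xr; have xr' : normc x%:C <= r by rewrite normcR.
have := clog_approx N rc xr'; congr (_ <= _).
have -> : clog (c%:C + x%:C) = (ln (c + x))%:C.
  move: rc xr; rewrite ler_norml => /andP[r0 rc] /andP[h1 h2].
  rewrite -rmorphD /clog /csq/= expr0n addr0 sqrtr_sqr ger0_norm; last lra.
  by rewrite mul0r atan0.
rewrite /clog_part; under eq_bigr do rewrite -rmorphXn -rmorphM/=.
by rewrite -rmorph_sum -rmorphD -rmorphB normcR.
Qed.

End ComplexLog.

(** * Algebras of bounded operators *)

(* A complete algebra of bounded operators on a complex inner product space,
   containing the scalars zop z; rip is the real part of the inner product. Its two
   instances are the bounded operators on L^2(T^n) and the square matrices of such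
   operators. *)
Record opAlg (R : realType) := OpAlg {
  hsp : lmodType R[i];
  rip : hsp -> hsp -> R;
  ripDl : forall x y z, rip (x + y) z = rip x z + rip y z;
  ripC : forall x y, rip x y = rip y x;
  ripZl : forall (a : R) x y, rip (a%:C%C *: x) y = a * rip x y;
  rip_csq : forall z x, rip (z *: x) (z *: x) = csq z * rip x x;
  rip_ge0 : forall x, 0 <= rip x x;
  rip_eq0 : forall x, rip x x = 0 -> x = 0;
  alg :> pzRingType;
  act : alg -> hsp -> hsp;
  act_lin : forall T a x y, act T (a *: x + y) = a *: act T x + act T y;
  actD : forall S T x, act (S + T) x = act S x + act T x;
  actM : forall S T x, act (S * T) x = act S (act T x);
  act1 : forall x, act 1 x = x;
  act_inj : forall S T, (forall x, act S x = act T x) -> S = T;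
  act_bnd : forall T, exists M, forall x,
    Num.sqrt (rip (act T x) (act T x)) <= M * Num.sqrt (rip x x);
  zop : R[i] -> alg;
  act_zop : forall z x, act (zop z) x = z *: x;
  alg_complete : forall u : nat -> alg,
    (forall e, 0 < e -> exists N, forall p q, (N <= p)%N -> (N <= q)%N -> forall x,
       Num.sqrt (rip (act (u p - u q) x) (act (u p - u q) x)) <= e * Num.sqrt (rip x x)) ->
    exists l, forall e, 0 < e -> exists N, forall p, (N <= p)%N -> forall x,
       Num.sqrt (rip (act (u p - l) x) (act (u p - l) x)) <= e * Num.sqrt (rip x x)
}.

(** * Inner product and operator norm in an abstract algebra *)

Section HilbertSpace.
Variables (R : realType) (O : opAlg R).
Local Notation H := (hsp O).
Local Notation A := (alg O).
Local Open Scope complex_scope.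
Implicit Types (x y z : H) (S T : A) (a b : R).

Definition hn x : R := Num.sqrt (rip x x).

Lemma ripDr x y z : rip x (y + z) = rip x y + rip x z.
Proof. by rewrite ripC ripDl !(ripC _ x). Qed.

Lemma ripZr a x y : rip x (a%:C *: y) = a * rip x y.
Proof. by rewrite ripC ripZl ripC. Qed.

Lemma ripNl x y : rip (- x) y = - rip x y.
Proof. by rewrite -[- x]scaleN1r -[-1 in LHS](rmorphN1 (real_complex R)) ripZl mulN1r. Qed.

Lemma ripNr x y : rip x (- y) = - rip x y.
Proof. by rewrite ripC ripNl ripC. Qed.

Lemma rip0l y : rip 0 y = 0.
Proof. by apply: (addrI (rip 0 y)); rewrite -ripDl !addr0. Qed.

Lemma hn_ge0 x : 0 <= hn x. Proof. exact: sqrtr_ge0. Qed.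

Lemma sqr_hn x : hn x ^+ 2 = rip x x. Proof. by rewrite sqr_sqrtr ?rip_ge0. Qed.

Lemma hn_eq0 x : hn x = 0 -> x = 0.
Proof. by move=> h; apply: rip_eq0; rewrite -sqr_hn h expr0n. Qed.

Lemma hn0 : hn 0 = 0. Proof. by rewrite /hn rip0l sqrtr0. Qed.

(** Stated for numbers because it serves three semidefinite forms: the inner product, the form of a
    positive element, and the integral form on square-integrable functions. *)
Lemma form_CS a b c : 0 <= a -> 0 <= c -> (forall t : R, 0 <= a + 2 * t * b + t ^+ 2 * c) ->
  b ^+ 2 <= a * c.
Proof.
move=> a0 c0 h; have [c00|cn0] := eqVneq c 0.
  (* If c = 0 and b is nonzero, the polynomial would take the value -1 here. *)
  have := h (- (a + 1) / (2 * b)); rewrite c00 mulr0 addr0 mulr0.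
  have [->|bn0] := eqVneq b 0; first by rewrite expr0n.
  have -> : 2 * (- (a + 1) / (2 * b)) * b = - (a + 1) by field.
  lra.
have cp : 0 < c by rewrite lt_neqAle eq_sym cn0.
have := h (- b / c).
have -> : a + 2 * (- b / c) * b + (- b / c) ^+ 2 * c = (a * c - b ^+ 2) / c by field.
by rewrite pmulr_lge0 ?invr_gt0// subr_ge0.
Qed.

Lemma hn_le x M : 0 <= M -> rip x x <= M ^+ 2 -> hn x <= M.
Proof. by move=> M0 h; rewrite -(@ler_pXn2r _ 2)// ?nnegrE ?hn_ge0// sqr_hn. Qed.

Lemma rip_le_hn x y : rip x y <= hn x * hn y.
Proof.
apply: le_trans (ler_norm _) _.
rewrite -(@ler_pXn2r _ 2)// ?nnegrE ?mulr_ge0 ?hn_ge0//.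
rewrite real_normK ?num_real// exprMn !sqr_hn.
apply: form_CS; rewrite ?rip_ge0// => t.
suff -> : rip x x + 2 * t * rip x y + t ^+ 2 * rip y y =
    rip (x + t%:C *: y) (x + t%:C *: y) by exact: rip_ge0.
by rewrite ripDl !ripDr !ripZl !ripZr (ripC y x); ring.
Qed.

Lemma hnD x y : hn (x + y) <= hn x + hn y.
Proof.
apply: hn_le; first by rewrite addr_ge0 ?hn_ge0.
rewrite sqrrD !sqr_hn ripDl !ripDr (ripC y x).
have := rip_le_hn x y; lra.
Qed.

Lemma hnZ (z : R[i]) x : hn (z *: x) = normc z * hn x.
Proof.
rewrite /hn rip_csq sqrtrM ?csq_ge0//; congr (_ * _).
by case: z.
Qed.

Lemma act0r T : act T 0 = 0.
Proof.
by apply: (addrI (act T 0)); have := act_lin T 1 0 0; rewrite !scale1r !addr0.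
Qed.

Lemma actDr T x y : act T (x + y) = act T x + act T y.
Proof. by have := act_lin T 1 x y; rewrite !scale1r. Qed.

Lemma actZr T (z : R[i]) x : act T (z *: x) = z *: act T x.
Proof. by have := act_lin T z x 0; rewrite act0r !addr0. Qed.

Lemma act0 x : act (0 : A) x = 0.
Proof. by apply: (addrI (act 0 x)); rewrite -actD !addr0. Qed.

Lemma actN T x : act (- T) x = - act T x.
Proof. by apply: (addrI (act T x)); rewrite -actD !subrr act0. Qed.

Lemma actB S T x : act (S - T) x = act S x - act T x.
Proof. by rewrite actD actN. Qed.

Lemma zopD (z w : R[i]) : zop O (z + w) = zop O z + zop O w.
Proof. by apply: act_inj => x; rewrite actD !act_zop scalerDl. Qed.

Lemma zopM (z w : R[i]) : zop O (z * w) = zop O z * zop O w.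
Proof. by apply: act_inj => x; rewrite actM !act_zop scalerA. Qed.

Lemma zop1 : zop O 1 = 1.
Proof. by apply: act_inj => x; rewrite act1 !act_zop scale1r. Qed.

Lemma zop0 : zop O 0 = 0.
Proof. by apply: act_inj => x; rewrite act0 !act_zop scale0r. Qed.

Lemma zopC (z : R[i]) T : zop O z * T = T * zop O z.
Proof. by apply: act_inj => x; rewrite !actM !act_zop actZr. Qed.

Lemma zopN (z : R[i]) : zop O (- z) = - zop O z.
Proof. by apply: (addrI (zop O z)); rewrite -zopD !subrr zop0. Qed.

Lemma zopB (z w : R[i]) : zop O (z - w) = zop O z - zop O w.
Proof. by rewrite zopD zopN. Qed.

Lemma zop_nat k : zop O k%:R = k%:R.
Proof. by elim: k => [|k IH]; rewrite ?zop0// -natr1 zopD zop1 IH natr1. Qed.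

Lemma zop_sum (I : Type) (r : seq I) (P : pred I) (F : I -> R[i]) :
  zop O (\sum_(i <- r | P i) F i) = \sum_(i <- r | P i) zop O (F i).
Proof. by elim/big_rec2: _ => [|i y x _ <-]; rewrite ?zop0 ?zopD. Qed.

Definition nrm T : R := sup [set hn (act T x) | x in [set x | hn x <= 1]].

Lemma nrm_has_sup T : has_sup [set hn (act T x) | x in [set x | hn x <= 1]].
Proof.
split; first by exists (hn (act T 0)); exists 0 => //=; rewrite hn0.
have [M bT] := act_bnd T; exists `|M| => _ [x /= x1 <-].
apply: le_trans (bT _) _; apply: le_trans (_ : `|M| * hn x <= _).
  by rewrite ler_wpM2r ?hn_ge0// ler_norm.
by rewrite -[leRHS]mulr1 ler_wpM2l.
Qed.

Lemma nrm_le T M : 0 <= M -> (forall x, hn (act T x) <= M * hn x) -> nrm T <= M.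
Proof.
move=> M0 h; apply: ge_sup; first exact: (nrm_has_sup T).1.
by move=> _ [x x1 <-]; apply: le_trans (h _) _; rewrite -[leRHS]mulr1 ler_wpM2l.
Qed.

Lemma nrm_ge0 T : 0 <= nrm T.
Proof.
have : hn (act T 0) <= nrm T.
  by apply: ub_le_sup; [exact: (nrm_has_sup T).2|exists 0 => //=; rewrite hn0].
by rewrite act0r hn0.
Qed.

Lemma le_nrm T x : hn (act T x) <= nrm T * hn x.
Proof.
have [x0|x0] := eqVneq (hn x) 0.
  by rewrite (hn_eq0 x0) act0r hn0 mulr0.
have xgt0 : 0 < hn x by rewrite lt_neqAle eq_sym x0 hn_ge0.
rewrite -ler_pdivrMr// mulrC.
have E : normc ((hn x)^-1)%:C = (hn x)^-1.
  by rewrite /= expr0n addr0 sqrtr_sqr ger0_norm// invr_ge0 hn_ge0.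
rewrite -[in leLHS]E -hnZ -actZr; apply: ub_le_sup; first exact: (nrm_has_sup T).2.
by exists (((hn x)^-1)%:C *: x) => //=; rewrite hnZ E mulVf.
Qed.

Lemma nrm0 : nrm 0 = 0.
Proof.
apply/eqP; rewrite eq_le nrm_ge0 andbT.
by apply: nrm_le => // x; rewrite act0 hn0 mul0r.
Qed.

Lemma nrm_eq0 T : nrm T = 0 -> T = 0.
Proof.
move=> h; apply: act_inj => x; rewrite act0; apply: hn_eq0; apply/eqP.
by rewrite eq_le hn_ge0 andbT -(mul0r (hn x)) -h le_nrm.
Qed.

Lemma nrmD S T : nrm (S + T) <= nrm S + nrm T.
Proof.
apply: nrm_le; first by rewrite addr_ge0 ?nrm_ge0.
move=> x; rewrite actD mulrDl; apply: le_trans (hnD _ _) _.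
by rewrite lerD ?le_nrm.
Qed.

Lemma nrmM S T : nrm (S * T) <= nrm S * nrm T.
Proof.
apply: nrm_le; first by rewrite mulr_ge0 ?nrm_ge0.
move=> x; rewrite actM; apply: le_trans (le_nrm _ _) _.
by rewrite -mulrA ler_wpM2l ?nrm_ge0 ?le_nrm.
Qed.

Lemma nrm_zop_le (z : R[i]) : nrm (zop O z) <= normc z.
Proof.
apply: nrm_le; first by case: z => ? ?; rewrite sqrtr_ge0.
by move=> x; rewrite act_zop hnZ.
Qed.

Lemma nrmZ_le (z : R[i]) T : nrm (zop O z * T) <= normc z * nrm T.
Proof.
apply: le_trans (nrmM _ _) _.
by rewrite ler_wpM2r ?nrm_ge0 ?nrm_zop_le.
Qed.

Lemma nrmN T : nrm (- T) = nrm T.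
Proof.
have h S : nrm (- S) <= nrm S.
  by apply: nrm_le; rewrite ?nrm_ge0// => x; rewrite actN -scaleN1r hnZ normcN normc1 mul1r le_nrm.
by apply/eqP; rewrite eq_le h/= -{1}[T]opprK h.
Qed.

Lemma nrmB S T : nrm (S - T) <= nrm S + nrm T.
Proof. by rewrite -[nrm T]nrmN nrmD. Qed.

Lemma nrmC S T : nrm (S - T) = nrm (T - S).
Proof. by rewrite -nrmN opprB. Qed.

(** Equality fails when the space is trivial, as for matrices of size 0. *)
Lemma nrm1_le : nrm 1 <= 1.
Proof. by apply: nrm_le => // x; rewrite act1 mul1r. Qed.

Lemma nrmX T k : nrm (T ^+ k) <= nrm T ^+ k.
Proof.
elim: k => [|k IH]; first by rewrite !expr0 nrm1_le.
rewrite !exprS; apply: le_trans (nrmM _ _) _.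
by rewrite ler_wpM2l ?nrm_ge0.
Qed.

Lemma nrm_sum (I : Type) (r : seq I) (P : pred I) (F : I -> A) :
  nrm (\sum_(i <- r | P i) F i) <= \sum_(i <- r | P i) nrm (F i).
Proof.
elim/big_rec2: _ => [|i y x _ h]; first by rewrite nrm0.
by apply: le_trans (nrmD _ _) _; rewrite lerD2l.
Qed.

End HilbertSpace.

(** * Norm convergence and absolutely convergent series *)

Section Convergence.
Variables (R : realType) (O : opAlg R).
Local Notation A := (alg O).
Local Open Scope complex_scope.
Implicit Types (S T l : A) (u v : nat -> A).

(** An [opAlg] carries no topology of its own; [ncvg_bop] and [ncvg_mx] identify this with the
    convergence of operators and of matrices. *)
Definition ncvg u l : Prop := (fun N => nrm (u N - l)) @ \oo --> (0 : R).

Lemma ncvg_le u l (e : nat -> R) :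
  (forall N, nrm (u N - l) <= e N) -> e @ \oo --> 0 -> ncvg u l.
Proof.
move=> h e0; apply: (squeeze_cvgr _ (cvg_cst 0) e0).
by apply: nearW => N; rewrite nrm_ge0 h.
Qed.

Lemma ncvg_near u l (e : R) : ncvg u l -> 0 < e -> \forall N \near \oo, nrm (u N - l) <= e.
Proof.
rewrite /ncvg => /cvgrPdist_le h e0; apply: filterS (h e e0) => N.
by rewrite sub0r normrN ger0_norm ?nrm_ge0.
Qed.

Lemma ncvg_cst l : ncvg (fun=> l) l.
Proof. by rewrite /ncvg subrr nrm0; exact: cvg_cst. Qed.

Lemma ncvgD u v S T : ncvg u S -> ncvg v T -> ncvg (fun N => u N + v N) (S + T).
Proof.
move=> hu hv.
have h : (fun N => nrm (u N - S) + nrm (v N - T)) @ \oo --> (0 : R).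
  by rewrite -[X in _ --> X](addr0 0); exact: cvgD.
apply: (ncvg_le _ h) => N.
by rewrite opprD addrACA nrmD.
Qed.

Lemma ncvgN u S : ncvg u S -> ncvg (fun N => - u N) (- S).
Proof. by move=> hu; apply: (ncvg_le _ hu) => N; rewrite -opprD nrmN. Qed.

Lemma ncvgB u v S T : ncvg u S -> ncvg v T -> ncvg (fun N => u N - v N) (S - T).
Proof. by move=> hu hv; apply: ncvgD => //; apply: ncvgN. Qed.

Lemma nrm_cvg u S : ncvg u S -> (fun N => nrm (u N)) @ \oo --> nrm S.
Proof.
move=> hu; apply/cvgrPdist_le => e e0.
apply: filterS (ncvg_near hu e0) => N h.
apply: le_trans h; rewrite ler_norml; apply/andP; split.
  by rewrite lerNl opprB lerBlDr -{1}[u N](subrK S) nrmD.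
by rewrite lerBlDr -{1}[S](subrK (u N)) nrmC; apply: le_trans (nrmD _ _) _; rewrite nrmC.
Qed.

Lemma ncvgM u v S T : ncvg u S -> ncvg v T -> ncvg (fun N => u N * v N) (S * T).
Proof.
move=> hu hv.
have e0 : (fun N => nrm (u N - S) * nrm (v N) + nrm S * nrm (v N - T)) @ \oo --> (0 : R).
  rewrite -[X in _ --> X]addr0 -[X in _ --> X + _](mul0r (nrm T)) -[X in _ --> _ + X](mulr0 (nrm S)).
  apply: cvgD; apply: cvgM => //; first exact: nrm_cvg.
  exact: cvg_cst.
apply: (ncvg_le _ e0) => N.
have -> : u N * v N - S * T = (u N - S) * v N + S * (v N - T).
  by rewrite mulrBl mulrBr addrA subrK.
apply: le_trans (nrmD _ _) _; apply: lerD; exact: nrmM.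
Qed.

Lemma ncvgZ (z : R[i]) u S : ncvg u S -> ncvg (fun N => zop O z * u N) (zop O z * S).
Proof. by move=> hu; apply: ncvgM => //; apply: ncvg_cst. Qed.

Lemma ncvgX u S k : ncvg u S -> ncvg (fun N => u N ^+ k) (S ^+ k).
Proof.
move=> hu; elim: k => [|k IH]; first by rewrite expr0; exact: ncvg_cst.
under eq_fun do rewrite exprS.
by rewrite exprS; apply: ncvgM.
Qed.

Lemma ncvg_sum (I : Type) (r : seq I) (F : I -> nat -> A) (L : I -> A) :
  (forall i, ncvg (F i) (L i)) ->
  ncvg (fun N => \sum_(i <- r) F i N) (\sum_(i <- r) L i).
Proof.
move=> h; elim: r => [|i r IH].
  under eq_fun do rewrite big_nil.
  by rewrite big_nil; exact: ncvg_cst.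
under eq_fun do rewrite big_cons.
by rewrite big_cons; apply: ncvgD.
Qed.

Lemma ncvg_nrm_le u S (M : R) : ncvg u S -> (forall N, nrm (u N) <= M) -> nrm S <= M.
Proof.
move=> hu h; rewrite -(cvg_lim _ (nrm_cvg hu))//; apply: limr_le.
  by apply/cvg_ex; eexists; exact: nrm_cvg hu.
exact: nearW.
Qed.

Lemma ncvg_uniq u S T : ncvg u S -> ncvg u T -> S = T.
Proof.
move=> hS hT; have := ncvgB hS hT; under eq_fun do rewrite subrr.
move=> h; apply/eqP; rewrite -subr_eq0; apply/eqP/nrm_eq0.
have := nrm_cvg h; rewrite nrm0 => h0.
by rewrite -(cvg_lim _ h0)// lim_cst.
Qed.

Lemma ncvg_shift u S : ncvg u S -> ncvg (fun N => u N.+1) S.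
Proof. by rewrite /ncvg (cvg_shiftS (fun N => nrm (u N - S))). Qed.

Lemma nrm_complete u :
  (forall e : R, 0 < e -> exists N, forall p q, (N <= p)%N -> (N <= q)%N -> nrm (u p - u q) <= e) ->
  exists l, ncvg u l.
Proof.
move=> h; have [|l hl] := @alg_complete _ O u.
  move=> e e0; have [N hN] := h e e0; exists N => p q pN qN x.
  by apply: le_trans (le_nrm _ _) _; rewrite ler_wpM2r ?hn_ge0 ?hN.
exists l; apply/cvgrPdist_le => e e0; have [N hN] := hl e e0.
exists N => // p /= pN; rewrite sub0r normrN ger0_norm ?nrm_ge0//.
by apply: nrm_le; [exact: ltW|move=> x; exact: hN].
Qed.

(** Majorant test. The tail estimate is kept because [expA_tail] needs it, to bound the exponential
    to second order. *)
Lemma ncvg_series u (v : nat -> R) : (forall k, nrm (u k) <= v k) -> cvgn (series v) ->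
  exists2 l, ncvg (fun N => \sum_(0 <= k < N) u k) l &
    forall N, nrm (l - \sum_(0 <= k < N) u k) <= limn (series v) - series v N.
Proof.
move=> uv cv.
have v0 k : 0 <= v k by apply: le_trans (uv k); exact: nrm_ge0.
have nd : nondecreasing_seq (series v).
  by apply/nondecreasing_seqP => k; rewrite seriesSr lerDl.
have D p q : (p <= q)%N -> \sum_(0 <= k < q) u k - \sum_(0 <= k < p) u k = \sum_(p <= k < q) u k.
  by move=> pq; rewrite (@big_cat_nat _ _ _ p)//= addrAC subrr add0r.
have B p q : (p <= q)%N ->
    nrm (\sum_(0 <= k < q) u k - \sum_(0 <= k < p) u k) <= series v q - series v p.
  move=> pq; rewrite D//; apply: le_trans (nrm_sum _ _ _) _.
  by rewrite sub_series_geq//; apply: ler_sum.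
have B' p q : (p <= q)%N ->
    nrm (\sum_(0 <= k < q) u k - \sum_(0 <= k < p) u k) <= limn (series v) - series v p.
  move=> pq; apply: le_trans (B _ _ pq) _; rewrite lerD2r.
  exact: nondecreasing_cvgn_le.
have [|l hl] := @nrm_complete (fun N => \sum_(0 <= k < N) u k).
  move=> e e0; move/cvgrPdist_le: (cv) => /(_ e e0) [N _ hN].
  exists N => p q pN qN.
  wlog pq : p q pN qN / (p <= q)%N.
    by move=> W; have [/W->//|/ltnW qp] := leqP p q; rewrite nrmC W.
  rewrite nrmC; apply: le_trans (B' _ _ pq) _.
  by apply: le_trans (hN p pN); rewrite ler_norm.
exists l => // N.
have hh : ncvg (fun M => \sum_(0 <= k < M + N) u k - \sum_(0 <= k < N) u k)
            (l - \sum_(0 <= k < N) u k).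
  by apply: ncvgB; [rewrite /ncvg (cvg_shiftn N (fun M => nrm (\sum_(0 <= k < M) u k - l)))|exact: ncvg_cst].
by apply: ncvg_nrm_le hh _ => M; apply: B'; rewrite leq_addl.
Qed.

Lemma comm_ncvg u l T : ncvg u l -> (forall N, u N * T = T * u N) -> l * T = T * l.
Proof.
move=> hu h; apply: ncvg_uniq (ncvgM hu (ncvg_cst T)) _.
by under eq_fun do rewrite h; apply: ncvgM hu; exact: ncvg_cst.
Qed.

End Convergence.

(** The defect of the Cauchy product is the corner i + j >= N of the square. Being valid in any
    additive group, the identity applies at once to the operators and to the real series that
    dominates them. *)
Lemma sum_square_triangle (V : zmodType) (F : nat -> nat -> V) N :
  \sum_(0 <= i < N) \sum_(0 <= j < N) F i j - \sum_(0 <= k < N) \sum_(i < k.+1) F i (k - i)%N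
  = \sum_(0 <= i < N) \sum_(N - i <= j < N) F i j.
Proof.
have -> : \sum_(0 <= k < N) \sum_(i < k.+1) F i (k - i)%N =
    \sum_(0 <= i < N) \sum_(0 <= j < N - i) F i j.
  transitivity (\sum_(0 <= k < N) \sum_(0 <= i < N | (i <= k)%N) F i (k - i)%N).
    apply: eq_big_nat => k /andP[_ kN].
    rewrite -(big_mkord xpredT (fun i => F i (k - i)%N)).
    rewrite (big_nat_widen _ _ N)//; apply: eq_bigl => i; by rewrite ltnS.
  rewrite (exchange_big_dep xpredT)//=; apply: eq_big_nat => i /andP[_ iN].
  rewrite -(big_nat_widenl i 0 N xpredT (fun k => F i (k - i)%N))//=.
  rewrite -[X in \sum_(X <= k < N) _]add0n big_addn.
  by apply: eq_bigr => j _; rewrite addnK.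
rewrite -sumrB; apply: eq_big_nat => i /andP[_ iN].
by rewrite (@big_cat_nat _ _ _ (N - i))//= ?leq_subr// addrAC subrr add0r.
Qed.

(** * The exponential *)

Section ExpAlg.
Variables (R : realType) (O : opAlg R).
Local Notation A := (alg O).
Local Open Scope complex_scope.
Implicit Types (S T X Y l : A).

Definition exp_part X (N : nat) : A :=
  \sum_(0 <= k < N) zop O ((k`!%:R)^-1)%:C * X ^+ k.

Definition expA X : A := xget 0 [set l | ncvg (exp_part X) l].

Lemma nrm_exp_term X (b : R) k : nrm X <= b ->
  nrm (zop O ((k`!%:R)^-1)%:C * X ^+ k) <= exp_coeff b k.
Proof.
move=> Xb; apply: le_trans (nrmZ_le _ _) _.
rewrite normcR ger0_norm ?invr_ge0// /exp_coeff/= mulrC ler_wpM2r ?invr_ge0//.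
by apply: le_trans (nrmX _ _) _; rewrite lerXn2r ?nnegrE ?nrm_ge0// (le_trans _ Xb)// nrm_ge0.
Qed.

Lemma exp_part_cvg X : exists2 l, ncvg (exp_part X) l &
    forall N, nrm (l - exp_part X N) <= expR (nrm X) - series (exp_coeff (nrm X)) N.
Proof.
apply: (@ncvg_series _ _ _ (exp_coeff (nrm X))); last exact: is_cvg_series_exp_coeff.
by move=> k; exact: nrm_exp_term.
Qed.

Lemma expA_cvg X : ncvg (exp_part X) (expA X).
Proof.
have [l hl _] := exp_part_cvg X.
by rewrite /expA; case: xgetP => [y -> //|/(_ l)].
Qed.

Lemma expAE X l : ncvg (exp_part X) l -> expA X = l.
Proof. exact/ncvg_uniq/expA_cvg. Qed.

Lemma series_exp_coeff_le (a b : R) N M : 0 <= a <= b -> (N <= M)%N ->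
  series (exp_coeff a) M - series (exp_coeff a) N <=
  series (exp_coeff b) M - series (exp_coeff b) N.
Proof.
move=> /andP[a0 ab] NM; rewrite !sub_series_geq//; apply: ler_sum => k _.
rewrite /exp_coeff/= ler_wpM2r ?invr_ge0//.
by rewrite lerXn2r ?nnegrE// (le_trans a0).
Qed.

Lemma exp_tail_le (a b : R) N : 0 <= a <= b ->
  expR a - series (exp_coeff a) N <= expR b - series (exp_coeff b) N.
Proof.
move=> ab.
have h (c : R) : (fun M => series (exp_coeff c) (M + N)%N - series (exp_coeff c) N) @ \oo -->
    expR c - series (exp_coeff c) N.
  apply: cvgB; last exact: cvg_cst.
  by rewrite (cvg_shiftn N (series (exp_coeff c))); exact: is_cvg_series_exp_coeff.
rewrite -(cvg_lim _ (h a))// -(cvg_lim _ (h b))//; apply: ler_lim.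
- by apply/cvg_ex; eexists; exact: h a.
- by apply/cvg_ex; eexists; exact: h b.
- by apply: nearW => M; apply: series_exp_coeff_le => //; exact: leq_addl.
Qed.

Lemma expA_tail X (b : R) N : nrm X <= b ->
  nrm (expA X - exp_part X N) <= expR b - series (exp_coeff b) N.
Proof.
have [l /expAE-> h] := exp_part_cvg X => Xb.
by apply: le_trans (h N) _; apply: exp_tail_le; rewrite nrm_ge0.
Qed.

Lemma exp_tail_cvg0 (b : R) : (fun N => expR b - series (exp_coeff b) N) @ \oo --> 0.
Proof.
rewrite -[X in _ --> X](subrr (expR b)); apply: cvgB; first exact: cvg_cst.
exact: is_cvg_series_exp_coeff.
Qed.

Lemma binomial_inv_fact i j :
  ((i + j)`!%:R : R)^-1 * 'C(i + j, i)%:R = (i`!%:R)^-1 * (j`!%:R)^-1.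
Proof.
have f0 k : (k`!%:R : R) != 0 by rewrite pnatr_eq0 -lt0n fact_gt0.
apply: (mulfI (f0 (i + j)%N)); rewrite mulVKf//.
rewrite -(bin_fact (leq_addr j i)) addKn !natrM.
by field; rewrite !f0.
Qed.

Lemma binomial_series (B : pzRingType) (c : nat -> B) (x y : B) N :
  (forall i j, c (i + j)%N * 'C(i + j, i)%:R = c i * c j) ->
  (forall k z, c k * z = z * c k) -> x * y = y * x ->
  \sum_(0 <= k < N) c k * (x + y) ^+ k =
  \sum_(0 <= k < N) \sum_(i < k.+1) (c i * x ^+ i) * (c (k - i)%N * y ^+ (k - i)).
Proof.
move=> cf cc xy; apply: eq_bigr => k _.
rewrite addrC exprDn_comm// mulr_sumr; apply: eq_bigr => -[i /= ik] _.
have ki : (i <= k)%N by [].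
have comm : x ^+ i * y ^+ (k - i) = y ^+ (k - i) * x ^+ i.
  by apply: commrX; apply/commr_sym/commrX.
rewrite -comm -mulr_natl mulrA -[in LHS](subnKC ki) cf addKn.
by rewrite -!mulrA; congr (_ * _); rewrite !mulrA cc.
Qed.

(** The defect at rank N is a sum over the corner of the square, bounded term by term by the same
    corner for the real exponentials at |X| and |Y|. The latter tends to 0 by the functional
    equation of [expR]. *)
Lemma expAD X Y : X * Y = Y * X -> expA (X + Y) = expA X * expA Y.
Proof.
move=> XY; pose a := nrm X; pose b := nrm Y.
pose E (c : R) N := series (exp_coeff c) N.
have EE c N : E c N = \sum_(0 <= k < N) (k`!%:R)^-1 * c ^+ k.
  by apply: eq_bigr => k _; rewrite /exp_coeff/= mulrC.
have lim0 : (fun N => E a N * E b N - E (a + b) N) @ \oo --> (0 : R).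
  rewrite -[X in _ --> X](subrr (expR (a + b))); apply: cvgB; last first.
    exact: is_cvg_series_exp_coeff.
  rewrite expRD; apply: cvgM; exact: is_cvg_series_exp_coeff.
have bnd N : nrm (exp_part X N * exp_part Y N - exp_part (X + Y) N)
    <= E a N * E b N - E (a + b) N.
  rewrite !EE [X in _ <= _ - X]binomial_series; last 3 first.
  - exact: binomial_inv_fact.
  - by move=> *; exact: mulrC.
  - exact: mulrC.
  rewrite [exp_part (X + Y) N]binomial_series//; last 2 first.
  - by move=> i j; rewrite -(zop_nat O) -!zopM -(rmorph_nat (real_complex R)) -!rmorphM/= binomial_inv_fact.
  - by move=> *; exact: zopC.
  rewrite [X in nrm (X - _)]big_distrlr/= [X in _ <= X - _]big_distrlr/=.
  rewrite !sum_square_triangle.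
  apply: le_trans (nrm_sum _ _ _) _; apply: ler_sum => i _.
  apply: le_trans (nrm_sum _ _ _) _; apply: ler_sum => j _.
  apply: le_trans (nrmM _ _) _; apply: ler_pM; rewrite ?nrm_ge0//.
  - by rewrite mulrC; exact: nrm_exp_term.
  - by rewrite mulrC; exact: nrm_exp_term.
have h := ncvgB (ncvgM (expA_cvg X) (expA_cvg Y)) (expA_cvg (X + Y)).
have h0 := ncvg_le (l := 0) (u := fun N => exp_part X N * exp_part Y N - exp_part (X + Y) N) _ lim0.
apply/esym/eqP; rewrite -subr_eq0; apply/eqP; apply: ncvg_uniq h _.
by apply: h0 => N; rewrite subr0.
Qed.

(** The rank is a successor because the empty partial sum is 0. *)
Lemma exp_part0 N : exp_part 0 N.+1 = 1.
Proof.
rewrite /exp_part big_nat_recl// big1 => [|k _]; last by rewrite expr0n mulr0.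
by rewrite fact0 invr1 zop1 mul1r expr0 addr0.
Qed.

Lemma expA0 : expA 0 = 1.
Proof.
apply: ncvg_uniq (ncvg_shift (expA_cvg 0)) _.
by under eq_fun do rewrite exp_part0; exact: ncvg_cst.
Qed.

Lemma expA_inverse X : is_inverse (expA X) (expA (- X)).
Proof.
by split; rewrite -expAD ?(mulrN, mulNr)// ?(subrr, addNr) expA0.
Qed.

Lemma exp_part_comm X T N : X * T = T * X -> exp_part X N * T = T * exp_part X N.
Proof.
move=> XT; rewrite mulr_suml mulr_sumr; apply: eq_bigr => k _.
rewrite -mulrA [RHS]mulrA -[T * zop _ _]zopC -[RHS]mulrA; congr (_ * _).
by apply/commr_sym/commrX.
Qed.

Lemma expA_comm X T : X * T = T * X -> expA X * T = T * expA X.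
Proof. by move=> XT; apply: comm_ncvg (expA_cvg X) _ => N; exact: exp_part_comm. Qed.

Lemma expAMn X k : expA (X *+ k) = expA X ^+ k.
Proof.
elim: k => [|k IH]; first by rewrite mulr0n expA0.
by rewrite mulrS exprS expAD ?IH// mulrnAr mulrnAl.
Qed.

End ExpAlg.

(** * Selfadjoint and positive elements *)

Section Selfadjoint.
Variables (R : realType) (O : opAlg R).
Local Notation A := (alg O).
Local Notation H := (hsp O).
Local Open Scope complex_scope.
Implicit Types (S T X Y l : A) (x y : H) (a b c m t : R).

(** Since T is complex linear, replacing y by i y recovers the imaginary part of the usual
    condition. *)
Definition sa T : Prop := forall x y, rip (act T x) y = rip x (act T y).

(** [rip] is only a real part, so its nonnegativity alone would not force T to be selfadjoint. *)
Definition pos T : Prop := sa T /\ forall x, 0 <= rip (act T x) x.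

Lemma sa0 : sa (0 : A).
Proof. by move=> x y; rewrite !act0 [RHS]ripC !rip0l. Qed.

Lemma saD S T : sa S -> sa T -> sa (S + T).
Proof. by move=> hS hT x y; rewrite !actD ripDl ripDr hS hT. Qed.

Lemma saN S : sa S -> sa (- S).
Proof. by move=> hS x y; rewrite !actN ripNl ripNr hS. Qed.

Lemma saB S T : sa S -> sa T -> sa (S - T).
Proof. by move=> hS hT; apply/saD/saN. Qed.

Lemma sa_zop a : sa (zop O a%:C).
Proof. by move=> x y; rewrite !act_zop ripZl ripZr. Qed.

Lemma saM S T : sa S -> sa T -> S * T = T * S -> sa (S * T).
Proof. by move=> hS hT ST x y; rewrite {1}ST !actM hT hS. Qed.

Lemma saZ a T : sa T -> sa (zop O a%:C * T).
Proof. by move=> hT; apply: saM hT (zopC _ _) => //; exact: sa_zop. Qed.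

Lemma sa1 : sa (1 : A).
Proof. by move=> x y; rewrite !act1. Qed.

Lemma saX T k : sa T -> sa (T ^+ k).
Proof.
move=> hT; elim: k => [|k IH]; first by rewrite expr0; exact: sa1.
by rewrite exprS; apply: saM => //; exact: commrX.
Qed.

Lemma sa_sqr T x : sa T -> rip (act (T * T) x) x = rip (act T x) (act T x).
Proof. by move=> hT; rewrite actM hT. Qed.

Lemma pos_sqr T : sa T -> pos (T * T).
Proof.
by move=> hT; split=> [|x]; [exact: saM|rewrite sa_sqr// rip_ge0].
Qed.

Lemma sa_sum (I : Type) (r : seq I) (F : I -> A) :
  (forall i, sa (F i)) -> sa (\sum_(i <- r) F i).
Proof. by move=> h; apply: big_ind => //; [exact: sa0|exact: saD]. Qed.

Lemma norm_rip_le x y : `|rip x y| <= hn x * hn y.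
Proof.
rewrite ler_norml rip_le_hn andbT lerNl -ripNl; apply: le_trans (rip_le_hn _ _) _.
by rewrite -scaleN1r hnZ normcN normc1 mul1r.
Qed.

Lemma rip_act_le T x y : `|rip (act T x) y| <= nrm T * hn x * hn y.
Proof.
by apply: le_trans (norm_rip_le _ _) _; rewrite ler_wpM2r ?hn_ge0 ?le_nrm.
Qed.

Lemma sa_ncvg u l : ncvg u l -> (forall N, sa (u N)) -> sa l.
Proof.
move=> hu h x y; apply/eqP; rewrite -subr_eq0 -normr_le0; apply/ler_addgt0Pr => e e0.
rewrite add0r; pose K := hn x * hn y + 1.
have K0 : 0 < K by rewrite ltr_wpDl// mulr_ge0 ?hn_ge0.
have e1 : 0 < e / (2 * K) by rewrite divr_gt0 ?mulr_gt0.
have [N _ /(_ N (leqnn N)) /= hN] := ncvg_near hu e1.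
have -> : rip (act l x) y - rip x (act l y) =
    rip x (act (u N - l) y) - rip (act (u N - l) x) y.
  by rewrite !actB ripDl ripDr ripNl ripNr (h N); lra.
rewrite (ripC x); apply: le_trans (ler_normB _ _) _.
have b1 := rip_act_le (u N - l) x y; have b2 := rip_act_le (u N - l) y x.
have b3 : nrm (u N - l) * (hn x * hn y) <= e / (2 * K) * K.
  by apply: ler_pM; rewrite ?nrm_ge0 ?mulr_ge0 ?hn_ge0// lerDl.
have b4 : e / (2 * K) * K = e / 2 by field; rewrite gt_eqF.
nra.
Qed.

Lemma sa_exp T : sa T -> sa (expA T).
Proof.
move=> hT; apply: sa_ncvg (expA_cvg T) _ => N.
by apply: sa_sum => k; apply: saZ; exact: saX.
Qed.

Lemma zop_half_double T : zop O (2^-1)%:C * T + zop O (2^-1)%:C * T = T.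
Proof.
by rewrite -mulrDl -zopD -rmorphD/= (_ : 2^-1 + 2^-1 = 1) ?zop1 ?mul1r//; field.
Qed.

Lemma exp_half T : expA (zop O (2^-1)%:C * T) * expA (zop O (2^-1)%:C * T) = expA T.
Proof. by rewrite -expAD// zop_half_double. Qed.

Lemma pos_exp T : sa T -> pos (expA T).
Proof. by move=> hT; rewrite -exp_half; apply/pos_sqr/sa_exp/saZ. Qed.

Lemma neumann Y : nrm Y < 1 -> exists2 S, is_inverse (1 - Y) S & nrm S <= (1 - nrm Y)^-1.
Proof.
move=> Y1; have Y0 := nrm_ge0 Y.
have Yn : `|nrm Y| < 1 by rewrite ger0_norm.
have cg := @cvg_geometric_series R 1 (nrm Y) Yn.
have [||S hS hb] := @ncvg_series _ O (fun k => Y ^+ k) (geometric 1 (nrm Y)).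
- by move=> k; rewrite /geometric/= mul1r nrmX.
- by apply/cvg_ex; eexists; exact: cg.
have hY : ncvg (fun N => Y ^+ N) 0.
  apply: (@ncvg_le _ _ _ _ (geometric 1 (nrm Y))); last exact: cvg_geometric.
  by move=> N; rewrite subr0 /geometric/= mul1r nrmX.
have tel N : (1 - Y) * \sum_(0 <= k < N) Y ^+ k = 1 - Y ^+ N.
  elim: N => [|N IH]; first by rewrite big_nil mulr0 expr0 subrr.
  by rewrite big_nat_recr//= mulrDr IH mulrBl mul1r -exprS addrA subrK.
have tel' N : (\sum_(0 <= k < N) Y ^+ k) * (1 - Y) = 1 - Y ^+ N.
  rewrite -tel mulr_suml mulr_sumr; apply: eq_bigr => k _.
  by rewrite mulrBr mulrBl mulr1 mul1r -exprS -exprSr.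
exists S; last first.
  have := hb 0%N; rewrite big_nil subr0 /series/= big_nil subr0.
  by rewrite (cvg_lim _ cg)// mul1r.
have h1 := ncvgB (ncvg_cst 1) hY; rewrite subr0 in h1.
split.
- apply: ncvg_uniq h1; under eq_fun do rewrite -tel.
  by apply: ncvgM hS; exact: ncvg_cst.
- apply: ncvg_uniq h1; under eq_fun do rewrite -tel'.
  by apply: ncvgM; [exact: hS|exact: ncvg_cst].
Qed.

Lemma is_inverse_zop (z : R[i]) : z != 0 -> is_inverse (zop O z) (zop O z^-1).
Proof. by move=> z0; split; rewrite -zopM ?divff ?mulVf// zop1. Qed.

Lemma is_inverseM S S' T T' : is_inverse S S' -> is_inverse T T' ->
  is_inverse (S * T) (T' * S').
Proof.
move=> [a1 a2] [b1 b2]; split.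
  by rewrite mulrA -(mulrA S) b1 mulr1.
by rewrite mulrA -(mulrA T') a2 mulr1.
Qed.

Lemma neumann_zop (z : R[i]) T : nrm T < normc z ->
  exists2 S, is_inverse (zop O z - T) S & nrm S <= (normc z - nrm T)^-1.
Proof.
move=> Tz; have z0 : 0 < normc z by apply: le_lt_trans Tz; exact: nrm_ge0.
have zn0 : z != 0 by apply/eqP => z00; rewrite z00 normc0 ltxx in z0.
have b : nrm (zop O z^-1 * T) <= nrm T / normc z.
  by rewrite mulrC -normcV nrmZ_le.
have [|S hS nS] := @neumann (zop O z^-1 * T).
  by apply: le_lt_trans b _; rewrite ltr_pdivrMr// mul1r.
exists (S * zop O z^-1).
  have -> : zop O z - T = zop O z * (1 - zop O z^-1 * T).
    by rewrite mulrBr mulr1 mulrA -zopM divff// zop1 mul1r.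
  by apply: is_inverseM => //; exact: is_inverse_zop.
rewrite -zopC; apply: le_trans (nrmZ_le _ _) _; rewrite normcV.
have -> : (normc z - nrm T)^-1 = (normc z)^-1 * (1 - nrm T / normc z)^-1.
  by field; rewrite !gt_eqF// subr_gt0.
rewrite ler_wpM2l ?invr_ge0 ?normc_ge0//; apply: le_trans nS _.
rewrite lef_pV2 ?posrE ?subr_gt0 ?lerD2l ?lerN2//.
  by apply: le_lt_trans b _; rewrite ltr_pdivrMr// mul1r.
by rewrite ltr_pdivrMr// mul1r.
Qed.

Lemma pos_CS T x y : pos T -> rip (act T x) y ^+ 2 <= rip (act T x) x * rip (act T y) y.
Proof.
move=> [sT pT]; apply: form_CS; rewrite ?pT// => t.
suff -> : rip (act T x) x + 2 * t * rip (act T x) y + t ^+ 2 * rip (act T y) y =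
    rip (act T (x + t%:C *: y)) (x + t%:C *: y) by exact: pT.
rewrite actDr actZr !ripDl !ripDr !ripZl !ripZr (sT y x) (ripC y); ring.
Qed.

(** Cauchy-Schwarz for the form of T, at the vectors x and T x; one factor |T x|^2 cancels. *)
Lemma pos_sqr_le T x : pos T -> rip (act T x) (act T x) <= nrm T * rip (act T x) x.
Proof.
move=> pT; have := pos_CS x (act T x) pT; set q := rip (act T x) (act T x) => h.
have p0 : 0 <= rip (act T x) x by exact: pT.2.
have h2 : rip (act T (act T x)) (act T x) <= nrm T * q.
  apply: le_trans (rip_le_hn _ _) _; rewrite /q -sqr_hn expr2 mulrA.
  by apply: ler_wpM2r; [exact: hn_ge0|exact: le_nrm].
have q0 : 0 <= q by exact: rip_ge0.
have [->|qn] := eqVneq q 0; first by rewrite mulr_ge0 ?nrm_ge0.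
have qp : 0 < q by rewrite lt_neqAle eq_sym qn.
rewrite -(ler_pM2l qp) -expr2; apply: le_trans h _.
apply: le_trans (ler_wpM2l p0 h2) _; rewrite le_eqVlt; apply/orP; left; apply/eqP; ring.
Qed.

(** Cauchy-Schwarz for the form of T at x and S x: there (T x, S x) = (x, T S x) = |x|^2, and the
    second diagonal value is (x, S x) <= |S| |x|^2. *)
Lemma pos_inverse_ge T S : pos T -> is_inverse T S ->
  exists2 m, 0 < m & forall x, m * rip x x <= rip (act T x) x.
Proof.
move=> pT [TS ST]; have n0 : 0 < nrm S + 1 by rewrite ltr_wpDl ?nrm_ge0.
(* The added 1 keeps the bound positive even if |S| = 0. *)
exists (nrm S + 1)^-1 => [|x]; first by rewrite invr_gt0.
rewrite mulrC ler_pdivrMr//.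
have := pos_CS x (act S x) pT; rewrite pT.1 -!actM TS act1 => h.
have h2 : rip x (act S x) <= (nrm S + 1) * rip x x.
  apply: le_trans (rip_le_hn _ _) _; rewrite -sqr_hn expr2 mulrA mulrC ler_wpM2r ?hn_ge0//.
  apply: le_trans (le_nrm _ _) _.
  by rewrite ler_wpM2r ?hn_ge0// lerDl.
have p0 : 0 <= rip (act T x) x by exact: pT.2.
have x0 := rip_ge0 x.
have [->|qn] := eqVneq (rip x x) 0; first by rewrite mulr_ge0// ltW.
have qp : 0 < rip x x by rewrite lt_neqAle eq_sym qn.
rewrite -(ler_pM2l qp) -expr2; apply: le_trans h _.
apply: le_trans (ler_wpM2l p0 h2) _; rewrite le_eqVlt; apply/orP; left; apply/eqP; ring.
Qed.

Lemma nrm_le_sqr T a : 0 <= a -> (forall x, rip (act T x) (act T x) <= a ^+ 2 * rip x x) ->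
  nrm T <= a.
Proof.
move=> a0 h; apply: nrm_le => // x; apply: hn_le; first by rewrite mulr_ge0 ?hn_ge0.
by rewrite exprMn sqr_hn.
Qed.

(** By [pos_sqr_le], |T x|^2 <= |T| t |x|^2, hence |T|^2 <= |T| t. *)
Lemma pos_nrm_le T t : 0 <= t -> pos T -> (forall x, rip (act T x) x <= t * rip x x) ->
  nrm T <= t.
Proof.
move=> t0 pT h; have n0 := nrm_ge0 T.
have : nrm T <= Num.sqrt (nrm T * t).
  apply: nrm_le_sqr; first exact: sqrtr_ge0.
  move=> x; rewrite sqr_sqrtr ?mulr_ge0// -mulrA.
  by apply: le_trans (pos_sqr_le _ pT) _; rewrite ler_wpM2l.
move=> hh; have [->//|nn] := eqVneq (nrm T) 0.
have np : 0 < nrm T by rewrite lt_neqAle eq_sym nn.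
rewrite -(ler_pM2l np) -expr2 -(sqr_sqrtr (_ : 0 <= nrm T * t)) ?mulr_ge0//.
by rewrite lerXn2r ?nnegrE ?sqrtr_ge0.
Qed.

Lemma rip_act_nrm_le T x : rip (act T x) x <= nrm T * rip x x.
Proof.
apply: le_trans (rip_le_hn _ _) _; rewrite -sqr_hn expr2 mulrA.
by rewrite ler_wpM2r ?hn_ge0 ?le_nrm.
Qed.

Lemma nrm_shift_le T m c : sa T -> (forall x, m * rip x x <= rip (act T x) x) ->
  nrm T <= c -> m <= c -> nrm (zop O c%:C - T) <= c - m.
Proof.
move=> sT Tm Tc mc.
have E x : rip (act (zop O c%:C - T) x) x = c * rip x x - rip (act T x) x.
  by rewrite actB act_zop ripDl ripZl ripNl.
apply: pos_nrm_le; first by rewrite subr_ge0.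
- split; first by apply: saB => //; exact: sa_zop.
  move=> x; rewrite E subr_ge0; apply: le_trans (rip_act_nrm_le _ _) _.
  by rewrite ler_wpM2r ?rip_ge0.
- by move=> x; rewrite E mulrBl lerD2l lerN2.
Qed.

(** Around the scalar c = |T| + m, the element c - T has norm at most c - m < c, so T = c - (c - T)
    is inverted by a Neumann series. *)
Lemma sa_ge_unit T m : 0 < m -> sa T -> (forall x, m * rip x x <= rip (act T x) x) ->
  exists S, is_inverse T S.
Proof.
move=> m0 sT Tm; pose c := nrm T + m.
have c0 : 0 < c by rewrite ltr_wpDl ?nrm_ge0.
have b : nrm (zop O c%:C - T) <= c - m.
  by apply: nrm_shift_le => //; rewrite /c ?lerDl ?(ltW m0)// lerDr nrm_ge0.
have [|S hS _] := @neumann_zop c%:C (zop O c%:C - T).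
  by rewrite normcR ger0_norm ?(ltW c0)//; apply: le_lt_trans b _; rewrite ltrBlDr ltrDl.
by exists S; move: hS; rewrite opprB addrCA subrr addr0.
Qed.

(* If a selfadjoint T had norm t, then t^2 - T^2 would be bounded below, hence
   |T x|^2 <= (t^2 - m) |x|^2: the norm of T is attained in the spectrum. *)
Lemma sa_nrm_spectrum T S S' : sa T -> 0 < nrm T ->
  is_inverse (zop O (nrm T)%:C - T) S -> is_inverse (zop O (nrm T)%:C + T) S' -> False.
Proof.
move=> sT t0 hS hS'; set t := nrm T in t0 hS hS'.
have E : (zop O t%:C - T) * (zop O t%:C + T) = zop O (t ^+ 2)%:C - T * T.
  by rewrite mulrDr !mulrBl -zopM (zopC _ T) addrA subrK -rmorphM expr2.
have p : pos (zop O (t ^+ 2)%:C - T * T).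
  split; first by apply: saB; [exact: sa_zop|exact: saM].
  move=> x; rewrite actB act_zop ripDl ripZl ripNl sa_sqr// subr_ge0.
  by rewrite -!sqr_hn -exprMn lerXn2r ?nnegrE ?mulr_ge0 ?hn_ge0 ?nrm_ge0 ?le_nrm.
have [|m m0 hm] := @pos_inverse_ge _ (S' * S) p; first by rewrite -E; apply: is_inverseM.
have hm' x : rip (act T x) (act T x) <= (t ^+ 2 - m) * rip x x.
  by have := hm x; rewrite actB act_zop ripDl ripZl ripNl sa_sqr//; lra.
pose a := Num.max 0 (t ^+ 2 - m).
have a0 : 0 <= a by rewrite le_max lexx.
have : t <= Num.sqrt a.
  apply: nrm_le_sqr; first exact: sqrtr_ge0.
  move=> x; rewrite sqr_sqrtr//; apply: le_trans (hm' x) _.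
  by rewrite ler_wpM2r ?rip_ge0// le_max lexx orbT.
rewrite -(@ler_pXn2r _ 2)// ?nnegrE ?sqrtr_ge0 ?(ltW t0)// sqr_sqrtr// /a le_max.
case/orP; last by lra.
by rewrite leNgt exprn_gt0.
Qed.

(* X = b - b' satisfies b X + X b' = 0, i.e. (c + b') X = X (c - b). *)
Lemma pos_sqrt_uniq (b b' : A) S : pos b -> is_inverse b S -> pos b' -> b' * b' = b * b -> b' = b.
Proof.
move=> pb hS pb' bb; pose X := b - b'.
have [m0 m00 hm0] := pos_inverse_ge pb hS.
pose c := nrm b + m0; have cm : m0 <= c by rewrite lerDr nrm_ge0.
have c0 : 0 < c by rewrite ltr_wpDl ?nrm_ge0.
have nb : nrm (zop O c%:C - b) <= c - m0.
  by apply: nrm_shift_le => //; [exact: pb.1|rewrite /c lerDl ltW].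
have E : (zop O c%:C + b') * X = X * (zop O c%:C - b).
  rewrite mulrDl mulrBr zopC; congr (_ + _).
  by rewrite /X mulrBr mulrBl opprB bb.
have low y : c * hn y <= hn (act (zop O c%:C + b') y).
  have [->|yn] := eqVneq (hn y) 0; first by rewrite mulr0 hn_ge0.
  have yp : 0 < hn y by rewrite lt_neqAle eq_sym yn hn_ge0.
  rewrite -(ler_pM2r yp) -mulrA -expr2 sqr_hn.
  apply: le_trans (rip_le_hn _ _); rewrite actD act_zop ripDl ripZl lerDl.
  exact: pb'.2.
(* Positivity of b' bounds c + b' below by c, whereas |c - b| <= c - m0; the identity [E] then
   leaves only X = 0. *)
have h : c * nrm X <= nrm X * (c - m0).
  rewrite mulrC -ler_pdivlMr//; apply: nrm_le.
    by rewrite divr_ge0 ?mulr_ge0 ?nrm_ge0 ?subr_ge0 ?(ltW c0).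
  move=> x; rewrite mulrAC ler_pdivlMr// mulrC; apply: le_trans (low _) _.
  rewrite -actM E; apply: le_trans (le_nrm _ _) _; rewrite ler_wpM2r ?hn_ge0//.
  by apply: le_trans (nrmM _ _) _; rewrite ler_wpM2l ?nrm_ge0.
have X0 : nrm X = 0 by apply/eqP; rewrite eq_le nrm_ge0 andbT; nra.
by apply/esym/eqP; rewrite -subr_eq0 -/X; apply/eqP/nrm_eq0.
Qed.

(** S and T need not commute, so exp S exp(-T) gives no information. Uniqueness of positive square
    roots yields exp(2^-k S) = exp(2^-k T) for all k. Subtracting the first-order expansions, S - T
    is 2^k times a difference of second-order remainders, which is O(2^-k). *)
Lemma exp_sa_inj S T : sa S -> sa T -> expA S = expA T -> S = T.
Proof.
move=> sS sT ST; pose h k := zop O ((2 ^- k)%:C) : A.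
have hS k Z : h k.+1 * Z = zop O (2^-1)%:C * (h k * Z).
  by rewrite mulrA -zopM -rmorphM/= -invfM -exprS.
have E k : expA (h k * S) = expA (h k * T).
  elim: k => [|k IH]; first by rewrite /h expr0 invr1 zop1 !mul1r.
  rewrite !hS; apply: pos_sqrt_uniq.
  - by apply/pos_exp/saZ/saZ.
  - exact: expA_inverse.
  - by apply/pos_exp/saZ/saZ.
  - by rewrite !exp_half.
pose K := Num.max (nrm S) (nrm T).
have KS : nrm S <= K by rewrite le_max lexx.
have KT : nrm T <= K by rewrite le_max lexx orbT.
have K0 : 0 <= K by apply: le_trans KS; exact: nrm_ge0.
pose C := K ^+ 2 * expR K.
have C0 : 0 <= C by rewrite mulr_ge0 ?sqr_ge0 ?expR_ge0.
(* With y = a K, this is e^y - 1 - y <= y^2 e^y, obtained by multiplying 1 - y <= e^(-y) by (1 + y)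
   e^y. *)
have p2 (X : A) (a : R) : 0 <= a <= 1 -> nrm X <= K ->
    nrm (expA (zop O a%:C * X) - (1 + zop O a%:C * X)) <= a ^+ 2 * C.
  move=> /andP[a0 a1] XK.
  have b : nrm (zop O a%:C * X) <= a * K.
    apply: le_trans (nrmZ_le _ _) _; rewrite normcR ger0_norm//.
    by rewrite ler_wpM2l.
  have -> : 1 + zop O a%:C * X = exp_part (zop O a%:C * X) 2.
    rewrite /exp_part !big_nat_recr//= big_nil add0r !fact0 invr1 zop1 !mul1r.
    by rewrite expr0 expr1.
  apply: le_trans (expA_tail 2 b) _.
  rewrite /series/= !big_nat_recr//= big_nil add0r /exp_coeff/= expr0 expr1 !fact0 invr1 !mulr1.
  set y := a * K; have y0 : 0 <= y by exact: mulr_ge0.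
  have yK : expR y <= expR K by rewrite ler_expR /y ler_piMl.
  have : (1 + y) * (1 - y) <= (1 + y) * expR (- y).
    by rewrite ler_wpM2l ?addr_ge0// expR_ge1Dx.
  rewrite -(ler_pM2r (expR_gt0 y)) -[_ * expR (- y) * _]mulrA -expRD addNr expR0 mulr1 => h1.
  have h2 : y ^+ 2 * expR y <= y ^+ 2 * expR K by rewrite ler_wpM2l ?sqr_ge0.
  have -> : a ^+ 2 * C = y ^+ 2 * expR K by rewrite /C /y; ring.
  lra.
have D k : nrm (S - T) <= 2 ^- k * (2 * C).
  have a0 : 0 < 2 ^- k :> R by rewrite invr_gt0 exprn_gt0.
  have a1 : 2 ^- k <= 1 :> R by rewrite invf_le1 ?exprn_gt0// exprn_ege1// ler1n.
  have a01 : 0 <= (2 ^- k : R) <= 1 by rewrite (ltW a0) a1.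
  have -> : S - T = zop O (2 ^+ k)%:C * ((expA (h k * T) - (1 + h k * T)) - (expA (h k * S) - (1 + h k * S))).
    rewrite E; set e := expA _.
    have -> : e - (1 + h k * T) - (e - (1 + h k * S)) = h k * (S - T).
      by rewrite mulrBr opprB addrC addrA subrK opprD addrACA subrr add0r.
    by rewrite mulrA -zopM -rmorphM/= divff ?mul1r ?zop1 ?mul1r// expf_neq0 ?pnatr_eq0.
  apply: le_trans (nrmZ_le _ _) _; rewrite normcR ger0_norm ?exprn_ge0//.
  apply: le_trans (ler_wpM2l _ (nrmB _ _)) _; first by rewrite exprn_ge0.
  apply: le_trans (ler_wpM2l _ (lerD (p2 T _ a01 KT) (p2 S _ a01 KS))) _.
    by rewrite exprn_ge0.
  by rewrite le_eqVlt; apply/orP; left; apply/eqP; field; rewrite expf_neq0 ?pnatr_eq0.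
have L : (fun k => 2 ^- k * (2 * C)) @ \oo --> (0 : R).
  rewrite -[X in _ --> X](mul0r (2 * C)); apply: cvgM; last exact: cvg_cst.
  under eq_fun do rewrite -exprVn.
  by apply: cvg_expr; rewrite ger0_norm ?invr_ge0// invf_lt1 ?ltr1n.
apply: (ncvg_uniq (ncvg_cst S)); apply: ncvg_le L => k; exact: D.
Qed.

End Selfadjoint.

(** * Polynomial functional calculus *)

Section PolynomialCalculus.
Variables (R : realType) (O : opAlg R).
Local Notation A := (alg O).
Local Open Scope complex_scope.
Implicit Types (S T X Y l : A) (a b c r t : R) (p q : {poly R[i]}).

Definition peval T p : A := \sum_(0 <= i < size p) zop O p`_i * T ^+ i.

Lemma pevalE T p N : (size p <= N)%N -> peval T p = \sum_(0 <= i < N) zop O p`_i * T ^+ i.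
Proof.
move=> pN; rewrite (@big_cat_nat _ _ _ (size p))//= [X in _ + X]big_nat_cond.
rewrite [X in _ + X]big1 ?addr0// => i /andP[/andP[pi _] _].
by rewrite nth_default// zop0 mul0r.
Qed.

Lemma pevalD T p q : peval T (p + q) = peval T p + peval T q.
Proof.
pose N := maxn (size p) (size q).
rewrite (@pevalE _ _ N) ?(size_polyD)// (@pevalE _ p N) ?leq_maxl// (@pevalE _ q N) ?leq_maxr//.
by rewrite -big_split/=; apply: eq_bigr => i _; rewrite coefD zopD mulrDl.
Qed.

Lemma pevalC T (z : R[i]) : peval T z%:P = zop O z.
Proof.
rewrite (@pevalE _ _ 1) ?size_polyC ?leq_b1//.
by rewrite big_nat1 coefC eqxx expr0 mulr1.
Qed.

Lemma peval0 T : peval T 0 = 0.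
Proof. by rewrite -polyC0 pevalC zop0. Qed.

Lemma pevalMX T p : peval T (p * 'X) = peval T p * T.
Proof.
have [->|p0] := eqVneq p 0; first by rewrite mul0r peval0 mul0r.
rewrite /peval size_mulX// big_nat_recl// coefMX eqxx zop0 mul0r add0r.
rewrite mulr_suml; apply: eq_bigr => i _.
by rewrite coefMX/= -mulrA -exprSr.
Qed.

Lemma pevalX T : peval T 'X = T.
Proof. by rewrite -['X]mul1r pevalMX -polyC1 pevalC zop1 mul1r. Qed.

Lemma pevalCM T (z : R[i]) p : peval T (z%:P * p) = zop O z * peval T p.
Proof.
rewrite (@pevalE _ _ (size p)); last by rewrite mul_polyC size_scale_leq.
by rewrite mulr_sumr; apply: eq_bigr => i _; rewrite coefCM zopM mulrA.
Qed.

Lemma pevalM T p q : peval T (p * q) = peval T p * peval T q.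
Proof.
elim/poly_ind: p => [|p c IH]; first by rewrite mul0r peval0 mul0r.
rewrite mulrDl -mulrA (mulrC 'X) mulrA !pevalD !pevalMX IH pevalCM pevalC.
rewrite mulrDl; congr (_ + _); rewrite -!mulrA; congr (_ * _).
rewrite mulr_suml mulr_sumr; apply: eq_bigr => i _.
by rewrite mulrA -zopC -!mulrA -exprSr -exprS.
Qed.

Lemma peval_sum T (I : Type) (s : seq I) (F : I -> {poly R[i]}) :
  peval T (\sum_(i <- s) F i) = \sum_(i <- s) peval T (F i).
Proof. by elim/big_rec2: _ => [|i y x _ <-]; rewrite ?peval0 ?pevalD. Qed.

Lemma pevalXn T p k : peval T (p ^+ k) = peval T p ^+ k.
Proof.
elim: k => [|k IH]; first by rewrite !expr0 -polyC1 pevalC zop1.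
by rewrite !exprS pevalM IH.
Qed.

Lemma is_inverse_lr X Y Y' : X * Y = 1 -> Y' * X = 1 -> is_inverse X Y.
Proof.
move=> h h'; split=> //.
by have -> : Y = Y' by rewrite -[Y]mul1r -h' -mulrA h mulr1.
Qed.

(** For z = x + i y, the product of T - z and T - (x - i y) is (T - x)^2 + y^2, a selfadjoint
    element bounded below by y^2 > 0, hence invertible; the two factors commute. *)
Lemma sa_nonreal_unit T (z : R[i]) : sa T -> complex.Im z != 0 ->
  exists S, is_inverse (T - zop O z) S.
Proof.
case: z => x y /= sT y0; pose X := T - zop O x%:C.
have sX : sa X by apply: saB => //; exact: sa_zop.
have E : (T - zop O (x +i* y)) * (T - zop O (x +i* - y)) = X * X + zop O (y ^+ 2)%:C.
  have -> : zop O (x +i* y) = zop O x%:C + zop O (0 +i* y).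
    by rewrite -zopD; congr zop; apply/eqP; rewrite eq_complex /= addr0 add0r !eqxx.
  have -> : zop O (x +i* - y) = zop O x%:C - zop O (0 +i* y).
    by rewrite -zopB; congr zop; apply/eqP; rewrite eq_complex /= subr0 sub0r !eqxx.
  set J := zop O (0 +i* y).
  have -> : T - (zop O x%:C + J) = X - J by rewrite opprD addrA.
  have -> : T - (zop O x%:C - J) = X + J by rewrite opprB addrA addrAC.
  have JX : J * X = X * J by exact: zopC.
  rewrite mulrDr 2!mulrBl JX addrA subrK -[J * J]zopM; congr (_ + _); rewrite -zopN; congr zop.
  by apply/eqP; rewrite eq_complex/=; apply/andP; split; apply/eqP; ring.
have C : (T - zop O (x +i* - y)) * (T - zop O (x +i* y)) =
         (T - zop O (x +i* y)) * (T - zop O (x +i* - y)).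
  rewrite !mulrBl !mulrBr -!zopM !(zopC _ T) (mulrC (x +i* y)).
  by rewrite !opprB addrACA [X in _ + X]addrC addrACA.
have y2 : 0 < y ^+ 2 by rewrite lt_neqAle eq_sym sqrf_eq0 y0 sqr_ge0.
have [||Q [Q1 Q2]] := @sa_ge_unit _ _ (X * X + zop O (y ^+ 2)%:C) _ y2.
- by apply: saD; [exact: saM|exact: sa_zop].
- move=> v; rewrite actD ripDl act_zop ripZl sa_sqr//.
  by rewrite lerDr rip_ge0.
exists ((T - zop O (x +i* - y)) * Q).
apply: (@is_inverse_lr _ _ (Q * (T - zop O (x +i* - y)))); first by rewrite mulrA E.
by rewrite -mulrA C E.
Qed.

Lemma is_inverseN X Y : is_inverse X Y -> is_inverse (- X) (- Y).
Proof. by move=> [h h']; split; rewrite mulrNN. Qed.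

Lemma is_inverse1 : is_inverse (1 : A) 1.
Proof. by split; rewrite mulr1. Qed.

(* A selfadjoint p(T) has +-|p(T)| in its spectrum; factoring p - (+-|p(T)|) over
   the complex numbers gives a root of that polynomial in the spectrum of T,
   which lies in [-|T|, |T|]. *)
Lemma peval_sa_le T (p : {poly R}) b : sa T -> 0 <= b ->
  (forall x : R, `|x| <= nrm T -> `|p.[x]| <= b) ->
  nrm (peval T (map_poly (real_complex R) p)) <= b.
Proof.
move=> sT b0 hb; set pC := map_poly _ p; set S := peval T pC.
have sS : sa S by apply: sa_sum => i; rewrite coef_map; apply/saZ/saX.
rewrite leNgt; apply/negP => bS.
have t0 : 0 < nrm S by apply: le_lt_trans bS.
have inv (l : R) : `|l| = nrm S -> exists Y, is_inverse (zop O l%:C - S) Y.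
  move=> lS; pose P := l%:C%:P - pC.
  have PE : zop O l%:C - S = peval T P.
    by rewrite pevalD pevalC -[X in _ = _ + peval T X]mulN1r -polyCN pevalCM zopN zop1 mulN1r.
  have hl (x : R) : `|x| <= nrm T -> p.[x] != l.
    by move=> /hb h; apply/eqP => e; move: h; rewrite e lS leNgt bS.
  have P0 : P != 0.
    apply/eqP => h; have : P.[0] = 0 by rewrite h horner0.
    rewrite hornerD hornerN hornerC -[X in pC.[X]](rmorph0 (real_complex R)) horner_map/=.
    move/eqP; rewrite subr_eq0 => /eqP/complexI/esym/eqP.
    by apply/negP/hl; rewrite normr0 nrm_ge0.
  have [s Ps] := closed_field_poly_normal P.
  have rt z : z \in s -> P.[z] = 0.
    move=> zs; apply/rootP; rewrite Ps rootZ ?lead_coef_eq0// root_prod_XsubC.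
    exact: zs.
  rewrite PE Ps -mul_polyC.
  have [Y hY] : exists Y, is_inverse (peval T (\prod_(z <- s) ('X - z%:P))) Y.
    elim: s {Ps} rt => [|z s IH] rt.
      by exists 1; rewrite big_nil -polyC1 pevalC zop1; exact: is_inverse1.
    have [|Y hY] := IH; first by move=> w ws; apply: rt; rewrite inE ws orbT.
    have [Z hZ] : exists Z, is_inverse (T - zop O z) Z.
      have [zI|] := eqVneq (complex.Im z) 0; last exact: sa_nonreal_unit.
      have zE : z = (complex.Re z)%:C by case: z zI {IH rt} => u v /= ->.
      have [h|h] := leP `|complex.Re z| (nrm T).
        have := rt z; rewrite inE eqxx => /(_ erefl).
        rewrite hornerD hornerN hornerC [in pC.[z]]zE horner_map/= => /eqP.
        by rewrite subr_eq0 => /eqP/complexI/esym/eqP; rewrite (negbTE (hl _ h)).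
      have [|Z hZ _] := @neumann_zop _ _ z T; first by rewrite zE normcR.
      by exists (- Z); rewrite -opprB; exact: is_inverseN.
    exists (Y * Z); rewrite big_cons pevalM; apply: is_inverseM => //.
    by rewrite pevalD pevalX -polyCN pevalC zopN.
  exists (Y * zop O (lead_coef P)^-1); rewrite pevalCM; apply: is_inverseM => //.
  by apply: is_inverse_zop; rewrite lead_coef_eq0.
have [|Y hY] := inv (nrm S); first by rewrite ger0_norm ?nrm_ge0.
have [|Y' hY'] := inv (- nrm S); first by rewrite normrN ger0_norm ?nrm_ge0.
apply: (sa_nrm_spectrum sS t0 hY (S' := - Y')).
have -> : zop O (nrm S)%:C + S = - (zop O (- nrm S)%:C - S).
  by rewrite rmorphN zopN opprB opprK addrC.
exact: is_inverseN.
Qed.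

End PolynomialCalculus.

(** * Riemann sums of the resolvent *)

Section RootsOfUnity.
Variable R : realType.
Local Open Scope complex_scope.
Implicit Types (s t r : R).

Lemma expiD s t : expi (s + t) = expi s * expi t.
Proof.
rewrite /expi cosD sinD; apply/eqP; rewrite eq_complex/= (addrC (sin s * _)).
by rewrite !eqxx.
Qed.

Lemma expi0 : expi (0 : R) = 1.
Proof. by rewrite /expi cos0 sin0. Qed.

Lemma expiMn t k : expi (t *+ k) = expi t ^+ k.
Proof. by elim: k => [|k IH]; rewrite ?mulr0n ?expi0// mulrS expiD IH exprS. Qed.

Lemma normc_expi t : normc (expi t) = 1.
Proof. by rewrite /expi/= cos2Dsin2 sqrtr1. Qed.

Definition circle_pt r (N k : nat) : R[i] := r%:C * expi (2 * pi * k%:R / N%:R).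

Lemma normc_circle_pt r N k : 0 <= r -> normc (circle_pt r N k) = r.
Proof. by move=> r0; rewrite normcM normc_expi mulr1 normcR ger0_norm. Qed.

Lemma circle_ptE r N k : circle_pt r N k = r%:C * expi (2 * pi / N%:R) ^+ k.
Proof.
by rewrite /circle_pt -expiMn; congr (_ * expi _); rewrite -[RHS]mulr_natr mulrAC.
Qed.

Lemma expi_root_exp N : (0 < N)%N -> expi (2 * pi / N%:R : R) ^+ N = 1.
Proof.
move=> N0; rewrite -expiMn -[(_ / _) *+ N]mulr_natr divfK ?pnatr_eq0 ?gtn_eqF//.
by have := expiDint (0 : R) 1; rewrite mulr1 add0r expi0.
Qed.

(** cos t = 1 - 2 sin(t / 2)^2, and t / 2 lies strictly between 0 and pi. *)
Lemma expi_neq1 t : 0 < t < 2 * pi -> expi t != 1.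
Proof.
move=> /andP[t0 t2]; apply/eqP => -[h _].
have s0 : 0 < sin (t / 2) by apply: sin_gt0_pi; lra.
have : cos (t / 2 *+ 2) = 1 - sin (t / 2) ^+ 2 *+ 2 by rewrite cos_mulr2n cos2sin2; lra.
have -> : t / 2 *+ 2 = t by rewrite -[(_ / _) *+ 2]mulr_natr divfK ?pnatr_eq0.
rewrite h => e.
have : 0 < sin (t / 2) ^+ 2 by rewrite exprn_gt0.
by lra.
Qed.

Lemma sum_circle_pt r N i : (0 < i < N)%N -> \sum_(k < N) circle_pt r N k ^+ i = 0.
Proof.
move=> /andP[i0 iN]; have N0 : (0 < N)%N by apply: leq_ltn_trans iN.
set w := expi (2 * pi / N%:R : R).
have wi : w ^+ i != 1.
  rewrite -expiMn; apply: expi_neq1.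
  rewrite -[(_ / _) *+ i]mulr_natr mulr_gt0 ?divr_gt0 ?mulr_gt0 ?pi_gt0 ?ltr0n//=.
  by rewrite mulrAC ltr_pdivrMr ?ltr0n// ltr_pM2l ?mulr_gt0 ?pi_gt0// ltr_nat.
have -> : \sum_(k < N) circle_pt r N k ^+ i = r%:C ^+ i * \sum_(k < N) (w ^+ i) ^+ k.
  rewrite mulr_sumr; apply: eq_bigr => k _.
  by rewrite circle_ptE exprMn -!exprM mulnC.
apply/eqP; rewrite mulf_eq0; apply/orP; right.
have := subrX1 (w ^+ i) N; rewrite -exprM mulnC exprM expi_root_exp// expr1n subrr.
by move/esym/eqP; rewrite mulf_eq0 subr_eq0 (negbTE wi).
Qed.

Lemma circle_ptXN r N k : (0 < N)%N -> circle_pt r N k ^+ N = r%:C ^+ N.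
Proof. by move=> N0; rewrite circle_ptE exprMn exprAC expi_root_exp// expr1n mulr1. Qed.

End RootsOfUnity.

Section ResolventMeans.
Variables (R : realType) (O : opAlg R).
Local Notation A := (alg O).
Local Open Scope complex_scope.
Implicit Types (S T X Y l : A) (a b c r t : R).

Lemma ncvg_near_le (u : nat -> A) l (e : nat -> R) :
  (\forall N \near \oo, nrm (u N - l) <= e N) -> e @ \oo --> 0 -> ncvg u l.
Proof.
move=> h e0; apply: (squeeze_cvgr _ (cvg_cst 0) e0).
by apply: filterS h => N hN; rewrite nrm_ge0.
Qed.

Variables (T : A) (r : R).
Hypothesis Tr : nrm T < r.

Let r0 : 0 < r. Proof. by apply: le_lt_trans Tr; exact: nrm_ge0. Qed.

Definition resolvent_pt N k : A := inverse (zop O (circle_pt r N k) - T).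

Lemma resolvent_ptP N k :
  is_inverse (zop O (circle_pt r N k) - T) (resolvent_pt N k) /\
  nrm (resolvent_pt N k) <= (r - nrm T)^-1.
Proof.
have nr : normc (circle_pt r N k) = r by rewrite normc_circle_pt// ltW.
have [|S hS nS] := @neumann_zop _ _ (circle_pt r N k) T; first by rewrite nr.
by rewrite /resolvent_pt (inverseE hS); split => //; move: nS; rewrite nr.
Qed.

(** The factor z coming from dz = i z dt is left inside [f]: the moment of z^(p + 1) approximates
    the Cauchy integral of z^p. *)
Definition moment N (f : R[i] -> R[i]) : A :=
  \sum_(k < N) zop O (N%:R^-1 * f (circle_pt r N k)) * resolvent_pt N k.

Lemma normc_invn N : normc (N%:R^-1 : R[i]) = (N%:R)^-1.
Proof.
by rewrite -(rmorph_nat (real_complex R)) -fmorphV normcR ger0_norm ?invr_ge0.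
Qed.

Lemma nrm_moment_le N f b : 0 <= b -> (forall z, normc z = r -> normc (f z) <= b) ->
  nrm (moment N f) <= b * (r - nrm T)^-1.
Proof.
move=> b0 hf; have g0 : 0 <= (r - nrm T)^-1 by rewrite invr_ge0 subr_ge0 ltW.
apply: le_trans (nrm_sum _ _ _) _.
apply: le_trans (_ : \sum_(k < N) (N%:R^-1 * (b * (r - nrm T)^-1)) <= _).
  apply: ler_sum => k _; apply: le_trans (nrmZ_le _ _) _.
  rewrite normcM normc_invn -mulrA ler_wpM2l ?invr_ge0//.
  apply: ler_pM; rewrite ?normc_ge0 ?nrm_ge0 ?(resolvent_ptP _ _).2//.
  by apply: hf; rewrite normc_circle_pt// ltW.
rewrite sumr_const card_ord -[leLHS]mulr_natl mulrA.
have [->|N0] := posnP N; first by rewrite !mul0r mulr_ge0.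
by rewrite divff ?mul1r// pnatr_eq0 gtn_eqF.
Qed.

Lemma momentD N f g : moment N (fun z => f z + g z) = moment N f + moment N g.
Proof.
by rewrite -big_split; apply: eq_bigr => k _; rewrite /= mulrDr zopD mulrDl.
Qed.

Lemma momentZ N (z : R[i]) f : moment N (fun w => z * f w) = zop O z * moment N f.
Proof. by rewrite mulr_sumr; apply: eq_bigr => k _; rewrite mulrCA zopM mulrA. Qed.

Lemma moment_sum N (s : seq nat) (f : nat -> R[i] -> R[i]) :
  moment N (fun z => \sum_(i <- s) f i z) = \sum_(i <- s) moment N (f i).
Proof.
elim: s => [|i s IH].
  rewrite big_nil /moment big1// => k _; by rewrite big_nil mulr0 zop0 mul0r.
by rewrite big_cons -IH -momentD; apply: eq_bigr => k _; rewrite big_cons.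
Qed.

Local Notation mX N p := (moment N (fun z => z ^+ p)).

(** From z (z - T)^-1 = 1 + T (z - T)^-1 at each node. *)
Lemma momentXS N p : mX N p.+1 =
  zop O (N%:R^-1 * \sum_(k < N) circle_pt r N k ^+ p) + T * mX N p.
Proof.
rewrite mulr_sumr zop_sum [T * _]mulr_sumr -big_split; apply: eq_bigr => k _ /=.
have [[h _] _] := resolvent_ptP N k.
have E : zop O (circle_pt r N k) * resolvent_pt N k = 1 + T * resolvent_pt N k.
  by rewrite -h mulrBl subrK.
rewrite exprSr [in LHS]mulrA zopM -[LHS]mulrA E mulrDr mulr1; congr (_ + _).
by rewrite !mulrA zopC.
Qed.

(** The sums of the nodes raised to the powers 1, ..., N - 1 vanish, so the quadrature is exact up
    to the moment of order 0. *)
Lemma momentX N p : (p < N)%N -> mX N p.+1 = T ^+ p + T ^+ p.+1 * mX N 0.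
Proof.
elim: p => [|p IH] pN.
  rewrite momentXS expr0 expr1; congr (_ + _).
  under eq_bigr do rewrite expr0.
  by rewrite sumr_const card_ord mulVf ?zop1// pnatr_eq0 gtn_eqF.
rewrite momentXS sum_circle_pt// mulr0 zop0 add0r IH ?(ltnW pN)//.
by rewrite mulrDr mulrA -!exprS.
Qed.

(** All nodes have the same N-th power r^N, so the moment of order N is known in two ways: this
    closes the recursion. *)
Lemma moment0_eq N : (0 < N)%N ->
  zop O (r%:C ^+ N) * mX N 0 = T ^+ N.-1 + T ^+ N * mX N 0.
Proof.
move=> N0; rewrite -[in X in _ = _ + X](prednK N0) -momentX ?prednK//.
by rewrite -momentZ; apply: eq_bigr => k _; rewrite expr0 mulr1 circle_ptXN.
Qed.

(** The moment is bounded by (r - |T|)^-1; dividing [moment0_eq] by r^N turns this bound into one of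
    order (|T| / r)^N. *)
Lemma moment0_cvg : ncvg (fun N => mX N 0) 0.
Proof.
pose q := nrm T / r; pose K := r^-1 + q * (r - nrm T)^-1.
have rT : 0 < r - nrm T by rewrite subr_gt0.
have q0 : 0 <= q by rewrite divr_ge0 ?nrm_ge0 ?ltW.
have q1 : `|q| < 1 by rewrite ger0_norm// ltr_pdivrMr// mul1r.
(* The shift makes the number of nodes positive, as [moment0_eq] requires. *)
rewrite /ncvg -(cvg_shiftS (fun N => nrm (mX N 0 - 0))).
suff : ncvg (fun N => mX N.+1 0) 0 by [].
have L : (fun N => K * q ^+ N) @ \oo --> (0 : R).
  by have := cvgM (cvg_cst K) (cvg_expr q1); rewrite mulr0; apply.
apply: ncvg_le L => N; rewrite subr0.
have b0 : nrm (mX N.+1 0) <= (r - nrm T)^-1.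
  by rewrite -[leRHS]mul1r; apply: nrm_moment_le => // z _; rewrite expr0 normc1.
have E : mX N.+1 0 = zop O (r ^- N.+1)%:C * (T ^+ N + T ^+ N.+1 * mX N.+1 0).
  rewrite -(@moment0_eq N.+1)// mulrA -zopM -rmorphXn -rmorphM/= mulVf ?zop1 ?mul1r//.
  by rewrite expf_neq0// gt_eqF.
rewrite E; apply: le_trans (nrmZ_le _ _) _.
rewrite normcR ger0_norm ?invr_ge0 ?exprn_ge0 ?(ltW r0)//.
have -> : K * q ^+ N = r ^- N.+1 * (nrm T ^+ N + nrm T ^+ N.+1 * (r - nrm T)^-1).
  rewrite /K /q expr_div_n !exprS; field.
  by rewrite expf_neq0 !gt_eqF.
rewrite ler_wpM2l ?invr_ge0 ?exprn_ge0 ?(ltW r0)//.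
apply: le_trans (nrmD _ _) _; apply: lerD; first exact: nrmX.
apply: le_trans (nrmM _ _) _; apply: ler_pM; rewrite ?nrm_ge0//; exact: nrmX.
Qed.

Lemma momentX_cvg p : ncvg (fun N => mX N p.+1) (T ^+ p).
Proof.
have := ncvgM (ncvg_cst (T ^+ p.+1)) moment0_cvg; rewrite mulr0 /ncvg => h.
apply: ncvg_near_le h; exists p.+1 => // N /= pN.
by rewrite momentX// addrC addKr subr0.
Qed.

End ResolventMeans.

(** * The logarithm *)

Section ScalarExpLog.
Variable R : realType.
Implicit Types (u v b c r x : R).

Lemma expR_lipschitz u v : `|expR u - expR v| <= (expR u + expR v) * `|u - v|.
Proof.
wlog vu : u v / v <= u.
  move=> W; have [/W//|/ltW/W] := leP v u.
  by rewrite distrC (addrC (expR v)) (distrC v).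
rewrite !ger0_norm ?subr_ge0 ?ler_expR//.
have h : expR u * (1 + (v - u)) <= expR u * expR (v - u).
  by rewrite ler_wpM2l ?expR_ge0 ?expR_ge1Dx.
have e : expR u * expR (v - u) = expR v by rewrite -expRD addrC subrK.
have : 0 <= expR v * (u - v) by rewrite mulr_ge0 ?expR_ge0 ?subr_ge0.
nra.
Qed.

Lemma expR_tail_le u b N : `|u| <= b ->
  `|series (exp_coeff u) N - expR u| <= expR b - series (exp_coeff b) N.
Proof.
move=> ub.
have h c : (fun M => series (exp_coeff c) (M + N)%N - series (exp_coeff c) N) @ \oo -->
    expR c - series (exp_coeff c) N.
  apply: cvgB; last exact: cvg_cst.
  by rewrite (cvg_shiftn N (series (exp_coeff c))); exact: is_cvg_series_exp_coeff.
have hn : (fun M => `|series (exp_coeff u) (M + N)%N - series (exp_coeff u) N|) @ \oo -->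
    `|expR u - series (exp_coeff u) N| by apply: cvg_norm; exact: h.
rewrite distrC -(cvg_lim _ hn)// -(cvg_lim _ (h b))//; apply: ler_lim.
- by apply/cvg_ex; eexists; exact: hn.
- by apply/cvg_ex; eexists; exact: h b.
apply: nearW => M; rewrite !sub_series_geq ?leq_addl//.
apply: le_trans (ler_norm_sum _ _ _) _; apply: ler_sum => k _.
rewrite /exp_coeff/= normrM normrX (ger0_norm (_ : 0 <= _^-1)) ?invr_ge0//.
by rewrite ler_wpM2r ?invr_ge0// lerXn2r ?nnegrE// (le_trans _ ub).
Qed.

Lemma norm_log_coeff c k : 0 < c -> `|log_coeff c k| = (k.+1%:R * c ^+ k.+1)^-1.
Proof.
move=> c0; rewrite /log_coeff normrM normrX normrN1 expr1n mul1r ger0_norm//.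
by rewrite invr_ge0 mulr_ge0// exprn_ge0// ltW.
Qed.

Lemma log_coeff_le c q k : 0 < c -> 0 <= q ->
  `|log_coeff c k| * q ^+ k.+1 <= geometric (q / c) (q / c) k.
Proof.
move=> c0 q0; rewrite norm_log_coeff// /geometric/= -exprS expr_div_n.
rewrite mulrC ler_wpM2l ?exprn_ge0// invfM ler_piMl ?invr_ge0 ?exprn_ge0 ?(ltW c0)//.
by rewrite invf_le1// ler1n.
Qed.

End ScalarExpLog.

Section Logarithm.
Variables (R : realType) (O : opAlg R).
Local Notation A := (alg O).
Local Open Scope complex_scope.
Implicit Types (S T X Y l a : A) (b c r t : R).

(* Partial sums of log (c + T), log_coeff c k being (-1)^k / ((k + 1) c^(k + 1)). *)
Definition log_part T c (N : nat) : A :=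
  zop O (ln c)%:C + \sum_(0 <= k < N) zop O (log_coeff c k)%:C * T ^+ k.+1.

(** Real polynomials, so that [peval_sa_le] can compare their values at T with their values on an
    interval. *)
Definition lpoly c (N : nat) : {poly R} :=
  (ln c)%:P + \sum_(0 <= k < N) (log_coeff c k)%:P * 'X ^+ k.+1.

Definition epoly (p : {poly R}) (M : nat) : {poly R} :=
  \sum_(0 <= k < M) ((k`!%:R)^-1)%:P * p ^+ k.

Local Notation toC := (map_poly (real_complex R)).

Lemma peval_lpoly T c N : peval T (toC (lpoly c N)) = log_part T c N.
Proof.
rewrite rmorphD/= map_polyC pevalD pevalC rmorph_sum peval_sum; congr (_ + _).
apply: eq_bigr => k _.
by rewrite rmorphM/= map_polyC rmorphXn/= map_polyX pevalCM pevalXn pevalX.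
Qed.

Lemma peval_epoly T p M : peval T (toC (epoly p M)) = exp_part (peval T (toC p)) M.
Proof.
rewrite rmorph_sum peval_sum; apply: eq_bigr => k _.
by rewrite rmorphM/= map_polyC rmorphXn/= pevalCM pevalXn.
Qed.

Lemma horner_lpoly c N x : (lpoly c N).[x] = ln c + \sum_(0 <= k < N) log_coeff c k * x ^+ k.+1.
Proof.
rewrite hornerD hornerC horner_sum; congr (_ + _).
by apply: eq_bigr => k _; rewrite hornerCM hornerXn.
Qed.

Lemma horner_epoly p M x : (epoly p M).[x] = series (exp_coeff p.[x]) M.
Proof.
rewrite horner_sum; apply: eq_bigr => k _.
by rewrite hornerCM horner_exp /exp_coeff/= mulrC.
Qed.

Lemma nrm_log_term T c k : 0 < c ->
  nrm (zop O (log_coeff c k)%:C * T ^+ k.+1) <= geometric (nrm T / c) (nrm T / c) k.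
Proof.
move=> c0; apply: le_trans (nrmZ_le _ _) _; rewrite normcR.
apply: le_trans (log_coeff_le k c0 (nrm_ge0 T)).
by rewrite ler_wpM2l// nrmX.
Qed.

Lemma geometric_ratio_lt1 T c : nrm T < c -> `|nrm T / c| < 1.
Proof.
move=> Tc; have c0 : 0 < c by apply: le_lt_trans Tc; exact: nrm_ge0.
by rewrite ger0_norm ?divr_ge0 ?nrm_ge0 ?(ltW c0)// ltr_pdivrMr// mul1r.
Qed.

Lemma log_part_cvg T c : nrm T < c -> exists L, ncvg (log_part T c) L.
Proof.
move=> Tc; have c0 : 0 < c by apply: le_lt_trans Tc; exact: nrm_ge0.
have [|L hL _] := ncvg_series (fun k => nrm_log_term T k c0).
  exact: is_cvg_geometric_series (geometric_ratio_lt1 Tc).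
by exists (zop O (ln c)%:C + L); apply: ncvgD => //; exact: ncvg_cst.
Qed.

Lemma sa_log_part T c N : sa T -> sa (log_part T c N).
Proof.
by move=> sT; apply: saD; [exact: sa_zop|apply: sa_sum => k; apply/saZ/saX].
Qed.

Lemma log_part_comm T c N X : T * X = X * T -> log_part T c N * X = X * log_part T c N.
Proof.
move=> TX; rewrite mulrDl mulrDr zopC; congr (_ + _).
rewrite mulr_suml mulr_sumr; apply: eq_bigr => k _.
by rewrite mulrA -zopC -!mulrA; congr (_ * _); apply/commr_sym/commrX.
Qed.

(** Composing the M-th partial sum of exp with the N-th of log gives a polynomial in T. By
    [peval_sa_le] its distance to c + T is at most the largest real error on [-|T|, |T|], namely the
    tail of exp at [K] plus a multiple of the error of the logarithm. N is sent to infinity first,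
    then M. *)
Lemma exp_log T c L : sa T -> nrm T < c -> ncvg (log_part T c) L ->
  expA L = zop O c%:C + T.
Proof.
move=> sT Tc hL; have c0 : 0 < c by apply: le_lt_trans Tc; exact: nrm_ge0.
(* a radius strictly between |T| and c, positive even if T = 0 *)
pose r := (nrm T + c) / 2.
have T0 := nrm_ge0 T.
have Trr : nrm T <= r by rewrite /r; lra.
have rc : 0 < r < c by apply/andP; rewrite /r; split; lra.
have r0 : 0 <= r by case/andP: rc => /ltW.
have q0 : 0 <= r / c by rewrite divr_ge0// ltW.
have q1 : `|r / c| < 1.
  rewrite ger0_norm//.
  by rewrite ltr_pdivrMr// mul1r; case/andP: rc.
(* A bound, independent of N, for the partial sums of the logarithm on the interval. *)
pose K := `|ln c| + limn (series (geometric (r / c) (r / c))).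
pose e N := 2 * (r / (c - r) * (r / c) ^+ N).
have e0 : e @ \oo --> (0 : R) by exact: clog_approx_cvg0.
have pK N x : `|x| <= nrm T -> `|(lpoly c N).[x]| <= K.
  move=> xT; rewrite horner_lpoly; apply: le_trans (ler_normD _ _) _; rewrite lerD2l.
  apply: le_trans (ler_norm_sum _ _ _) _.
  apply: le_trans (_ : series (geometric (r / c) (r / c)) N <= _).
    apply: ler_sum => k _; rewrite normrM normrX.
    apply: le_trans (log_coeff_le k c0 r0).
    by rewrite ler_wpM2l// lerXn2r ?nnegrE// (le_trans xT).
  apply: nondecreasing_cvgn_le; last exact: is_cvg_geometric_series.
  apply/nondecreasing_seqP => k; rewrite seriesSr lerDl /geometric/=.
  by apply: mulr_ge0 => //; exact: exprn_ge0.
have K0 : 0 <= K by apply: le_trans (pK 0%N 0 _); rewrite ?normr0.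
(* Lipschitz factor from [expR_lipschitz]: e^u <= e^K at the partial sum u, and exp(ln(c + x)) = c +
   x <= 2 c. *)
pose C := expR K + 2 * c.
have main M N : nrm (exp_part (log_part T c N) M - (zop O c%:C + T)) <=
    expR K - series (exp_coeff K) M + C * e N.
  have -> : exp_part (log_part T c N) M - (zop O c%:C + T) =
      peval T (toC (epoly (lpoly c N) M - (c%:P + 'X))).
    rewrite rmorphB pevalD -[X in peval T (- X)]mul1r -mulNr -polyC1 -polyCN pevalCM zopN zop1 mulN1r.
    by rewrite peval_epoly peval_lpoly rmorphD/= map_polyC map_polyX pevalD pevalC pevalX.
  have CeN : 0 <= C * e N.
    apply: mulr_ge0; first by rewrite addr_ge0 ?expR_ge0// mulr_ge0// ltW.
    apply: mulr_ge0 => //; apply: mulr_ge0; last exact: exprn_ge0.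
    by case/andP: rc => _ rc; rewrite divr_ge0// subr_ge0 ltW.
  apply: peval_sa_le => //.
    apply: addr_ge0 => //; apply: le_trans (@expR_tail_le R K K M _) => //.
    by rewrite ger0_norm.
  move=> x xT.
  rewrite hornerD hornerN hornerD hornerC hornerX horner_epoly.
  set u := (lpoly c N).[x]; have uK : `|u| <= K by exact: pK.
  have xr : `|x| <= r by apply: le_trans Trr.
  have cx : 0 < c + x.
    have := le_lt_trans xT Tc; rewrite ltr_norml => /andP[]; lra.
  have cx2 : c + x <= 2 * c.
    have := le_lt_trans xT Tc; rewrite ltr_norml => /andP[]; lra.
  have -> : series (exp_coeff u) M - (c + x) =
      (series (exp_coeff u) M - expR u) + (expR u - expR (ln (c + x))).
    by rewrite lnK ?posrE//; ring.
  apply: le_trans (ler_normD _ _) _; apply: lerD; first exact: expR_tail_le.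
  apply: le_trans (expR_lipschitz _ _) _; rewrite lnK ?posrE//.
  have u0 : 0 <= expR u + (c + x) by apply: addr_ge0; rewrite ?expR_ge0// ltW.
  apply: ler_pM => //.
    by rewrite /C lerD// ler_expR (le_trans (ler_norm _)).
  rewrite distrC /u horner_lpoly; exact: ln_approx.
have lim1 M : nrm (exp_part L M - (zop O c%:C + T)) <= expR K - series (exp_coeff K) M.
  have h : ncvg (fun N => exp_part (log_part T c N) M - (zop O c%:C + T))
     (exp_part L M - (zop O c%:C + T)).
    apply: ncvgB; last exact: ncvg_cst.
    by apply: ncvg_sum => k; apply/ncvgZ/ncvgX.
  have hb : (fun N => expR K - series (exp_coeff K) M + C * e N) @ \oo -->
      expR K - series (exp_coeff K) M.
    have := cvgD (cvg_cst (expR K - series (exp_coeff K) M)) (cvgM (cvg_cst C) e0).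
    by rewrite mulr0 addr0; apply.
  rewrite -(cvg_lim _ (nrm_cvg h))// -(cvg_lim _ hb)//; apply: ler_lim.
  - by apply/cvg_ex; eexists; exact: nrm_cvg h.
  - by apply/cvg_ex; eexists; exact: hb.
  - by apply: nearW => N; exact: main.
apply: expAE; apply: ncvg_le lim1 _.
exact: exp_tail_cvg0.
Qed.

(** For a partial sum of the series the moments converge by [momentX_cvg]. The moments of the
    remainder are small uniformly in N, since the remainder is small on the whole circle and the
    resolvents are bounded by (r - |T|)^-1. *)
Lemma moment_clog_cvg T c r L : nrm T < r -> r < c -> ncvg (log_part T c) L ->
  ncvg (fun N => moment T r N (fun w => clog (c%:C + w) * w)) L.
Proof.
move=> Tr rc hL; have r0 : 0 < r by apply: le_lt_trans Tr; exact: nrm_ge0.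
have rc' : 0 < r < c by rewrite r0.
have rT : 0 < r - nrm T by rewrite subr_gt0.
pose e N := 2 * (r / (c - r) * (r / c) ^+ N).
have e0 : e @ \oo --> (0 : R) by exact: clog_approx_cvg0.
have part M : ncvg (fun N => moment T r N (fun w => clog_part c w M * w)) (log_part T c M).
  have -> : (fun N => moment T r N (fun w => clog_part c w M * w)) =
     (fun N => zop O (ln c)%:C * moment T r N (fun w => w ^+ 1) +
        \sum_(0 <= k < M) zop O (log_coeff c k)%:C * moment T r N (fun w => w ^+ k.+2)).
    apply/funext => N; rewrite -momentZ; under [in RHS]eq_bigr do rewrite -momentZ.
    rewrite -moment_sum -momentD; congr moment; apply/funext => w.
    rewrite /clog_part mulrDl expr1 mulr_suml; congr (_ + _).
    by apply: eq_bigr => k _; rewrite -mulrA -exprSr.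
  apply: ncvgD; first by rewrite -[X in ncvg _ X]mulr1; apply: ncvgZ; exact: momentX_cvg.
  by apply: ncvg_sum => k; apply: ncvgZ; exact: momentX_cvg.
pose F N := moment T r N (fun w => clog (c%:C + w) * w).
pose P M N := moment T r N (fun w => clog_part c w M * w).
have FP M N : nrm (F N - P M N) <= e M * r * (r - nrm T)^-1.
  have -> : F N - P M N = moment T r N (fun w => (clog (c%:C + w) - clog_part c w M) * w).
    rewrite /F /P -mulN1r -zop1 -zopN -momentZ -momentD; congr moment.
    by apply/funext => w; rewrite mulrBl mulN1r.
  have eM : 0 <= e M.
    have cr : 0 <= c - r by rewrite subr_ge0 ltW.
    have cp : 0 <= c by rewrite ltW// (lt_trans r0).
    apply: mulr_ge0 => //; apply: mulr_ge0; first by apply: divr_ge0 => //; exact: ltW.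
    by apply: exprn_ge0; apply: divr_ge0 => //; exact: ltW.
  apply: nrm_moment_le => //; first by rewrite mulr_ge0 ?(ltW r0).
  move=> z zr; rewrite normcM zr ler_wpM2r ?(ltW r0)//.
  by apply: clog_approx => //; rewrite zr.
apply/cvgrPdist_le => eps eps0.
pose K := r * (r - nrm T)^-1.
have K0 : 0 < K by rewrite mulr_gt0 ?invr_gt0.
have e3 : 0 < eps / 3 by rewrite divr_gt0.
have e3K : 0 < eps / 3 / K by rewrite divr_gt0.
have [M [hM1 hM2]] : exists M, e M <= eps / 3 / K /\ nrm (log_part T c M - L) <= eps / 3.
  move/cvgrPdist_le: e0 => /(_ _ e3K) [M1 _ h1].
  have [M2 _ h2] := ncvg_near hL e3.
  exists (maxn M1 M2); split; last by apply: h2; rewrite /= leq_maxr.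
  have := h1 (maxn M1 M2) (leq_maxl _ _).
  by rewrite sub0r normrN; apply: le_trans; exact: ler_norm.
apply: filterS (ncvg_near (part M) e3) => N hN.
rewrite sub0r normrN ger0_norm ?nrm_ge0//.
have -> : F N - L = (F N - P M N) + (P M N - log_part T c M) + (log_part T c M - L).
  by rewrite !subrKA.
apply: le_trans (nrmD _ _) _; have -> : eps = eps / 3 + eps / 3 + eps / 3 by field.
apply: lerD => //; apply: le_trans (nrmD _ _) _; apply: lerD => //.
apply: le_trans (FP _ _) _; rewrite -mulrA -/K.
by rewrite -ler_pdivlMr.
Qed.

Definition cauchyA a c r (N : nat) : A :=
  \sum_(k < N) let z := c%:C + r%:C * expi (2 * pi * k%:R / N%:R) in
    zop O (N%:R^-1 * clog z * (z - c%:C)) * inverse (zop O z - a).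

Lemma cauchyA_moment a c r N :
  cauchyA a c r N = moment (a - zop O c%:C) r N (fun w => clog (c%:C + w) * w).
Proof.
apply: eq_bigr => k _ /=; rewrite -/(circle_pt r N k) addrAC subrr add0r -(mulrA _^-1).
congr (_ * inverse _).
by rewrite zopD opprB addrA [RHS]addrAC [RHS]addrC addrA.
Qed.

Lemma pos_unit_shift a S : pos a -> is_inverse a S ->
  exists c r : R, [/\ 0 < r, r < c & nrm (a - zop O c%:C) < r].
Proof.
move=> pa aS; have [m m0 hm] := pos_inverse_ge pa aS.
have na := nrm_ge0 a.
(* The form of a lies between m and |a|, so a is within |a| of the center |a| + m; the radius is
   taken halfway between |a| and the center. *)
exists (nrm a + m), (nrm a + m / 2); split; [lra|lra|].
rewrite nrmC; apply: le_lt_trans (nrm_shift_le pa.1 hm _ _) _; lra.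
Qed.

(** Converts the spectral condition on the circle into a norm bound: with T = a - c, the numbers |T|
    and -|T| cannot both be regular, so one of them gives a spectral value of a at distance |T| from
    c. *)
Lemma sa_spectrum_nrm a c r : sa a -> 0 < r ->
  (forall z : R[i], ~ (exists b : A, is_inverse (zop O z - a) b) -> normc (z - c%:C) < r) ->
  nrm (a - zop O c%:C) < r.
Proof.
move=> sA r0 h; rewrite ltNge; apply/negP => rn.
set T := a - zop O c%:C in rn.
have sT : sa T by apply: saB => //; exact: sa_zop.
have n0 : 0 < nrm T by apply: lt_le_trans rn.
have inv (z : R) : `|z| = nrm T -> exists b : A, is_inverse (zop O z%:C - T) b.
  move=> zT; apply: contrapT => hn; have := h (c%:C + z%:C).
  rewrite addrAC subrr add0r normcR zT ltNge rn => H; apply: notF; apply: H => -[b hb].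
  apply: hn; exists b; move: hb; rewrite zopD /T opprB addrA.
  by rewrite [zop O c%:C + _]addrC.
have [|S hS] := inv (nrm T); first by rewrite ger0_norm ?ltW.
have [|S' hS'] := inv (- nrm T); first by rewrite normrN ger0_norm ?ltW.
apply: (sa_nrm_spectrum sT n0 hS (S' := - S')).
have -> : zop O (nrm T)%:C + T = - (zop O (- nrm T)%:C - T).
  by rewrite rmorphN zopN opprB opprK addrC.
exact: is_inverseN.
Qed.

End Logarithm.

(** * Derivations *)

Section Derivation.
Variables (R : realType) (O : opAlg R).
Local Notation A := (alg O).
Local Open Scope complex_scope.
Implicit Types (x y d l : A) (e h s t : R).
Variable V : R -> A.
Hypothesis V0 : V 0 = 1.
Hypothesis VD : forall s t, V (s + t) = V s * V t.
Hypothesis V_le : forall t, nrm (V t) <= 1.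

Definition conj_flow t x : A := V t * x * V (- t).

Definition diff_quot h x : A := zop O (h^-1)%:C * (conj_flow h x - x).

(** Translations are not continuous in operator norm, so differentiability concerns the element x
    and not the group [V]. *)
Definition isder x d : Prop := forall e, 0 < e ->
  exists2 r, 0 < r & forall h, 0 < `|h| < r -> nrm (diff_quot h x - d) <= e.

Definition hasder x : Prop := exists d, isder x d.

Lemma VNr t : V t * V (- t) = 1.
Proof. by rewrite -VD subrr V0. Qed.

Lemma VNl t : V (- t) * V t = 1.
Proof. by rewrite -VD addNr V0. Qed.

Lemma conj_flowM t x y : conj_flow t (x * y) = conj_flow t x * conj_flow t y.
Proof. by rewrite /conj_flow !mulrA -[_ * V (- t) * V t]mulrA VNl mulr1. Qed.

Lemma conj_flowD t x y : conj_flow t (x + y) = conj_flow t x + conj_flow t y.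
Proof. by rewrite /conj_flow mulrDr mulrDl. Qed.

Lemma conj_flowN t x : conj_flow t (- x) = - conj_flow t x.
Proof. by rewrite /conj_flow mulrN mulNr. Qed.

Lemma conj_flow_zop t (z : R[i]) : conj_flow t (zop O z) = zop O z.
Proof. by rewrite /conj_flow -zopC -mulrA VNr mulr1. Qed.

Lemma conj_flow_add s t x : conj_flow (s + t) x = conj_flow s (conj_flow t x).
Proof. by rewrite /conj_flow opprD (addrC (- s)) !VD !mulrA. Qed.

Lemma nrm_conj_flow t x : nrm (conj_flow t x) <= nrm x.
Proof.
apply: le_trans (nrmM _ _) _; rewrite -[leRHS]mulr1; apply: ler_pM; rewrite ?nrm_ge0//.
by apply: le_trans (nrmM _ _) _; rewrite -[leRHS]mul1r ler_wpM2r ?nrm_ge0.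
Qed.

Lemma diff_quotD h x y : diff_quot h (x + y) = diff_quot h x + diff_quot h y.
Proof. by rewrite /diff_quot -mulrDr conj_flowD opprD addrACA. Qed.

Lemma diff_quotN h x : diff_quot h (- x) = - diff_quot h x.
Proof. by rewrite /diff_quot conj_flowN -opprD mulrN. Qed.

Lemma diff_quot_zop h (z : R[i]) : diff_quot h (zop O z) = 0.
Proof. by rewrite /diff_quot conj_flow_zop subrr mulr0. Qed.

Lemma diff_quotM h x y :
  diff_quot h (x * y) = diff_quot h x * conj_flow h y + x * diff_quot h y.
Proof.
have C (z : R[i]) w : x * (zop O z * w) = zop O z * (x * w) by rewrite !mulrA zopC.
rewrite /diff_quot conj_flowM C -[X in _ = X + _]mulrA -mulrDr.
by congr (_ * _); rewrite mulrBl mulrBr addrA subrK.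
Qed.

Lemma conj_flow_sub h x : h != 0 -> conj_flow h x - x = zop O h%:C * diff_quot h x.
Proof.
move=> h0; rewrite /diff_quot mulrA -zopM -rmorphM/= divff// zop1 mul1r; by [].
Qed.

Lemma nrm_conj_flow_iter t x k :
  nrm (conj_flow (t *+ k) x - x) <= k%:R * nrm (conj_flow t x - x).
Proof.
elim: k => [|k IH].
  by rewrite mulr0n mul0r /conj_flow oppr0 V0 mul1r mulr1 subrr nrm0.
have -> : conj_flow (t *+ k.+1) x - x =
    conj_flow t (conj_flow (t *+ k) x - x) + (conj_flow t x - x).
  by rewrite conj_flowD conj_flowN -conj_flow_add -mulrS subrKA.
apply: le_trans (nrmD _ _) _; rewrite -natr1 mulrDl mul1r lerD2r.
by apply: le_trans (nrm_conj_flow _ _) _.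
Qed.

(* V_h x V_-h - x telescopes into h / m steps, and V_t is a contraction. *)
Lemma isder_bound x d h : isder x d -> h != 0 -> nrm (diff_quot h x) <= nrm d.
Proof.
move=> xd h0; apply/ler_addgt0Pr => e e0; have [r r0 hr] := xd e e0.
have hp : 0 < `|h| by rewrite normr_gt0.
pose N := (Num.trunc (`|h| / r)).+1.
have N0 : 0 < N%:R :> R by rewrite ltr0n.
pose k := h / N%:R.
have kh : k *+ N = h by rewrite -mulr_natr divfK// gt_eqF.
have k0 : k != 0 by rewrite mulf_neq0// invr_eq0 gt_eqF.
have nk : `|k| = `|h| / N%:R by rewrite normrM [`|_^-1|]ger0_norm// invr_ge0 ltW.
have kr : 0 < `|k| < r.
  rewrite normr_gt0 k0/= nk ltr_pdivrMr// mulrC -ltr_pdivrMr//.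
  exact: truncnS_gt.
have b := nrm_conj_flow_iter k x N; rewrite kh conj_flow_sub// in b.
rewrite /diff_quot; apply: le_trans (nrmZ_le _ _) _.
rewrite normcR normrV ?unitfE// mulrC ler_pdivrMr//.
rewrite conj_flow_sub// ; apply: le_trans b _.
rewrite (conj_flow_sub _ k0); apply: le_trans (ler_wpM2l (ltW N0) (nrmZ_le _ _)) _.
rewrite normcR nk mulrA mulrCA divff ?mulr1 ?gt_eqF// mulrC ler_wpM2r ?(ltW hp)//.
rewrite -[diff_quot k x](subrK d); apply: le_trans (nrmD _ _) _.
by rewrite addrC lerD2l; exact: hr.
Qed.

Lemma isder_zop (z : R[i]) : isder (zop O z) 0.
Proof.
move=> e e0; exists 1 => // h _.
by rewrite diff_quot_zop subrr nrm0 ltW.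
Qed.

Lemma isderD x y d d' : isder x d -> isder y d' -> isder (x + y) (d + d').
Proof.
move=> hx hy e e0; have e2 : 0 < e / 2 by rewrite divr_gt0.
have [r r0 hr] := hx _ e2; have [r' r0' hr'] := hy _ e2.
exists (Num.min r r'); first by rewrite lt_min r0.
move=> h; rewrite lt_min andbA => /andP[/andP[h0 h1] h2].
rewrite diff_quotD opprD addrACA; apply: le_trans (nrmD _ _) _.
have -> : e = e / 2 + e / 2 by field.
by apply: lerD; [apply: hr|apply: hr']; rewrite h0.
Qed.

Lemma isderM x y d d' : isder x d -> isder y d' -> isder (x * y) (d * y + x * d').
Proof.
move=> hx hy e e0; have e3 : 0 < e / 3 by rewrite divr_gt0.
have p (z : A) : 0 < nrm z + 1 by rewrite ltr_wpDl ?nrm_ge0.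
have q0 : 0 < nrm d * nrm d' + 1 by rewrite ltr_wpDl ?mulr_ge0 ?nrm_ge0.
have [r r0 hr] := hx _ (divr_gt0 e3 (p y)).
have [r' r0' hr'] := hy _ (divr_gt0 e3 (p x)).
(* Controls the cross term, of size at most |h| |d| |d'| by [isder_bound]. *)
pose r'' := e / 3 / (nrm d * nrm d' + 1).
have r0'' : 0 < r'' by rewrite divr_gt0.
exists (Num.min r (Num.min r' r'')); first by rewrite !lt_min r0 r0'.
move=> h; rewrite !lt_min => /and4P[h0 h1 h2 h3].
have hn0 : h != 0 by rewrite -normr_gt0.
have -> : diff_quot h (x * y) - (d * y + x * d') =
   diff_quot h x * (conj_flow h y - y) + (diff_quot h x - d) * y + x * (diff_quot h y - d').
  rewrite diff_quotM opprD addrACA -mulrBr; congr (_ + _).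
  by rewrite mulrBr mulrBl addrA subrK.
have -> : e = e / 3 + e / 3 + e / 3 by field.
have h1' : 0 < `|h| < r by rewrite h0.
have h2' : 0 < `|h| < r' by rewrite h0.
apply: le_trans (nrmD _ _) _; apply: lerD; last first.
  apply: le_trans (nrmM _ _) _; apply: le_trans (ler_wpM2l (nrm_ge0 _) (hr' _ h2')) _.
  rewrite mulrA ler_pdivrMr// mulrC ler_wpM2l ?(ltW e3)//; by rewrite lerDl.
apply: le_trans (nrmD _ _) _; apply: lerD; last first.
  apply: le_trans (nrmM _ _) _; apply: le_trans (ler_wpM2r (nrm_ge0 _) (hr _ h1')) _.
  by rewrite mulrAC ler_pdivrMr// ler_wpM2l ?(ltW e3)// lerDl.
apply: le_trans (nrmM _ _) _; rewrite conj_flow_sub//.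
apply: le_trans (_ : nrm d * (`|h| * nrm d') <= _).
  apply: ler_pM; rewrite ?nrm_ge0 ?(isder_bound hx)//.
  apply: le_trans (nrmZ_le _ _) _; rewrite normcR ler_wpM2l//; exact: isder_bound hy hn0.
rewrite mulrCA; apply: le_trans (_ : r'' * (nrm d * nrm d' + 1) <= _).
  by apply: ler_pM; rewrite ?mulr_ge0 ?nrm_ge0 ?(ltW h3)// lerDl.
by rewrite /r'' divfK// gt_eqF.
Qed.

Lemma isderZ (z : R[i]) x d : isder x d -> isder (zop O z * x) (zop O z * d).
Proof. by move=> /(isderM (isder_zop z)); rewrite mul0r add0r. Qed.

Lemma isder_sum (I : Type) (s : seq I) (F D : I -> A) :
  (forall i, isder (F i) (D i)) -> isder (\sum_(i <- s) F i) (\sum_(i <- s) D i).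
Proof.
move=> h; elim/big_rec2: _ => [|i y x _ IH]; last exact: isderD.
by have := isder_zop 0; rewrite zop0.
Qed.

(** By [isder_bound], the quotients of u M - u N are at most |D M - D N| for every step h. Letting M
    tend to infinity bounds the quotient of l - u N uniformly in h, so that one rank N serves all
    small h. *)
Lemma isder_closed (u D : nat -> A) l d : (forall N, isder (u N) (D N)) ->
  ncvg u l -> ncvg D d -> isder l d.
Proof.
move=> uD ul Dd e e0; have e3 : 0 < e / 3 by rewrite divr_gt0.
have [N _ hN] := ncvg_near Dd e3.
have dN : nrm (D N - d) <= e / 3 by exact: (hN N (leqnn N)).
have [r r0 hr] := uD N _ e3; exists r => // h hh.
have h0 : h != 0 by case/andP: hh; rewrite normr_gt0.
have qN : nrm (diff_quot h (l - u N)) <= e / 3.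
  have c1 : ncvg (fun M => diff_quot h (u M - u N)) (diff_quot h (l - u N)).
    apply: ncvgZ; apply: ncvgB.
      apply: ncvgM; last exact: ncvg_cst.
      by apply: ncvgM; [exact: ncvg_cst|apply: ncvgB => //; exact: ncvg_cst].
    by apply: ncvgB => //; exact: ncvg_cst.
  have c2 : ncvg (fun M => D M - D N) (d - D N) by apply: ncvgB => //; exact: ncvg_cst.
  apply: le_trans (_ : nrm (d - D N) <= _); last by rewrite nrmC.
  rewrite -(cvg_lim _ (nrm_cvg c1))// -(cvg_lim _ (nrm_cvg c2))//; apply: ler_lim.
  - by apply/cvg_ex; eexists; exact: nrm_cvg c1.
  - by apply/cvg_ex; eexists; exact: nrm_cvg c2.
  apply: nearW => M; apply: isder_bound h0; rewrite -[u M - u N]/(u M + - u N).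
  apply: isderD => //; rewrite -mulN1r -[- D N]mulN1r -(zop1 O) -zopN.
  exact: isderZ.
have -> : diff_quot h l - d = diff_quot h (l - u N) + (diff_quot h (u N) - D N) + (D N - d).
  by rewrite diff_quotD diff_quotN !subrKA.
have -> : e = e / 3 + e / 3 + e / 3 by field.
apply: le_trans (nrmD _ _) _; apply: lerD => //.
apply: le_trans (nrmD _ _) _; apply: lerD => //.
exact: hr.
Qed.

Lemma hasder_series (u : nat -> A) (v : nat -> R) l :
  (forall k, exists2 d, isder (u k) d & nrm d <= v k) -> cvgn (series v) ->
  ncvg (fun N => \sum_(0 <= k < N) u k) l -> hasder l.
Proof.
move=> h cv ul.
have /choice[D hD] : forall k, exists d, isder (u k) d /\ nrm d <= v k.
  by move=> k; have [d] := h k; exists d.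
have [d hd _] := ncvg_series (fun k => (hD k).2) cv.
exists d; apply: isder_closed ul hd => N.
by apply: isder_sum => k; exact: (hD k).1.
Qed.

Lemma isderX x d k : isder x d ->
  exists2 d', isder (x ^+ k.+1) d' & nrm d' <= k.+1%:R * nrm x ^+ k * nrm d.
Proof.
move=> xd; elim: k => [|k [d' hd' nd']].
  by exists d; rewrite ?expr1// expr0 !mul1r.
exists (d * x ^+ k.+1 + x * d'); first by rewrite exprS; exact: isderM.
apply: le_trans (nrmD _ _) _.
have b1 : nrm (d * x ^+ k.+1) <= nrm d * nrm x ^+ k.+1.
  by apply: le_trans (nrmM _ _) _; rewrite ler_wpM2l ?nrm_ge0 ?nrmX.
have b2 : nrm (x * d') <= nrm x * (k.+1%:R * nrm x ^+ k * nrm d).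
  by apply: le_trans (nrmM _ _) _; rewrite ler_wpM2l ?nrm_ge0.
apply: le_trans (lerD b1 b2) _; rewrite -[k.+2%:R]natr1 le_eqVlt; apply/orP; left.
by apply/eqP; rewrite exprS; ring.
Qed.

Lemma hasderD x y : hasder x -> hasder y -> hasder (x + y).
Proof. by move=> [d hd] [d' hd']; exists (d + d'); exact: isderD. Qed.

Lemma hasderM x y : hasder x -> hasder y -> hasder (x * y).
Proof. by move=> [d hd] [d' hd']; exists (d * y + x * d'); exact: isderM. Qed.

Lemma hasder_zop (z : R[i]) : hasder (zop O z).
Proof. by exists 0; exact: isder_zop. Qed.

Lemma hasder1 : hasder 1.
Proof. by rewrite -(zop1 O); exact: hasder_zop. Qed.

Lemma hasder_sum (I : Type) (s : seq I) (F : I -> A) :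
  (forall i, hasder (F i)) -> hasder (\sum_(i <- s) F i).
Proof.
move=> h; elim/big_rec: _ => [|i y _ IH]; last exact: hasderD.
by rewrite -(zop0 O); exact: hasder_zop.
Qed.

Lemma hasder_exp x : hasder x -> hasder (expA x).
Proof.
move=> [d xd].
(* Without its constant term the series involves powers k + 1 only, the case covered by [isderX];
   the factor k + 1 then cancels against the factorial. *)
have -> : expA x = 1 + (expA x - 1) by rewrite addrC subrK.
apply: hasderD; first exact: hasder1.
have c : ncvg (fun N => \sum_(0 <= k < N) zop O ((k.+1`!%:R)^-1)%:C * x ^+ k.+1) (expA x - 1).
  have := ncvgB (ncvg_shift (expA_cvg x)) (ncvg_cst 1).
  congr ncvg; apply/funext => N; rewrite /exp_part big_nat_recl//.
  by rewrite fact0 invr1 zop1 mul1r expr0 addrAC subrr add0r.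
have cv : cvgn (series (nrm d *: exp_coeff (nrm x))).
  by apply: is_cvg_seriesZ; exact: is_cvg_series_exp_coeff.
apply: hasder_series cv c => k.
have [d' hd' nd'] := isderX k xd; exists (zop O ((k.+1`!%:R)^-1)%:C * d'); first exact: isderZ.
apply: le_trans (nrmZ_le _ _) _; rewrite normcR ger0_norm ?invr_ge0//.
apply: le_trans (ler_wpM2l _ nd') _; first by rewrite invr_ge0.
rewrite le_eqVlt; apply/orP; left; apply/eqP.
rewrite -[RHS]/(nrm d * exp_coeff (nrm x) k) /exp_coeff/= factS natrM.
by field; rewrite addrC natr1 !pnatr_eq0 -!lt0n fact_gt0.
Qed.

(** The factor k + 1 from differentiating x^(k + 1) cancels the denominator of [log_coeff], leaving
    a geometric majorant of ratio |x| / c. *)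
Lemma hasder_log x c l : hasder x -> nrm x < c -> ncvg (log_part x c) l -> hasder l.
Proof.
move=> [d xd] xc hl; have c0 : 0 < c by apply: le_lt_trans xc; exact: nrm_ge0.
have -> : l = zop O (ln c)%:C + (l - zop O (ln c)%:C) by rewrite addrC subrK.
apply: hasderD; first exact: hasder_zop.
have cc : ncvg (fun N => \sum_(0 <= k < N) zop O (log_coeff c k)%:C * x ^+ k.+1)
     (l - zop O (ln c)%:C).
  have := ncvgB hl (ncvg_cst (zop O (ln c)%:C)).
  congr ncvg; apply/funext => N; by rewrite addrAC subrr add0r.
have cv : cvgn (series (geometric (nrm d / c) (nrm x / c))).
  exact: is_cvg_geometric_series (geometric_ratio_lt1 xc).
apply: hasder_series cv cc => k.
have [d' hd' nd'] := isderX k xd; exists (zop O (log_coeff c k)%:C * d'); first exact: isderZ.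
apply: le_trans (nrmZ_le _ _) _; rewrite normcR norm_log_coeff//.
apply: le_trans (ler_wpM2l _ nd') _; first by rewrite invr_ge0 mulr_ge0// exprn_ge0// ltW.
rewrite le_eqVlt; apply/orP; left; apply/eqP; rewrite /geometric/= expr_div_n exprS.
by field; rewrite addrC natr1 pnatr_eq0 expf_neq0 ?gt_eqF.
Qed.

End Derivation.

(** * Complex structure, logarithms of positive elements, isometric flows *)

Section Complements.
Variables (R : realType) (O : opAlg R).
Local Notation A := (alg O).
Local Notation H := (hsp O).
Local Open Scope complex_scope.
Implicit Types (S T X Y l : A) (x y : H) (a b c m t : R).

Lemma rip_i x y : rip ('i *: x) ('i *: y) = rip x y.
Proof.
have c1 : csq ('i : R[i]) = 1 by rewrite /csq/= expr0n expr1n add0r.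
have := rip_csq ('i : R[i]) (x + y); rewrite c1 mul1r scalerDr !ripDl !ripDr.
have := rip_csq ('i : R[i]) x; have := rip_csq ('i : R[i]) y; rewrite c1 !mul1r => -> ->.
by rewrite (ripC y) (ripC ('i *: y)); lra.
Qed.

Lemma scale_ii x : ('i : R[i]) *: ('i *: x) = - x.
Proof. by rewrite scalerA -expr2 sqr_i scaleN1r. Qed.

Lemma rip_ir x y : rip x ('i *: y) = - rip ('i *: x) y.
Proof. by rewrite -rip_i scale_ii ripNr. Qed.

(** The hypothesis says that (T x, x) has no imaginary part. Polarization makes (T x, i y)
    antisymmetric in x and y; taking i y for y gives the symmetry. *)
Lemma sa_of_real_form T : (forall x, rip (act T x) ('i *: x) = 0) -> sa T.
Proof.
move=> h x y; pose q u v := rip (act T u) ('i *: v).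
have q0 u : q u u = 0 by exact: h.
have qC u v : q u v = - q v u.
  have := q0 (u + v); rewrite /q actDr scalerDr !ripDl !ripDr.
  by rewrite -!/(q _ _) !q0; lra.
have := qC x ('i *: y); rewrite /q scale_ii ripNr actZr rip_i => h1.
by rewrite (ripC x); lra.
Qed.

Lemma sa_real_form T x : sa T -> rip (act T x) ('i *: x) = 0.
Proof.
move=> sT; have e : rip (act T x) ('i *: x) = rip x ('i *: act T x) by rewrite sT actZr.
have h := rip_ir x (act T x); have c := ripC ('i *: x) (act T x); lra.
Qed.

(** The commutation clause holds because the logarithm is a limit of polynomials in T. *)
Lemma exists_log T S : pos T -> is_inverse T S -> exists l,
  [/\ sa l, expA l = T & forall X, T * X = X * T -> l * X = X * l].
Proof.
move=> pT hS; have [c [r [r0 rc nT]]] := pos_unit_shift pT hS.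
have nTc : nrm (T - zop O c%:C) < c by apply: lt_trans rc.
have [l hl] := log_part_cvg nTc.
have sT : sa (T - zop O c%:C) by apply: saB; [exact: pT.1|exact: sa_zop].
exists l; split.
- by apply: sa_ncvg hl _ => N; exact: sa_log_part.
- by rewrite (exp_log sT nTc hl) addrC subrK.
- move=> X TX; apply: comm_ncvg hl _ => N; apply: log_part_comm.
  by rewrite mulrBl mulrBr TX zopC.
Qed.

Section Unitary.
Variable V : R -> A.
Hypothesis V0 : V 0 = 1.
Hypothesis VD : forall s t, V (s + t) = V s * V t.
Hypothesis V_le : forall t, nrm (V t) <= 1.

Lemma hn_flow t x : hn (act (V t) x) = hn x.
Proof.
have le s y : hn (act (V s) y) <= hn y.
  by apply: le_trans (le_nrm _ _) _; rewrite ler_piMl ?hn_ge0.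
apply/eqP; rewrite eq_le le/= -{1}[x]act1 -(VNl V0 VD t) actM; exact: le.
Qed.

Lemma rip_flow t x y : rip (act (V t) x) (act (V t) y) = rip x y.
Proof.
have e z : rip (act (V t) z) (act (V t) z) = rip z z by rewrite -!sqr_hn hn_flow.
have := e (x + y); rewrite actDr !ripDl !ripDr !e.
by rewrite (ripC y) (ripC (act _ y)); lra.
Qed.

Lemma rip_flow_adj t x y : rip (act (V t) x) y = rip x (act (V (- t)) y).
Proof. by rewrite -(rip_flow t x) -actM (VNr V0 VD) act1. Qed.

Lemma sa_conj_flow t T : sa T -> sa (conj_flow V t T).
Proof.
by move=> sT x y; rewrite /conj_flow !actM rip_flow_adj sT ripC -rip_flow_adj ripC.
Qed.

(** The flow is isometric, since V t and V (- t) are both contractions; hence the quotients at the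
    steps 1 / (N + 1) are selfadjoint, and so is their limit. *)
Lemma isder_sa T D : sa T -> isder V T D -> sa D.
Proof.
move=> sT TD; apply: (@sa_ncvg _ _ (fun N => diff_quot V (N.+1%:R^-1) T)).
  apply/cvgrPdist_le => e e0; have [r r0 hr] := TD e e0.
  exists (Num.trunc r^-1).+1 => // N /= hN; rewrite sub0r normrN ger0_norm ?nrm_ge0//.
  apply: hr; rewrite ger0_norm ?invr_ge0// invr_gt0 ltr0n/=.
  rewrite -[r]invrK ltf_pV2 ?posrE ?invr_gt0 ?ltr0n//.
  by apply: lt_trans (truncnS_gt _) _; rewrite ltr_nat.
by move=> N; apply: saZ; apply: saB => //; exact: sa_conj_flow.
Qed.

End Unitary.
End Complements.

(** * The Hilbert space of the torus *)

Section L2Hilbert.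
Variables (R : realType) (n : nat).
Notation T1 := (measurableTypeR R).
Notation Tn n := (n.-tuple T1).
Local Notation mu := (torus R n).
Local Open Scope complex_scope.
Implicit Types (u v w : l2fun R n) (xi eta : L2 R n).

Definition rdot u v (x : Tn n) : R := complex.Re (u x * (v x)^*).

Lemma rdotE u v x : rdot u v x =
  complex.Re (u x) * complex.Re (v x) + complex.Im (u x) * complex.Im (v x).
Proof. by rewrite /rdot; case: (u x) => a b; case: (v x) => c d /=; ring. Qed.

Lemma integrable_csq u : mu.-integrable setT (fun x => (csq (u x))%:E).
Proof.
apply/integrableP; split; first exact: measurable_csqE.
under eq_integral do rewrite gee0_abs ?lee_fin ?csq_ge0//.
by case: (l2funP u).
Qed.

Lemma integrable_rdot u v : mu.-integrable setT (EFin \o rdot u v).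
Proof.
have [_ mur mui _] := l2funP u; have [_ mvr mvi _] := l2funP v.
apply: (@le_integrable _ _ _ _ _ _ _ (fun x => (csq (u x))%:E + (csq (v x))%:E)%E) => //.
- apply/measurable_EFinP; rewrite (_ : rdot u v = (fun x =>
    ((@complex.Re R \o u) \* (@complex.Re R \o v)) x +
    ((@complex.Im R \o u) \* (@complex.Im R \o v)) x)).
    by apply: measurable_funD; exact: measurable_funM.
  by apply/funext => x; rewrite rdotE.
- move=> x _; rewrite -[leLHS]/(`|rdot u v x|%:E) -[leRHS]/(`|csq (u x) + csq (v x)|%:E).
  rewrite lee_fin [leRHS]ger0_norm; last by apply: addr_ge0; exact: csq_ge0.
  rewrite rdotE /csq.
  move: (complex.Re _) (complex.Im _) (complex.Re _) (complex.Im _) => a b c d.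
  rewrite ler_norml; apply/andP; split; rewrite -subr_ge0.
    rewrite (_ : _ - _ = ((a + c) ^+ 2 + (b + d) ^+ 2 + a ^+ 2 + b ^+ 2 + c ^+ 2 + d ^+ 2) / 2); last by field.
    by rewrite divr_ge0// !addr_ge0 ?sqr_ge0.
  rewrite (_ : _ - _ = ((a - c) ^+ 2 + (b - d) ^+ 2 + a ^+ 2 + b ^+ 2 + c ^+ 2 + d ^+ 2) / 2); last by field.
  by rewrite divr_ge0// !addr_ge0 ?sqr_ge0.
- by apply: integrableD => //; exact: integrable_csq.
Qed.

Definition l2rip u v : R := (\int[mu]_x rdot u v x)%R.

Lemma l2ripC u v : l2rip u v = l2rip v u.
Proof. by apply: eq_Rintegral => x _; rewrite !rdotE; ring. Qed.

Lemma l2ripDl u v w : l2rip (u + v) w = l2rip u w + l2rip v w.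
Proof.
rewrite /l2rip -RintegralD//; try exact: integrable_rdot.
by apply: eq_Rintegral => x _; rewrite !rdotE l2funDE cReD cImD; ring.
Qed.

Lemma l2ripZl (a : R) u v : l2rip (a%:C *: u) v = a * l2rip u v.
Proof.
rewrite /l2rip -RintegralZl//; last exact: integrable_rdot.
by apply: eq_Rintegral => x _; rewrite !rdotE l2funZE cReM cImM/=; ring.
Qed.

Lemma l2rip_sqint u : l2rip u u = sqint u.
Proof.
rewrite /l2rip /Rintegral /sqint; congr fine; apply: eq_integral => x _.
by rewrite rdotE /csq !expr2.
Qed.

Lemma l2ripDr u v w : l2rip u (v + w) = l2rip u v + l2rip u w.
Proof. by rewrite l2ripC l2ripDl !(l2ripC _ u). Qed.

Lemma l2ripZr (a : R) u v : l2rip u (a%:C *: v) = a * l2rip u v.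
Proof. by rewrite l2ripC l2ripZl l2ripC. Qed.

(** Cauchy-Schwarz against a zero norm; it makes the form depend on classes only. *)
Lemma l2rip_null u v : l2null u -> l2rip u v = 0.
Proof.
move=> /l2nullP h; have u0 : sqint u = 0 by rewrite -sq_l2norm h expr0n.
have : l2rip u v ^+ 2 <= sqint u * sqint v.
  apply: form_CS; rewrite ?sqint_ge0// => t.
  suff -> : sqint u + 2 * t * l2rip u v + t ^+ 2 * sqint v = sqint (u + t%:C *: v).
    exact: sqint_ge0.
  rewrite -!l2rip_sqint l2ripDl !l2ripDr !l2ripZl !l2ripZr (l2ripC v u); ring.
by rewrite u0 mul0r exprn_even_le0//= => /eqP.
Qed.

Lemma l2rip_eqr u v w : l2null (u - v) -> l2rip u w = l2rip v w.
Proof. by move=> h; rewrite -(subrK v u) l2ripDl (l2rip_null _ h) add0r. Qed.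

Definition L2rip xi eta : R := l2rip (repr xi) (repr eta).

Lemma L2rip_class u v : L2rip (class u) (class v) = l2rip u v.
Proof.
rewrite /L2rip (l2rip_eqr _ (repr_class u)) l2ripC (l2rip_eqr _ (repr_class v)).
exact: l2ripC.
Qed.

Lemma L2ripC xi eta : L2rip xi eta = L2rip eta xi.
Proof. exact: l2ripC. Qed.

Lemma L2ripDl xi xi' eta : L2rip (xi + xi') eta = L2rip xi eta + L2rip xi' eta.
Proof.
elim/L2ind: xi => u; elim/L2ind: xi' => v; elim/L2ind: eta => w.
by rewrite -classD !L2rip_class l2ripDl.
Qed.

Lemma L2ripZl (a : R) xi eta : L2rip (a%:C *: xi) eta = a * L2rip xi eta.
Proof.
by elim/L2ind: xi => u; elim/L2ind: eta => w; rewrite -classZ !L2rip_class l2ripZl.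
Qed.

Lemma L2rip_norm xi : L2rip xi xi = L2norm xi ^+ 2.
Proof. by elim/L2ind: xi => u; rewrite L2rip_class L2norm_class l2rip_sqint sq_l2norm. Qed.

Lemma L2norm_rip xi : Num.sqrt (L2rip xi xi) = L2norm xi.
Proof. by rewrite L2rip_norm sqrtr_sqr ger0_norm ?L2norm_ge0. Qed.

Lemma L2rip_csq (z : R[i]) xi : L2rip (z *: xi) (z *: xi) = csq z * L2rip xi xi.
Proof. by rewrite !L2rip_norm L2normZ exprMn sqr_sqrtr ?csq_ge0. Qed.

Lemma L2rip_ge0 xi : 0 <= L2rip xi xi.
Proof. by rewrite L2rip_norm sqr_ge0. Qed.

Lemma L2rip_eq0 xi : L2rip xi xi = 0 -> xi = 0.
Proof. by rewrite L2rip_norm => /eqP; rewrite sqrf_eq0 => /eqP/L2norm_eq0. Qed.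

Lemma L2innerE xi eta : L2inner xi eta = L2rip xi eta +i* L2rip xi ('i *: eta).
Proof.
elim/L2ind: xi => u; elim/L2ind: eta => v.
rewrite {1}/L2inner; congr (_ +i* _).
have E : l2null (repr ('i *: class v) - 'i *: repr (class v)).
  apply/class_eq; rewrite classZ !class_repr; by [].
rewrite /L2rip l2ripC (l2rip_eqr _ E); apply: eq_Rintegral => x _.
rewrite rdotE l2funZE cReM cImM.
by case: (repr (class u) x) => a b; case: (repr (class v) x) => c d /=; ring.
Qed.

Lemma L2normB xi eta : L2norm (xi - eta) = L2norm (eta - xi).
Proof.
by rewrite -opprB -scaleN1r L2normZ /csq/= oppr0 expr0n addr0 sqrrN expr1n sqrtr1 mul1r.
Qed.

End L2Hilbert.

(** * Completeness of L^2 (Riesz-Fischer) *)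

Section L2Complete.
Variables (R : realType) (n : nat).
Notation T1 := (measurableTypeR R).
Notation Tn n := (n.-tuple T1).
Local Notation mu := (torus R n).
Local Open Scope complex_scope.
Implicit Types (u v w : l2fun R n) (xi eta : L2 R n).

Lemma limn_einf_ub (u : (\bar R)^nat) (M : \bar R) :
  (forall k, u k <= M)%E -> (limn_einf u <= M)%E.
Proof.
move=> h; rewrite limn_einf_lim; apply: lime_le; first exact: is_cvg_einfs.
apply: nearW => k; apply: le_trans (h k).
by apply: ereal_inf_lbound; exists k => //=.
Qed.

Lemma csq_cvg (z : nat -> R[i]) (w : R[i]) :
  (fun k => complex.Re (z k)) @ \oo --> complex.Re w ->
  (fun k => complex.Im (z k)) @ \oo --> complex.Im w ->
  (fun k => csq (z k)) @ \oo --> csq w.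
Proof.
move=> hr hi; rewrite /csq !expr2; under eq_fun do rewrite !expr2.
by apply: cvgD; apply: cvgM.
Qed.

Lemma l2fun_periodic u : lattice_periodic u.
Proof. by have [] := l2funP u. Qed.

(** Fatou's lemma for the sequence shifted by [K], so that the bound is required from rank [K] on
    only. *)
Lemma sqint_fatou (F : nat -> l2fun R n) (f : Tn n -> R[i]) (M : R) (K : nat) :
  (forall x, (fun k => csq (F k x)) @ \oo --> csq (f x)) ->
  (forall k, (K <= k)%N -> sqint (F k) <= M) ->
  (\int[mu]_x (csq (f x))%:E <= M%:E)%E.
Proof.
move=> cF hM.
have := @fatou _ _ _ mu setT measurableT (fun k x => (csq (F (k + K)%N x))%:E).
move=> /(_ (fun k => measurable_csqE (F (k + K)%N)) (fun k x _ => csqE_ge0 _ _)) h.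
have -> : (\int[mu]_x (csq (f x))%:E =
    \int[mu]_x limn_einf (fun k => (csq (F (k + K)%N x))%:E))%E.
  apply: eq_integral => x _; apply/esym; apply: (cvg_limn_einf_sup _).1.
  apply: cvg_EFin; first exact: nearW.
  by rewrite [X in X @ _ --> _](_ : _ = fun k => csq (F (k + K)%N x))// (cvg_shiftn K (fun k => csq (F k x))).
apply: le_trans h _; apply: limn_einf_ub => k.
by rewrite sqintE lee_fin hM// leq_addl.
Qed.

Lemma sum_inv4_le N : \sum_(0 <= k < N) (4 ^- k : R) <= 2 - 2 * 4 ^- N.
Proof.
elim: N => [|N IH]; first by rewrite big_nil expr0 invr1 mulr1 subrr.
rewrite big_nat_recr//=; apply: le_trans (lerD IH (lexx _)) _.
have : 0 < 4 ^- N :> R by rewrite invr_gt0 exprn_gt0.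
rewrite exprS invfM; lra.
Qed.

Variable f : nat -> l2fun R n.
Hypothesis fC : forall m k, (m <= k)%N -> l2norm (f k - f m) <= 4 ^- m.

Let d k : l2fun R n := f k.+1 - f k.

(** As the square integral of [d k] is at most 16^-k, the weight 4^k leaves an integrable sum; where
    it is finite, |d_k(x)| <= sqrt(G(x)) 2^-k, which is summable. *)
Let G (x : Tn n) : \bar R := (\sum_(0 <= k <oo) (4 ^+ k * csq (d k x))%:E)%E.

Let term_ge0 k x : (0 <= (4 ^+ k * csq (d k x))%:E)%E.
Proof. by rewrite lee_fin mulr_ge0 ?csq_ge0 ?exprn_ge0. Qed.

Let measurable_term k : measurable_fun setT (fun x => (4 ^+ k * csq (d k x))%:E).
Proof.
under eq_fun do rewrite EFinM.
by apply: measurable_funeM; exact: measurable_csqE.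
Qed.

Let measurable_G : measurable_fun setT G.
Proof. exact: ge0_emeasurable_sum. Qed.

Let G_ge0 x : (0 <= G x)%E.
Proof. by apply: nneseries_ge0. Qed.

Let integral_G : (\int[mu]_x G x <= 2%:E)%E.
Proof.
rewrite integral_nneseries//; apply: lime_le.
  by apply: is_cvg_nneseries => k _ _; exact: integral_ge0.
apply: nearW => N.
apply: (@le_trans _ _ (\sum_(0 <= k < N) (4 ^- k)%:E)%E).
  apply: lee_sum => k _; under eq_integral do rewrite EFinM.
  rewrite ge0_integralZl//; last 2 first.
  - exact: measurable_csqE.
  - by move=> x _; exact: csqE_ge0.
  rewrite sqintE -EFinM lee_fin -sq_l2norm.
  have h := fC (leqnSn k); have p : 0 < 4 ^+ k :> R by rewrite exprn_gt0.
  have : l2norm (d k) ^+ 2 <= (4 ^- k) ^+ 2 by rewrite lerXn2r ?nnegrE ?l2norm_ge0 ?invr_ge0 ?(ltW p).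
  rewrite -(ler_pM2l p) => /le_trans; apply.
  by rewrite expr2 mulrA divff ?mul1r// gt_eqF.
rewrite sumEFin lee_fin; apply: le_trans (sum_inv4_le N) _.
by rewrite gerBl mulr_ge0 ?invr_ge0 ?exprn_ge0.
Qed.

Let A : set (Tn n) := [set x | (G x < +oo)%E].

Let measurable_A : measurable A.
Proof.
rewrite -[A]setTI; exact: emeasurable_fun_infty_o.
Qed.

Let ae_A : {ae mu, forall x, A x}.
Proof.
have iG : mu.-integrable setT G.
  apply/integrableP; split => //; under eq_integral do rewrite gee0_abs//.
  by apply: le_lt_trans integral_G _; rewrite ltry.
apply: filterS (integrable_ae measurableT iG) => x /(_ I).
by rewrite ge0_fin_numE.
Qed.

(** Cutting off outside [A] makes the sequence converge at every point, without changing its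
    classes. The indicator is periodic because [G] is, so the functions still live on the torus. *)
Let F_fun k (x : Tn n) : R[i] := (\1_A x : R)%:C * f k x.

Let csq_F_le k x : csq (F_fun k x) <= csq (f k x).
Proof.
rewrite /F_fun csqM ler_piMl ?csq_ge0// /csq/= expr0n addr0 indicE.
by case: (_ \in _); rewrite ?expr1n// expr0n.
Qed.

Let indic_periodic : lattice_periodic (\1_A : Tn n -> R).
Proof.
move=> z x; rewrite !indicE; congr (nat_of_bool _)%:R; apply/idP/idP; rewrite !inE /A/=.
  suff -> : G (tshift (lattice R z) x) = G x by [].
  by apply: eq_eseriesr => k _; rewrite l2fun_periodic.
suff -> : G (tshift (lattice R z) x) = G x by [].
by apply: eq_eseriesr => k _; rewrite l2fun_periodic.
Qed.

Let F_subproof k : F_fun k \in @l2_pred R n.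
Proof.
have [pf mr mi lf] := l2funP (f k).
have mI : measurable_fun setT (\1_A : Tn n -> R) by exact: measurable_indic.
have mrF : measurable_fun setT (@complex.Re R \o F_fun k).
  rewrite (_ : _ \o _ = (\1_A : Tn n -> R) \* (@complex.Re R \o f k)); first exact: measurable_funM.
  by apply/funext => x /=; rewrite Re_realM.
have miF : measurable_fun setT (@complex.Im R \o F_fun k).
  rewrite (_ : _ \o _ = (\1_A : Tn n -> R) \* (@complex.Im R \o f k)); first exact: measurable_funM.
  by apply/funext => x /=; rewrite Im_realM.
apply/asboolP; split => //.
- by move=> z x; rewrite /F_fun indic_periodic pf.
- apply: le_lt_trans lf; apply: ge0_le_integral => //.
  + by move=> x _; rewrite lee_fin csq_ge0.
  + by apply/measurable_EFinP; exact: measurable_csq.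
  + exact: measurable_csqE.
  + by move=> x _; rewrite lee_fin csq_F_le.
Qed.

Let F k : l2fun R n := L2Fun (F_subproof k).

Let F_null k : l2null (F k - f k).
Proof.
apply: filterS ae_A => x Ax; rewrite l2funDE l2funNE.
by rewrite -[F k x]/(F_fun k x) /F_fun indicE mem_set// mul1r subrr.
Qed.

Let term_le x k : A x -> csq (d k x) <= fine (G x) * 4 ^- k.
Proof.
move=> Ax; rewrite ler_pdivlMr ?exprn_gt0// mulrC -lee_fin fineK ?ge0_fin_numE//.
apply: le_trans (nneseries_lim_ge (P := xpredT) (m := 0) k.+1 _) => //.
rewrite big_nat_recr//= leeDr//; apply: sume_ge0 => i _; exact: term_ge0.
Qed.

Let F_cvg_comp (phi : R[i] -> R) x :
  (forall z z' : R[i], phi (z + z') = phi z + phi z') ->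
  (forall a (z : R[i]), phi (a%:C * z) = a * phi z) ->
  (forall z : R[i], `|phi z| <= normc z) -> cvgn (fun k => phi (F k x)).
Proof.
move=> phiD phiZ phile; have phi0 : phi 0 = 0 by have := phiZ 0 0; rewrite mulr0 mul0r.
have [Ax|nAx] := pselect (A x); last first.
  have -> : (fun k => phi (F k x)) = (fun=> 0).
    apply/funext => k; rewrite -[F k x]/(F_fun k x) /F_fun indicE memNset// mul0r.
    by [].
  exact: is_cvg_cst.
have -> : (fun k => phi (F k x)) = (fun k => phi (f 0%N x) + series (fun k => phi (d k x)) k).
  apply/funext => k; rewrite -[F k x]/(F_fun k x) /F_fun indicE mem_set// mul1r.
  elim: k => [|k IH]; first by rewrite /series/= big_nil addr0.
  rewrite seriesSr addrA -IH -phiD; congr phi.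
  by rewrite /d l2funDE l2funNE addrC subrK.
apply: is_cvgD; first exact: is_cvg_cst.
pose c := Num.sqrt (fine (G x)).
apply: normed_cvg; apply: (@series_le_cvg _ _ (geometric c (2^-1))).
- by move=> k /=; exact: normr_ge0.
- by move=> k; rewrite /geometric/= mulr_ge0 ?sqrtr_ge0 ?exprn_ge0 ?invr_ge0.
- move=> k; rewrite /geometric/=; apply: le_trans (phile _) _.
  have -> : normc (d k x) = Num.sqrt (csq (d k x)) by case: (d k x).
  apply: le_trans (ler_wsqrtr (term_le k Ax)) _.
  rewrite sqrtrM ?fine_ge0// -/c ler_wpM2l ?sqrtr_ge0//.
  have -> : (4 ^- k : R) = (2^-1 ^+ k) ^+ 2.
    by rewrite -exprM mulnC exprM -[LHS]exprVn; congr (_ ^+ k); field.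
  by rewrite sqrtr_sqr ger0_norm// exprn_ge0 ?invr_ge0.
- apply: is_cvg_geometric_series.
  by rewrite ger0_norm ?invr_ge0// invf_lt1 ?ltr1n.
Qed.

Let g (x : Tn n) : R[i] :=
  limn (fun k => complex.Re (F k x)) +i* limn (fun k => complex.Im (F k x)).

Let cvg_Re x : (fun k => complex.Re (F k x)) @ \oo --> complex.Re (g x).
Proof. have := @F_cvg_comp _ x (@cReD R) (@Re_realM R) (@normc_Re R); exact. Qed.

Let cvg_Im x : (fun k => complex.Im (F k x)) @ \oo --> complex.Im (g x).
Proof. have := @F_cvg_comp _ x (@cImD R) (@Im_realM R) (@normc_Im R); exact. Qed.

Let cvg_csq_sub (w : l2fun R n) x :
  (fun k => csq ((F k - w) x)) @ \oo --> csq (g x - w x).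
Proof.
have E k : (F k - w) x = F k x - w x by [].
apply: csq_cvg.
  under eq_fun do rewrite E cReD.
  by rewrite cReD; apply: cvgD; [exact: cvg_Re|exact: cvg_cst].
under eq_fun do rewrite E cImD.
by rewrite cImD; apply: cvgD; [exact: cvg_Im|exact: cvg_cst].
Qed.

Let integral_g_sub m :
  (\int[mu]_x (csq (g x - F m x))%:E <= ((4 ^- m) ^+ 2)%:E)%E.
Proof.
apply: (@sqint_fatou (fun k => F k - F m) _ _ m) => [x|k mk]; first exact: cvg_csq_sub.
rewrite -sq_l2norm; rewrite lerXn2r ?nnegrE ?l2norm_ge0 ?invr_ge0 ?exprn_ge0//.
apply: le_trans (fC mk); rewrite -!L2norm_class.
suff -> : class (F k - F m) = class (f k - f m) by [].
apply/class_eq; have -> : F k - F m - (f k - f m) = (F k - f k) - (F m - f m).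
  by rewrite !opprD !opprK addrACA.
by apply: filterS2 (F_null k) (F_null m) => x h1 h2; rewrite l2funDE l2funNE h1 h2 subrr.
Qed.

Let g_subproof : g \in @l2_pred R n.
Proof.
have mr : measurable_fun setT (@complex.Re R \o g).
  apply: (@measurable_fun_cvg _ _ _ _ (fun k => @complex.Re R \o F k)) => [k|x _]; last exact: cvg_Re.
  by case: (l2funP (F k)).
have mi : measurable_fun setT (@complex.Im R \o g).
  apply: (@measurable_fun_cvg _ _ _ _ (fun k => @complex.Im R \o F k)) => [k|x _]; last exact: cvg_Im.
  by case: (l2funP (F k)).
have pg : lattice_periodic g.
  move=> z x; rewrite /g; congr (limn _ +i* limn _); apply/funext => k;
    by rewrite l2fun_periodic.
apply/asboolP; split => //.
pose M := (l2norm (f 0%N) + 1) ^+ 2.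
apply: (@le_lt_trans _ _ M%:E); last by rewrite ltry.
apply: (@sqint_fatou F _ _ 0) => [x|k _].
  have := @csq_cvg (fun k => F k x) (g x) (@cvg_Re x) (@cvg_Im x); exact.
rewrite -sq_l2norm lerXn2r ?nnegrE ?l2norm_ge0 ?addr_ge0 ?l2norm_ge0//.
have -> : l2norm (F k) = l2norm (f k).
  by rewrite -!L2norm_class; congr L2norm; apply/class_eq.
rewrite -[f k](subrK (f 0%N)); apply: le_trans (l2normD _ _) _; rewrite addrC lerD2l.
by have := fC (leq0n k); rewrite expr0 invr1.
Qed.

Lemma l2_fast_cauchy_cvg : exists l : L2 R n, forall m, L2norm (class (f m) - l) <= 4 ^- m.
Proof.
pose gg : l2fun R n := L2Fun g_subproof.
exists (class gg) => m; rewrite L2normB.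
have -> : class (f m) = class (F m) by apply/esym/class_eq.
rewrite -[class gg - _]/(class gg + - class (F m)).
have -> : - class (F m) = class (- F m) by rewrite -scaleN1r -classZ scaleN1r.
rewrite -classD L2norm_class -(@ler_pXn2r _ 2)// ?nnegrE ?l2norm_ge0 ?invr_ge0 ?exprn_ge0//.
rewrite sq_l2norm -lee_fin -sqintE; exact: integral_g_sub.
Qed.

End L2Complete.

Lemma L2_complete (R : realType) (n : nat) (xi : nat -> L2 R n) :
  (forall e : R, 0 < e -> exists N, forall p q, (N <= p)%N -> (N <= q)%N ->
     L2norm (xi p - xi q) <= e) ->
  exists l, forall e : R, 0 < e -> exists N, forall p, (N <= p)%N -> L2norm (xi p - l) <= e.
Proof.
move=> h.
have p4 k : 0 < 4 ^- k :> R by rewrite invr_gt0 exprn_gt0.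
have /choice[N hN] : forall k, exists N, forall p q, (N <= p)%N -> (N <= q)%N ->
     L2norm (xi p - xi q) <= 4 ^- k by move=> k; exact: h (p4 k).
(* The maximum makes [s k] at least [N i] for all i <= k, so the extracted sequence is fast Cauchy
   even if [N] is not monotone. *)
pose s k := (\max_(i < k.+1) N i)%N.
have sN i k : (i <= k)%N -> (N i <= s k)%N.
  by move=> ik; rewrite /s (leq_bigmax (Ordinal (ik : (i < k.+1)%N))).
have [m k mk|l hl] := @l2_fast_cauchy_cvg R n (fun k => repr (xi (s k))).
  rewrite -L2norm_class (_ : class _ = xi (s k) - xi (s m)); first by apply: hN; exact: sN.
  rewrite classD class_repr; congr (_ + _).
  by rewrite -scaleN1r classZ class_repr scaleN1r.
exists l => e e0.
have [k hk] : exists k, 4 ^- k <= e / 2.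
  have e2 : 0 < e / 2 by rewrite divr_gt0.
  have c : (fun k => (4^-1 : R) ^+ k) @ \oo --> (0 : R).
    by apply: cvg_expr; rewrite ger0_norm ?invr_ge0// invf_lt1 ?ltr1n.
  move/cvgrPdist_le: c => /(_ _ e2) [k _ hk]; exists k.
  have := hk k (leqnn k); rewrite sub0r normrN exprVn; apply: le_trans; exact: ler_norm.
exists (N k) => p pN.
rewrite -(subrKA (xi (s k))); apply: le_trans (L2normD _ _) _.
have -> : e = e / 2 + e / 2 by field.
apply: lerD.
  by apply: le_trans hk; apply: hN => //; exact: sN.
by apply: le_trans hk; have := hl k; rewrite class_repr.
Qed.

(** * The algebras of the noncommutative torus *)

Section OperatorInstances.
Variables (R : realType) (n : nat).
Local Notation L2 := (L2 R n).
Local Notation B := (bop R n).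
Local Open Scope complex_scope.
Implicit Types (xi eta : L2) (S T : B).

Definition L2cvg (u : nat -> L2) l : Prop :=
  forall e : R, 0 < e -> exists N, forall p, (N <= p)%N -> L2norm (u p - l) <= e.

Lemma L2norm_small xi : (forall e, 0 < e -> L2norm xi <= e) -> xi = 0.
Proof.
move=> h; apply: L2norm_eq0; apply/eqP; rewrite eq_le L2norm_ge0 andbT.
by apply/ler_addgt0Pr => e e0; rewrite add0r h.
Qed.

Lemma L2cvg_uniq u l l' : L2cvg u l -> L2cvg u l' -> l = l'.
Proof.
move=> h h'; apply/eqP; rewrite -subr_eq0; apply/eqP/L2norm_small => e e0.
have e2 : 0 < e / 2 by rewrite divr_gt0.
have [N hN] := h _ e2; have [N' hN'] := h' _ e2; pose p := maxn N N'.
rewrite -(subrKA (u p)); apply: le_trans (L2normD _ _) _.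
have -> : e = e / 2 + e / 2 by field.
by apply: lerD; [rewrite L2normB hN ?leq_maxl|rewrite hN' ?leq_maxr].
Qed.

Lemma L2cvg_lin a u v l l' : L2cvg u l -> L2cvg v l' ->
  L2cvg (fun p => a *: u p + v p) (a *: l + l').
Proof.
move=> h h' e e0; pose c := Num.sqrt (csq a) + 1.
have c0 : 0 < c by rewrite ltr_wpDl ?sqrtr_ge0.
have e2 : 0 < e / 2 by rewrite divr_gt0.
have [N hN] := h _ (divr_gt0 e2 c0); have [N' hN'] := h' _ e2.
exists (maxn N N') => p; rewrite geq_max => /andP[pN pN'].
rewrite opprD addrACA -scalerBr; apply: le_trans (L2normD _ _) _.
have -> : e = e / 2 + e / 2 by field.
apply: lerD; last exact: hN'.
rewrite L2normZ; apply: le_trans (_ : c * (e / 2 / c) <= _).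
  by apply: ler_pM; rewrite ?sqrtr_ge0 ?L2norm_ge0 ?hN// lerDl.
by rewrite mulrC divfK// gt_eqF.
Qed.

(** The limit is taken pointwise in L^2; linearity passes to it, and its boundedness comes from one
    u N at uniform distance at most 1. *)
Lemma bop_complete (u : nat -> B) :
  (forall e, 0 < e -> exists N, forall p q, (N <= p)%N -> (N <= q)%N -> forall xi,
     L2norm ((u p - u q) xi) <= e * L2norm xi) ->
  exists l : B, forall e, 0 < e -> exists N, forall p, (N <= p)%N -> forall xi,
     L2norm ((u p - l) xi) <= e * L2norm xi.
Proof.
move=> h.
have /choice[T hT] : forall xi, exists l, L2cvg (fun p => u p xi) l.
  move=> xi; apply: L2_complete => e e0.
  have x0 : 0 < L2norm xi + 1 by rewrite ltr_wpDl ?L2norm_ge0.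
  have [N hN] := h _ (divr_gt0 e0 x0); exists N => p q pN qN.
  apply: le_trans (hN _ _ pN qN xi) _.
  by rewrite mulrAC ler_pdivrMr// ler_wpM2l ?(ltW e0)// lerDl.
have close e : 0 < e -> exists N, forall p, (N <= p)%N -> forall xi,
     L2norm (u p xi - T xi) <= e * L2norm xi.
  move=> e0; have [N hN] := h e e0; exists N => p pN xi.
  apply/ler_addgt0Pr => e' e'0; have [N' hN'] := hT xi _ e'0.
  rewrite -(subrKA (u (maxn N N') xi)); apply: le_trans (L2normD _ _) _.
  by apply: lerD; [apply: hN; rewrite ?leq_maxl|apply: hN'; rewrite leq_maxr].
have lT (a : R[i]) xi eta : T (a *: xi + eta) = a *: T xi + T eta.
  apply: L2cvg_uniq (hT _) _; under [u in L2cvg u]eq_fun do rewrite bop_lin.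
  exact: L2cvg_lin.
have bT : bop_prop T.
  split=> //; have [N hN] := close 1 ltr01; exists (1 + opnorm (u N)) => xi.
  rewrite -[T xi](subrK (u N xi)); apply: le_trans (L2normD _ _) _.
  rewrite mulrDl; apply: lerD; last exact: le_opnorm.
  by rewrite L2normB; apply: hN.
by exists (mkbop bT) => e /close[N hN]; exists N => p pN xi; exact: hN.
Qed.

Lemma bop_bnd T : exists M, forall xi, Num.sqrt (L2rip (T xi) (T xi)) <= M * Num.sqrt (L2rip xi xi).
Proof. by exists (opnorm T) => xi; rewrite !L2norm_rip; exact: le_opnorm. Qed.

Lemma bop_complete_rip (u : nat -> B) :
  (forall e, 0 < e -> exists N, forall p q, (N <= p)%N -> (N <= q)%N -> forall xi,
     Num.sqrt (L2rip ((u p - u q) xi) ((u p - u q) xi)) <= e * Num.sqrt (L2rip xi xi)) ->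
  exists l : B, forall e, 0 < e -> exists N, forall p, (N <= p)%N -> forall xi,
     Num.sqrt (L2rip ((u p - l) xi) ((u p - l) xi)) <= e * Num.sqrt (L2rip xi xi).
Proof.
move=> h; have [|l hl] := @bop_complete u.
  move=> e /h[N hN]; exists N => p q pN qN xi.
  by have := hN p q pN qN xi; rewrite !L2norm_rip.
exists l => e /hl[N hN]; exists N => p pN xi.
by have := hN p pN xi; rewrite !L2norm_rip.
Qed.

Definition OB : opAlg R := @OpAlg R L2 (@L2rip R n) (@L2ripDl R n) (@L2ripC R n)
  (@L2ripZl R n) (@L2rip_csq R n) (@L2rip_ge0 R n) (@L2rip_eq0 R n)
  B (fun T => T : L2 -> L2) (@bop_lin R n) (@bopDE R n) (@bopME R n) (@bop1E R n)
  (@bop_ext R n) bop_bnd (@cscalar R n) (fun z xi => erefl _) bop_complete_rip.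

Lemma hn_L2norm (xi : hsp OB) : hn xi = L2norm xi.
Proof. exact: L2norm_rip. Qed.

Lemma nrm_opnorm (T : OB) : nrm T = opnorm T.
Proof.
apply/eqP; rewrite eq_le; apply/andP; split.
  apply: nrm_le; first exact: opnorm_ge0.
  by move=> xi; rewrite !hn_L2norm; exact: le_opnorm.
apply: opnorm_le => xi x1; rewrite -hn_L2norm.
apply: le_trans (le_nrm _ _) _; rewrite hn_L2norm -[leRHS]mulr1.
by rewrite ler_wpM2l ?nrm_ge0.
Qed.

(** * Matrices of operators acting on a direct sum *)

Section Matrices.
Variable m : nat.
Local Notation H := {ffun 'I_m -> L2}.
Implicit Types (f g : H) (a b : 'M[B]_m).

Definition mrip f g : R := \sum_i L2rip (f i) (g i).

Definition mact a f : H := [ffun i => \sum_j a i j (f j)].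

Lemma mripDl f f' g : mrip (f + f') g = mrip f g + mrip f' g.
Proof. by rewrite -big_split; apply: eq_bigr => i _; rewrite ffunE L2ripDl. Qed.

Lemma mripC f g : mrip f g = mrip g f.
Proof. by apply: eq_bigr => i _; rewrite L2ripC. Qed.

Lemma mripZl (c : R) f g : mrip (c%:C *: f) g = c * mrip f g.
Proof. by rewrite mulr_sumr; apply: eq_bigr => i _; rewrite ffunE L2ripZl. Qed.

Lemma mrip_csq (z : R[i]) f : mrip (z *: f) (z *: f) = csq z * mrip f f.
Proof. by rewrite mulr_sumr; apply: eq_bigr => i _; rewrite ffunE L2rip_csq. Qed.

Lemma mrip_ge0 f : 0 <= mrip f f.
Proof. by apply: sumr_ge0 => i _; exact: L2rip_ge0. Qed.

Lemma mrip_eq0 f : mrip f f = 0 -> f = 0.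
Proof.
move=> /eqP; rewrite psumr_eq0 => [/allP h|i _]; last exact: L2rip_ge0.
apply/ffunP => i; rewrite ffunE; apply: L2rip_eq0; apply/eqP.
by have := h i (mem_index_enum i).
Qed.

Lemma bop_sumE (I : Type) (s : seq I) (P : pred I) (F : I -> B) xi :
  (\sum_(i <- s | P i) F i) xi = \sum_(i <- s | P i) F i xi.
Proof. by elim/big_rec2: _ => // i x y _ <-. Qed.

Lemma bop_sumr T (I : Type) (s : seq I) (P : pred I) (F : I -> L2) :
  T (\sum_(i <- s | P i) F i) = \sum_(i <- s | P i) T (F i).
Proof. by elim/big_rec2: _ => [|i x y _ <-]; rewrite ?bop0 ?bopD. Qed.

Lemma mact_lin a (z : R[i]) f g : mact a (z *: f + g) = z *: mact a f + mact a g.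
Proof.
apply/ffunP => i; rewrite !ffunE scaler_sumr -big_split; apply: eq_bigr => j _.
by rewrite !ffunE bop_lin.
Qed.

Lemma mactD a b f : mact (a + b) f = mact a f + mact b f.
Proof.
apply/ffunP => i; rewrite !ffunE -big_split; apply: eq_bigr => j _.
by rewrite mxE bopDE.
Qed.

Lemma mactM a b f : mact (a * b) f = mact a (mact b f).
Proof.
apply/ffunP => i; rewrite !ffunE.
under eq_bigr do rewrite mxE bop_sumE.
rewrite exchange_big; apply: eq_bigr => j _ /=.
by rewrite ffunE bop_sumr.
Qed.

Lemma mact_scalar T f i : mact T%:M f i = T (f i).
Proof.
rewrite ffunE (bigD1 i)//= mxE eqxx mulr1n big1 ?addr0// => j ji.
by rewrite mxE eq_sym (negbTE ji) mulr0n bop0E.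
Qed.

Lemma mact1 f : mact 1 f = f.
Proof. by apply/ffunP => i; rewrite mact_scalar bop1E. Qed.

Definition mdelta j xi : H := [ffun j' => if j' == j then xi else 0].

Lemma mact_delta a i j xi : mact a (mdelta j xi) i = a i j xi.
Proof.
rewrite ffunE (bigD1 j)//= ffunE eqxx big1 ?addr0// => k kj.
by rewrite ffunE (negbTE kj) bop0.
Qed.

Lemma mact_inj a b : (forall f, mact a f = mact b f) -> a = b.
Proof.
by move=> h; apply/matrixP => i j; apply: bop_ext => xi; rewrite -!mact_delta h.
Qed.

Lemma mact_zop (z : R[i]) f : mact (cscalar n z)%:M f = z *: f.
Proof. by apply/ffunP => i; rewrite mact_scalar ffunE. Qed.

Definition mnorm f : R := Num.sqrt (mrip f f).

Lemma mrip_norm f : mrip f f = \sum_i L2norm (f i) ^+ 2.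
Proof. by apply: eq_bigr => i _; rewrite L2rip_norm. Qed.

Lemma L2norm_le_mnorm f i : L2norm (f i) <= mnorm f.
Proof.
rewrite -[leLHS]ger0_norm ?L2norm_ge0// -sqrtr_sqr ler_wsqrtr// mrip_norm (bigD1 i)//=.
by rewrite lerDl sumr_ge0// => j _; rewrite sqr_ge0.
Qed.

Lemma mnorm_le_sum f : mnorm f <= \sum_i L2norm (f i).
Proof.
have s0 : 0 <= \sum_i L2norm (f i) by apply: sumr_ge0 => i _; exact: L2norm_ge0.
rewrite -[leRHS]ger0_norm// -sqrtr_sqr ler_wsqrtr// mrip_norm expr2 mulr_suml.
apply: ler_sum => i _; rewrite expr2 ler_wpM2l ?L2norm_ge0//.
by rewrite (bigD1 i)//= lerDl sumr_ge0// => j _; exact: L2norm_ge0.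
Qed.

Lemma L2norm_sum (I : Type) (s : seq I) (F : I -> L2) :
  L2norm (\sum_(i <- s) F i) <= \sum_(i <- s) L2norm (F i).
Proof.
elim/big_rec2: _ => [|i y x _ h]; first by rewrite L2norm0.
by apply: le_trans (L2normD _ _) _; rewrite lerD2l.
Qed.

Lemma mact_le a f : mnorm (mact a f) <= (\sum_i \sum_j opnorm (a i j)) * mnorm f.
Proof.
apply: le_trans (mnorm_le_sum _) _; rewrite mulr_suml; apply: ler_sum => i _.
rewrite ffunE; apply: le_trans (L2norm_sum _ _) _; rewrite mulr_suml.
apply: ler_sum => j _; apply: le_trans (le_opnorm _ _) _.
by rewrite ler_wpM2l ?opnorm_ge0 ?L2norm_le_mnorm.
Qed.

Lemma mnorm_delta j xi : mnorm (mdelta j xi) = L2norm xi.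
Proof.
rewrite /mnorm mrip_norm (bigD1 j)//= ffunE eqxx big1 ?addr0 => [|i ij].
  by rewrite sqrtr_sqr ger0_norm ?L2norm_ge0.
by rewrite ffunE (negbTE ij) L2norm0 expr0n.
Qed.

Lemma mact_complete (u : nat -> 'M[B]_m) :
  (forall e, 0 < e -> exists N, forall p q, (N <= p)%N -> (N <= q)%N -> forall f,
     mnorm (mact (u p - u q) f) <= e * mnorm f) ->
  exists l : 'M[B]_m, forall e, 0 < e -> exists N, forall p, (N <= p)%N -> forall f,
     mnorm (mact (u p - l) f) <= e * mnorm f.
Proof.
move=> h.
have /choice[l hl] : forall ij, exists l : B, forall e, 0 < e -> exists N, forall p, (N <= p)%N ->
     forall xi, L2norm ((u p ij.1 ij.2 - l) xi) <= e * L2norm xi.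
  move=> [i j]; apply: bop_complete => e /h[N hN]; exists N => p q pN qN xi /=.
  have := hN p q pN qN (mdelta j xi); rewrite mnorm_delta; apply: le_trans.
  apply: le_trans (L2norm_le_mnorm _ i); by rewrite mact_delta !mxE.
exists (\matrix_(i, j) l (i, j)) => e e0.
have d0 : 0 < (m * m).+1%:R :> R by rewrite ltr0n.
pose e' := e / (m * m).+1%:R; have e'0 : 0 < e' by rewrite divr_gt0.
have /choice[N hN] := fun ij => hl ij e' e'0.
exists (\max_ij N ij) => p pN f; apply: le_trans (mact_le _ _) _.
rewrite ler_wpM2r ?sqrtr_ge0//.
apply: (@le_trans _ _ (\sum_(i < m) \sum_(j < m) e')).
  apply: ler_sum => i _; apply: ler_sum => j _; apply: opnorm_le => xi x1.
  rewrite !mxE; apply: (le_trans (hN (i, j) p _ xi)).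
    by apply: leq_trans pN; exact: leq_bigmax.
  by rewrite -[leRHS]mulr1 ler_wpM2l// ltW.
rewrite !sumr_const card_ord -mulrnA -[leLHS]mulr_natr /e' mulrAC ler_pdivrMr//.
by rewrite ler_wpM2l ?(ltW e0)// ler_nat.
Qed.

Definition OM : opAlg R := @OpAlg R H mrip mripDl mripC mripZl mrip_csq mrip_ge0 mrip_eq0
  'M[B]_m mact mact_lin mactD mactM mact1 mact_inj
  (fun a => ex_intro _ _ (mact_le a)) (fun z => (cscalar n z)%:M) mact_zop mact_complete.

Lemma nrm_mx_le (a : OM) : nrm a <= \sum_i \sum_j opnorm ((a : 'M[B]_m) i j).
Proof.
apply: nrm_le => [|f]; last exact: mact_le.
by apply: sumr_ge0 => i _; apply: sumr_ge0 => j _; exact: opnorm_ge0.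
Qed.

Lemma opnorm_entry_le (a : OM) i j : opnorm ((a : 'M[B]_m) i j) <= nrm a.
Proof.
apply: opnorm_le => xi x1; rewrite -mact_delta.
apply: le_trans (L2norm_le_mnorm _ _) _.
apply: le_trans (le_nrm a (mdelta j xi)) _.
rewrite -[leRHS]mulr1 ler_wpM2l ?nrm_ge0//.
by rewrite -[hn _]/(mnorm _) mnorm_delta.
Qed.

End Matrices.
End OperatorInstances.

(** * The abstract calculus and the notions of the statement *)

Section Links.
Variables (R : realType) (n : nat).
Local Notation L2 := (L2 R n).
Local Notation B := (bop R n).
Local Notation OB := (OB R n).
Local Notation OM := (OM R n).
Local Open Scope complex_scope.
Implicit Types (xi eta : L2) (S T : B).

Lemma ncvg_bop (u : nat -> B) l : @ncvg _ OB u l <-> u @ \oo --> l.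
Proof.
split.
- move=> h; apply/cvgrPdist_le => e e0; apply: filterS (ncvg_near h e0) => N.
  by rewrite nrm_opnorm distrC.
- move=> /cvgrPdist_le h; apply/cvgrPdist_le => e e0; apply: filterS (h e e0) => N.
  by rewrite sub0r normrN ger0_norm ?nrm_ge0// nrm_opnorm distrC.
Qed.

Lemma expopE (a : B) : expop a = expA (a : OB).
Proof.
apply: cvg_lim; first exact: norm_hausdorff.
by apply/ncvg_bop; exact: expA_cvg.
Qed.

Lemma ncvg_entry m (u : nat -> 'M[B]_m) (L : 'M[B]_m) i j :
  @ncvg _ (OM m) u L -> @ncvg _ OB (fun N => u N i j) (L i j).
Proof.
move=> h; apply: (@ncvg_le _ OB _ _ _ _ h) => N; rewrite nrm_opnorm.
have := @opnorm_entry_le R n m (u N - L : OM m) i j.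
by rewrite !mxE.
Qed.

Lemma sum_cvg0 (I : Type) (s : seq I) (v : I -> nat -> R) :
  (forall i, v i @ \oo --> (0 : R)) -> (fun N => \sum_(i <- s) v i N) @ \oo --> (0 : R).
Proof.
move=> h; elim: s => [|i s IH].
  by under eq_fun do rewrite big_nil; exact: cvg_cst.
under eq_fun do rewrite big_cons.
by have := cvgD (h i) IH; rewrite addr0; apply.
Qed.

Lemma entry_ncvg m (u : nat -> 'M[B]_m) (L : 'M[B]_m) :
  (forall i j, @ncvg _ OB (fun N => u N i j) (L i j)) -> @ncvg _ (OM m) u L.
Proof.
move=> h.
have e0 : (fun N => \sum_(i < m) \sum_(j < m) nrm (u N i j - L i j : OB)) @ \oo --> (0 : R).
  by do 2!apply: sum_cvg0 => ?; exact: h.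
apply: (ncvg_le _ e0) => N; apply: le_trans (nrm_mx_le _) _.
by apply: ler_sum => i _; apply: ler_sum => j _; rewrite nrm_opnorm !mxE.
Qed.

(** The limit in [is_mxlog] is for the entrywise topology of matrices, which [nrm_mx_le] and
    [opnorm_entry_le] compare with the operator norm. *)
Lemma ncvg_mx m (u : nat -> 'M[B]_m) (L : 'M[B]_m) :
  @ncvg _ (OM m) u L <-> u @ \oo --> L.
Proof.
split.
- move=> h A [P hP PA].
  have /filter_forall : forall ij : 'I_m * 'I_m, \forall N \near \oo, P ij.1 ij.2 (u N ij.1 ij.2).
    move=> [i j]; have /ncvg_bop c := ncvg_entry i j h.
    exact: c _ (hP i j).
  by apply: filterS => N hN; apply: PA => i j; exact: hN (i, j).
- move=> h; apply: entry_ncvg => i j; apply/ncvg_bop => A hA.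
  have : nbhs L [set M : 'M[B]_m | A (M i j)].
    exists (fun i' j' => if (i', j') == (i, j) then A else setT).
      move=> i' j'; case: ifP => [/eqP[-> ->]//|_]; exact: filterT.
    by move=> M /(_ i j); rewrite eqxx.
  by move/h.
Qed.

Lemma cauchy_sumE m (a : 'M[B]_m) c r N :
  cauchy_sum (@clog R) a c r N = cauchyA (a : OM m) c r N.
Proof.
by apply: eq_bigr => k _; apply/esym; exact: mul_scalar_mx.
Qed.

Lemma cauchy_sum_moment m (a : 'M[B]_m) c r : cauchy_sum (@clog R) a c r =
  (fun N => @moment _ (OM m) (a - zop (OM m) c%:C) r N (fun w => clog (c%:C + w) * w)).
Proof. by apply/funext => N; rewrite cauchy_sumE cauchyA_moment. Qed.

Lemma ge0_complex (z : R[i]) : (0 <= z) = (complex.Im z == 0) && (0 <= complex.Re z).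
Proof. by rewrite lecE. Qed.

Lemma op_positiveP T : op_positive T <-> pos (T : OB).
Proof.
split=> [h|[sT pT] xi].
  have h' xi : L2rip (T xi) ('i *: xi) = 0 /\ 0 <= L2rip (T xi) xi.
    by have := h xi; rewrite L2innerE ge0_complex/= => /andP[/eqP-> ->].
  by split=> [|xi]; [apply: sa_of_real_form => xi; exact: (h' xi).1|exact: (h' xi).2].
rewrite L2innerE ge0_complex/=; apply/andP; split; last exact: pT.
by apply/eqP; exact: (@sa_real_form _ OB).
Qed.

Lemma mx_positive_pos m (a : 'M[B]_m) : mx_positive a -> pos (a : OM m).
Proof.
move=> h.
have E (f g : {ffun 'I_m -> L2}) :
    mrip (mact a f) g = \sum_(i < m) \sum_(j < m) L2rip (a i j (f j)) (g i).
  apply: eq_bigr => i _; rewrite ffunE.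
  elim/big_rec2: _ => [|j y x _ <-]; last by rewrite L2ripDl.
  exact: (@rip0l _ OB).
have h' (f : {ffun 'I_m -> L2}) :
    mrip (mact a f) ('i *: f) = 0 /\ 0 <= mrip (mact a f) f.
  have := h f; rewrite ge0_complex Re_sum Im_sum.
  under eq_bigr do rewrite Im_sum.
  under [X in _ && (_ <= X)]eq_bigr do rewrite Re_sum.
  rewrite !E => /andP[/eqP h1 h2]; split.
    rewrite -[RHS]h1; apply: eq_bigr => i _; apply: eq_bigr => j _.
    by rewrite L2innerE ffunE.
  by move: h2; congr (_ <= _); apply: eq_bigr => i _; apply: eq_bigr => j _; rewrite L2innerE.
by split=> [|f]; [apply: sa_of_real_form => f; exact: (h' f).1|exact: (h' f).2].
Qed.

Lemma is_adjointP T S : is_adjoint T S <->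
  (forall xi eta, L2rip (T xi) eta = L2rip xi (S eta)).
Proof.
split=> h xi eta.
  by have := h xi eta; rewrite !L2innerE => -[].
by rewrite !L2innerE -bopZ !h.
Qed.

Lemma adjE T S : is_adjoint T S -> adj T = S.
Proof.
move=> h; rewrite /adj; case: xgetP => [S' _ h'|/(_ S)//].
apply: bop_ext => xi; apply/eqP; rewrite -subr_eq0; apply/eqP/L2rip_eq0.
have /is_adjointP a1 := h; have /is_adjointP a2 := h'.
have e eta : L2rip eta (S' xi) = L2rip eta (S xi) by rewrite -a1 -a2.
transitivity (L2rip (S' xi - S xi) (S' xi) + L2rip (S' xi - S xi) (- S xi)).
  exact: (@ripDr _ OB).
have N : L2rip (S' xi - S xi) (- S xi) = - L2rip (S' xi - S xi) (S xi).
  exact: (@ripNr _ OB).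
by rewrite N e subrr.
Qed.

Lemma sqrtopE (a b c : B) : pos (b : OB) -> is_inverse b c -> b * b = a -> sqrtop a = b.
Proof.
move=> pb bc ba; rewrite /sqrtop; case: xgetP => [b' _ [pb' ba']|/(_ b) []].
  apply: (@pos_sqrt_uniq _ OB _ _ _ pb bc); last by rewrite ba.
  exact/op_positiveP.
by split=> //; exact/op_positiveP.
Qed.

Lemma sqrtop_exp (x : B) : sa (x : OB) ->
  sqrtop (expA (x : OB)) = expA (zop OB (2^-1)%:C * x).
Proof.
move=> sx; apply: (@sqrtopE _ _ (expA (- (zop OB (2^-1)%:C * x)))).
- by apply: pos_exp; exact: saZ.
- exact: (@expA_inverse _ OB).
- exact: (@exp_half _ OB).
Qed.

(** [mxlog] is a choice, so its properties must follow from an arbitrary admissible circle: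
    [sa_spectrum_nrm] gives the norm bound under which the Riemann sums tend to the power series. *)
Lemma is_mxlog_spec m (a L : 'M[B]_m) : sa (a : OM m) -> is_mxlog a L ->
  exists2 c : R, nrm (a - zop (OM m) c%:C : OM m) < c &
     @ncvg _ (OM m) (log_part (a - zop (OM m) c%:C : OM m) c) L.
Proof.
move=> sA [c [r [/andP[r0 rc] hs hL]]].
have nr : nrm (a - zop (OM m) c%:C : OM m) < r.
  apply: sa_spectrum_nrm => // z hz; have := hs z hz.
  by rewrite normc_def ltcR; case: (z - _) => x y.
exists c; first exact: lt_trans rc.
have [L' hL'] := log_part_cvg (lt_trans nr rc).
suff -> : L = L' by [].
have /ncvg_mx c1 := hL; rewrite cauchy_sum_moment in c1.
exact: ncvg_uniq c1 (moment_clog_cvg nr rc hL').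
Qed.

Lemma is_mxlog_exists m (a b : 'M[B]_m) : pos (a : OM m) -> is_inverse a b ->
  exists L, is_mxlog a L.
Proof.
move=> pa ab; have [c [r [r0 rc nr]]] := pos_unit_shift (pa : @pos _ (OM m) a) ab.
have [L hL] := log_part_cvg (lt_trans nr rc).
exists L, c, r; split; first by rewrite r0.
- move=> z hz; rewrite normc_def ltcR.
  have -> : Num.sqrt (complex.Re (z - c%:C) ^+ 2 + complex.Im (z - c%:C) ^+ 2) = normc (z - c%:C).
    by case: (z - _).
  rewrite ltNge; apply/negP => h; apply: hz.
  have [S hS _] := neumann_zop (lt_le_trans nr h).
  by exists S; move: hS; rewrite zopB opprB addrA subrK.
- by apply/ncvg_mx; rewrite cauchy_sum_moment; exact: moment_clog_cvg nr rc hL.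
Qed.

Lemma mxlog_spec m (a b : 'M[B]_m) : pos (a : OM m) -> is_inverse a b ->
  exists2 c : R, nrm (a - zop (OM m) c%:C : OM m) < c &
     @ncvg _ (OM m) (log_part (a - zop (OM m) c%:C : OM m) c) (mxlog a).
Proof.
move=> pa ab; have [L hL] := is_mxlog_exists pa ab.
apply: is_mxlog_spec; first exact: pa.1.
by rewrite /mxlog; case: xgetP => [y -> //|/(_ L)].
Qed.

Lemma sa_mxlog m (a b : 'M[B]_m) : pos (a : OM m) -> is_inverse a b -> sa (mxlog a : OM m).
Proof.
move=> pa ab; have [c _ h] := mxlog_spec pa ab; apply: sa_ncvg h _ => N.
by apply: sa_log_part; apply: saB; [exact: pa.1|exact: sa_zop].
Qed.

Lemma exp_mxlog m (a b : 'M[B]_m) : pos (a : OM m) -> is_inverse a b ->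
  expA (mxlog a : OM m) = a.
Proof.
move=> pa ab; have [c nc h] := mxlog_spec pa ab.
rewrite (exp_log _ nc h); first by rewrite addrC subrK.
by apply: saB; [exact: pa.1|exact: sa_zop].
Qed.

Lemma mxlog_comm m (a b x : 'M[B]_m) : pos (a : OM m) -> is_inverse a b ->
  a * x = x * a -> mxlog a * x = x * mxlog a.
Proof.
move=> pa ab ax; have [c _ h] := mxlog_spec pa ab.
apply: (@comm_ncvg _ (OM m) _ _ _ h) => N; apply: log_part_comm.
by rewrite mulrBl mulrBr ax zopC.
Qed.

(** Injectivity of exp lets logarithms be identified without comparing two circles. *)
Lemma mxlog_uniq m (a b L : 'M[B]_m) : pos (a : OM m) -> is_inverse a b ->
  sa (L : OM m) -> expA (L : OM m) = a -> mxlog a = L.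
Proof.
move=> pa ab sL eL.
exact: (@exp_sa_inj _ (OM m) _ _ (sa_mxlog pa ab) sL (etrans (exp_mxlog pa ab) (esym eL))).
Qed.

Lemma sa_entry m (a : 'M[B]_m) i : sa (a : OM m) -> sa (a i i : OB).
Proof.
move=> h xi eta; have := h (mdelta i xi) (mdelta i eta).
have E (f : {ffun 'I_m -> L2}) x : mrip f (mdelta i x) = L2rip (f i) x.
  rewrite /mrip (bigD1 i)//= big1 ?addr0 ?ffunE ?eqxx// => k ki.
  by rewrite ffunE (negbTE ki) L2ripC; exact: (@rip0l _ OB).
rewrite -![rip _ _]/(mrip _ _) E mact_delta (mripC _ (mact a _)) E mact_delta.
by move=> e; transitivity (L2rip (a i i eta) xi); [exact: e|exact: L2ripC].
Qed.

Lemma sa_scalar_mx m T : sa (T : OB) -> sa (T%:M : OM m).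
Proof.
move=> h f g; apply: eq_bigr => i _.
by rewrite -[act _ f]/(mact _ f) -[act _ g]/(mact _ g) !mact_scalar; exact: h.
Qed.

Lemma scalar_mx_mul m S T : (S * T)%:M = S%:M * T%:M :> 'M[B]_m.
Proof. exact: scalar_mxM. Qed.

Lemma scalar_mx_exp m T k : T%:M ^+ k = (T ^+ k)%:M :> 'M[B]_m.
Proof. by elim: k => [|k IH]; rewrite ?expr0// !exprS scalar_mx_mul IH. Qed.

Lemma exp_scalar_mx m T : expA (T%:M : OM m) = (expA (T : OB))%:M.
Proof.
apply: expAE.
have -> : exp_part (T%:M : OM m) = fun N => (exp_part (T : OB) N)%:M.
  apply/funext => N; rewrite /exp_part raddf_sum; apply: eq_bigr => k _.
  have -> : (T%:M : OM m) ^+ k = (T ^+ k)%:M by exact: scalar_mx_exp.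
  by apply/esym; exact: scalar_mx_mul.
apply: entry_ncvg => i j.
have E (X : B) : (X%:M : 'M[B]_m) i j = X *+ (i == j) by rewrite mxE.
rewrite E; under eq_fun do rewrite E.
by case: (i == j); [exact: (expA_cvg (T : OB))|exact: (ncvg_cst (0 : OB))].
Qed.

End Links.

(** * Derivations of the torus as derivatives along translation flows *)

Section TorusDerivations.
Variables (R : realType) (n : nat).
Local Notation B := (bop R n).
Local Notation OB := (OB R n).
Local Notation OM := (OM R n).
Local Open Scope complex_scope.
Implicit Types (T S x d u : B) (i j : 'I_n).

Lemma translation0 : translation 0 = 1 :> B.
Proof.
apply: bop_ext; elim/L2ind => v; rewrite translationE bop1E; congr class.
by apply/val_inj/funext => y; rewrite -[LHS]/(1 * v _) mul1r tshift0.
Qed.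

Lemma translationD (s t : 'rV[R]_n) : translation (s + t) = translation s * translation t :> B.
Proof.
apply: bop_ext; elim/L2ind => v; rewrite bopME !translationE; congr class.
apply/val_inj/funext => y; rewrite -[LHS]/(1 * v _) -[RHS]/(1 * (1 * v _)).
by rewrite !mul1r tshiftD addrC.
Qed.

Lemma L2norm_translation (s : 'rV[R]_n) xi : L2norm (translation s xi) = L2norm xi.
Proof. by elim/L2ind: xi => v; rewrite translationE !L2norm_class l2norm_wtrans. Qed.

Definition flow j (h : R) : B := translation (h *: delta_mx 0 j).

Lemma flow0 j : flow j 0 = 1.
Proof. by rewrite /flow scale0r translation0. Qed.

Lemma flowD j s t : flow j (s + t) = flow j s * flow j t.
Proof. by rewrite /flow scalerDl translationD. Qed.

Lemma nrm_flow_le j t : nrm (flow j t : OB) <= 1.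
Proof.
apply: nrm_le => // xi; rewrite mul1r !hn_L2norm.
by rewrite -[act _ _]/(flow j t xi) L2norm_translation.
Qed.

Lemma torus_action0 x : torus_action 0 x = x.
Proof. by rewrite /torus_action oppr0 translation0 mul1r mulr1. Qed.

Lemma torus_actionD s t x : torus_action (s + t) x = torus_action s (torus_action t x).
Proof. by rewrite /torus_action opprD (addrC (- s)) !translationD !mulrA. Qed.

Lemma conj_flowE j h x : conj_flow (flow j : R -> OB) h x = torus_action (h *: delta_mx 0 j) x.
Proof. by rewrite /conj_flow /torus_action /flow scaleNr. Qed.

Lemma diff_quotE j h x : diff_quot (flow j : R -> OB) h x =
  h^-1 *: (torus_action (h *: delta_mx 0 j) x - x).
Proof. by rewrite /diff_quot conj_flowE. Qed.

Lemma dnbhs0P (P : R -> Prop) :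
  (\forall h \near 0^', P h) <-> exists2 r, 0 < r & forall h, 0 < `|h| < r -> P h.
Proof.
split.
- move=> /nbhs_ballP[r /= r0 hr]; exists r => // h /andP[h0 hr'].
  apply: hr; last by rewrite -normr_gt0.
  by rewrite /ball/= sub0r normrN.
- move=> [r r0 hr]; apply/nbhs_ballP; exists r => // h; rewrite /ball/= sub0r normrN => hr' h0.
  by apply: hr; rewrite normr_gt0 h0.
Qed.

Lemma isder_cvg j x d : isder (flow j : R -> OB) x d <->
  (fun h : R => h^-1 *: (torus_action (h *: delta_mx 0 j) x - x)) @ 0^' --> d.
Proof.
split=> [h|/cvgrPdist_le h].
- apply/cvgrPdist_le => e e0; apply/dnbhs0P; have [r r0 hr] := h e e0.
  by exists r => // t /hr; rewrite diff_quotE nrm_opnorm distrC.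
- move=> e e0; have /dnbhs0P[r r0 hr] := h e e0.
  by exists r => // t /hr; rewrite diff_quotE nrm_opnorm distrC.
Qed.

Lemma dpartial_quotE j x : (fun h : R => h^-1 *: (((fun s => torus_action s x) \o shift (0 : 'rV[R]_n))
    (h *: delta_mx 0 j) - torus_action 0 x)) =
  (fun h : R => h^-1 *: (torus_action (h *: delta_mx 0 j) x - x)).
Proof. by apply/funext => h; rewrite /= addr0 torus_action0. Qed.

Lemma derivE j x d : isder (flow j : R -> OB) x d -> deriv j x = d.
Proof.
move=> /isder_cvg h; apply: cvg_lim; first exact: norm_hausdorff.
by rewrite dpartial_quotE.
Qed.

Lemma derivable_isder j x : derivable (fun s => torus_action s x) 0 (delta_mx 0 j) ->
  isder (flow j : R -> OB) x (deriv j x).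
Proof.
move=> h; have := h; rewrite /derivable dpartial_quotE => /cvg_ex[d hd].
by have /isder_cvg hd' := hd; rewrite (derivE hd').
Qed.

Lemma hasder_isder j x : hasder (flow j : R -> OB) x -> isder (flow j : R -> OB) x (deriv j x).
Proof. by move=> [d hd]; rewrite (derivE hd). Qed.

Lemma smooth_isder theta u j : smooth_nct theta u -> isder (flow j : R -> OB) u (deriv j u).
Proof. by move=> [_ /(_ [::]) [_ h]]; apply: derivable_isder; exact: h. Qed.

Lemma cvg_mul_bop (F : set_system R) (FF : Filter F) (f : R -> B) (a b l : B) :
  f @ F --> l -> (fun h => a * f h * b) @ F --> a * l * b.
Proof.
move=> /cvgrPdist_le h; apply/cvgrPdist_le => e e0.
pose K := opnorm a * opnorm b + 1.
have K0 : 0 < K by rewrite ltr_wpDl ?mulr_ge0 ?opnorm_ge0.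
apply: filterS (h _ (divr_gt0 e0 K0)) => t ht.
rewrite -mulrBl -mulrBr -[`|_|]/(opnorm _) -nrm_opnorm.
apply: le_trans (@nrmM _ OB _ _) _.
apply: le_trans (ler_wpM2r (nrm_ge0 _) (@nrmM _ OB _ _)) _.
rewrite !nrm_opnorm mulrAC; apply: le_trans (_ : K * (e / K) <= _).
  by apply: ler_pM; rewrite ?mulr_ge0 ?opnorm_ge0// lerDl.
by rewrite mulrC divfK// gt_eqF.
Qed.

(** The Laplacian needs a second derivative. As the action at s + h is the action at s after that at
    h, the partial derivative of the orbit of u is the orbit of [deriv j u], which smoothness makes
    differentiable again. *)
Lemma smooth_deriv_isder theta u i j : smooth_nct theta u ->
  isder (flow i : R -> OB) (deriv j u) (deriv i (deriv j u)).
Proof.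
move=> su; have /isder_cvg h := smooth_isder j su; case: su => _ /(_ [:: j]) [_ /(_ i 0)] /=.
suff -> : dpartial j (fun s => torus_action s u) = fun s => torus_action s (deriv j u).
  exact: derivable_isder.
apply/funext => s; apply: cvg_lim; first exact: norm_hausdorff.
have -> : (fun h : R => h^-1 *: (((fun s => torus_action s u) \o shift s) (h *: delta_mx 0 j)
     - torus_action s u)) =
   (fun h : R => translation s * (h^-1 *: (torus_action (h *: delta_mx 0 j) u - u)) * translation (- s)).
  apply/funext => h' /=; rewrite (addrC (_ *: _) s) torus_actionD.
  have Z c (X : B) : c *: X = cscalar n c%:C * X by [].
  have C (z : R[i]) (X : B) : X * cscalar n z = cscalar n z * X.
    by apply/esym; exact: (@zopC _ OB).
  have E (X Y : B) : torus_action s X - torus_action s Y =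
      translation s * (X - Y) * translation (- s).
    by rewrite /torus_action mulrBr mulrBl.
  by rewrite E !Z; move: (_ - u) => Y; rewrite !mulrA C.
exact: cvg_mul_bop.
Qed.

Lemma deriv1 j : deriv j (1 : B) = 0.
Proof.
have h := @isder_zop _ OB _ (flow0 j) (flowD j) 1.
by rewrite (@zop1 _ OB) in h; exact: derivE.
Qed.

Section MatrixFlow.
Variable m : nat.

(** Conjugation by these scalar matrices acts entrywise, so [hasder_log] applies to [mxlog] within
    the algebra of matrices. *)
Definition mflow j (h : R) : 'M[B]_m := (flow j h)%:M.

Lemma mflow0 j : mflow j 0 = 1.
Proof. by rewrite /mflow flow0. Qed.

Lemma mflowD j s t : mflow j (s + t) = mflow j s * mflow j t.
Proof. by rewrite /mflow flowD scalar_mx_mul. Qed.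

Lemma nrm_mflow_le j t : nrm (mflow j t : OM m) <= 1.
Proof.
apply: nrm_le => // f; rewrite mul1r le_eqVlt; apply/orP; left; apply/eqP.
congr Num.sqrt; rewrite -[LHS]/(mrip _ _) -[RHS]/(mrip _ _) !mrip_norm.
by apply: eq_bigr => k _; rewrite mact_scalar L2norm_translation.
Qed.

Lemma diff_quot_entry j h (a : 'M[B]_m) k l :
  (diff_quot (mflow j : R -> OM m) h a : 'M[B]_m) k l = diff_quot (flow j : R -> OB) h (a k l).
Proof.
have E (S T : B) (b : 'M[B]_m) : (S%:M * b * T%:M) k l = S * b k l * T.
  rewrite mxE (bigD1 l)//= big1 ?addr0 => [|q ql].
    rewrite (_ : (S%:M * b) k l = S * b k l); last first.
      by rewrite -[_ * b]/(S%:M *m b) mul_scalar_mx mxE.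
    by rewrite mxE eqxx mulr1n.
  by rewrite [T%:M _ _]mxE (negbTE ql) mulr0n mulr0.
have E' (S : B) (b : 'M[B]_m) : (S%:M * b) k l = S * b k l.
  by rewrite -[_ * b]/(S%:M *m b) mul_scalar_mx mxE.
rewrite /diff_quot -[zop (OM m) _]/((cscalar n _)%:M) E' /conj_flow.
by rewrite -[mflow j h * a * mflow j (- h) - a]/(_ + - _) mxE E mxE.
Qed.

Lemma isder_entry j (a d : 'M[B]_m) k l : isder (mflow j : R -> OM m) a d ->
  isder (flow j : R -> OB) (a k l) (d k l).
Proof.
move=> h e /h[r r0 hr]; exists r => // t /hr; apply: le_trans.
rewrite nrm_opnorm -diff_quot_entry.
have := @opnorm_entry_le R n m (diff_quot (mflow j : R -> OM m) t a - d : OM m) k l.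
by rewrite !mxE.
Qed.

Lemma entry_isder j (a d : 'M[B]_m) :
  (forall k l, isder (flow j : R -> OB) (a k l) (d k l)) -> isder (mflow j : R -> OM m) a d.
Proof.
move=> h e e0.
have N0 : 0 < (m * m).+1%:R :> R by rewrite ltr0n.
pose e' := e / (m * m).+1%:R; have e'0 : 0 < e' by rewrite divr_gt0.
have /choice[r hr] : forall kl : 'I_m * 'I_m, exists r : R, 0 < r /\
    forall t, 0 < `|t| < r -> nrm (diff_quot (flow j : R -> OB) t (a kl.1 kl.2) - d kl.1 kl.2) <= e'.
  by move=> [k l]; have [r r0 hr] := h k l e' e'0; exists r.
(* a common positive lower bound for the finitely many radii *)
pose q := 1 + \sum_kl (r kl)^-1.
have q0 : 0 < q.
  by rewrite ltr_wpDr// sumr_ge0// => kl _; rewrite invr_ge0 ltW//; case: (hr kl).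
exists q^-1; first by rewrite invr_gt0.
move=> t /andP[t0 tq]; apply: le_trans (nrm_mx_le _) _.
apply: (@le_trans _ _ (\sum_(k < m) \sum_(l < m) e')).
  apply: ler_sum => k _; apply: ler_sum => l _; have [r0 hkl] := hr (k, l).
  rewrite -nrm_opnorm mxE diff_quot_entry mxE; apply: hkl; rewrite t0/=.
  apply: lt_le_trans tq _; rewrite -[leRHS]invrK lef_pV2 ?posrE ?invr_gt0//.
  rewrite /q (bigD1 (k, l))//= addrCA lerDl addr_ge0// sumr_ge0// => kl _.
  by rewrite invr_ge0 ltW//; case: (hr kl).
rewrite !sumr_const card_ord -mulrnA -[leLHS]mulr_natr /e' mulrAC ler_pdivrMr//.
by rewrite ler_wpM2l ?(ltW e0)// ler_nat.
Qed.

End MatrixFlow.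
End TorusDerivations.

(** * Conformal change of the metric *)

Section ScalarMatrices.
Variables (R : realType) (n m : nat).
Local Notation B := (bop R n).
Implicit Types (T S : B) (a b : 'M[B]_m).

Lemma scalar_mxMl T a i j : (T%:M * a) i j = T * a i j.
Proof. by rewrite -[_ * a]/(T%:M *m a) mul_scalar_mx mxE. Qed.

Lemma scalar_mxMr T a i j : (a * T%:M) i j = a i j * T.
Proof.
rewrite mxE (bigD1 j)//= mxE eqxx mulr1n big1 ?addr0// => k kj.
by rewrite mxE (negbTE kj) mulr0n mulr0.
Qed.

Lemma scalar_mx_comm T a :
  (forall i j, T * a i j = a i j * T) <-> T%:M * a = a * T%:M.
Proof.
split=> h; first by apply/matrixP => i j; rewrite scalar_mxMl scalar_mxMr.
by move=> i j; rewrite -scalar_mxMl h scalar_mxMr.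
Qed.

Lemma is_inverse_scalar_mx T S : is_inverse T S ->
  is_inverse (T%:M : 'M[B]_m) (S%:M : 'M[B]_m).
Proof. by move=> [h h']; split; rewrite -scalar_mx_mul ?h ?h'. Qed.

End ScalarMatrices.

Section CommInverse.
Variable A : pzRingType.
Implicit Types x y z : A.

Lemma comm_is_inverse x y z : is_inverse x y -> x * z = z * x -> y * z = z * y.
Proof.
move=> [xy yx] xz; rewrite -[LHS]mulr1 -xy -mulrA [z * _]mulrA -xz.
by rewrite !mulrA yx mul1r.
Qed.

Lemma is_inverse_prod x x' y y' : is_inverse x x' -> is_inverse y y' ->
  is_inverse (x * y) (y' * x').
Proof.
move=> [a1 a2] [b1 b2]; split.
  by rewrite mulrA -(mulrA x) b1 mulr1.
by rewrite mulrA -(mulrA y') a2 mulr1.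
Qed.

Lemma is_inverse_exp x y k : is_inverse x y -> is_inverse (x ^+ k) (y ^+ k).
Proof.
move=> xy; elim: k => [|k IH]; first by rewrite !expr0; split; rewrite mulr1.
by rewrite exprS exprSr; exact: is_inverse_prod.
Qed.

End CommInverse.

(** * The Riemannian density as an exponential *)

Section Density.
Variables (R : realType) (n : nat).
Local Notation B := (bop R n).
Local Notation OB := (OB R n).
Local Notation OM := (OM R n).
Local Open Scope complex_scope.
Implicit Types x : B.

Definition halfB x : B := cscalar n (2^-1)%:C * x.

Lemma halfBD x y : halfB (x + y) = halfB x + halfB y.
Proof. exact: mulrDr. Qed.

Lemma halfB_double x : halfB (x + x) = x.
Proof. by rewrite halfBD; exact: (@zop_half_double _ OB). Qed.

Lemma sa_halfB x : sa (x : OB) -> sa (halfB x : OB).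
Proof. exact: (@saZ _ OB). Qed.

Lemma halfB_comm x y : x * y = y * x -> halfB x * y = y * halfB x.
Proof.
move=> xy; rewrite /halfB -mulrA xy !mulrA; congr (_ * _).
exact: (@zopC _ OB).
Qed.

Variables (g h : 'M[B]_n).
Hypothesis pg : pos (g : OM n).
Hypothesis gh : is_inverse g h.

Definition log_trace : B := \tr (mxlog g).

Lemma sa_log_trace : sa (log_trace : OB).
Proof. by apply: (@sa_sum _ OB) => i; apply: sa_entry; exact: sa_mxlog pg gh. Qed.

(** The scalar matrix of x commutes with [g], hence with its logarithm, hence x commutes with every
    entry of the latter. *)
Lemma log_trace_comm x : (forall i j, x * g i j = g i j * x) ->
  log_trace * x = x * log_trace.
Proof.
move=> /scalar_mx_comm xg.
have /scalar_mx_comm xL : x%:M * mxlog g = mxlog g * x%:M.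
  by apply/esym; apply: mxlog_comm pg gh _.
by rewrite /log_trace mulr_suml mulr_sumr; apply: eq_bigr => i _.
Qed.

Lemma nuE : nu g = expA (halfB log_trace : OB).
Proof. by rewrite /nu /det_metric expopE; exact: sqrtop_exp sa_log_trace. Qed.

Lemma sqrt_nuE : sqrtop (nu g) = expA (halfB (halfB log_trace) : OB).
Proof. by rewrite nuE; apply: sqrtop_exp; apply: sa_halfB; exact: sa_log_trace. Qed.

Lemma hasder_log_trace j : (forall k l, hasder (flow j : R -> OB) (g k l)) ->
  hasder (flow j : R -> OB) log_trace.
Proof.
move=> hg.
have hgM : hasder (mflow n j : R -> OM n) g.
  exists (\matrix_(p, q) deriv j (g p q)); apply: entry_isder => k l.
  by rewrite mxE; exact: hasder_isder.
have [c nc hc] := mxlog_spec pg gh.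
have [D hD] : hasder (mflow n j : R -> OM n) (mxlog g).
  have hz : hasder (mflow n j : R -> OM n) (zop (OM n) (- c%:C)).
    by apply: (@hasder_zop _ (OM n)); [exact: mflow0|exact: mflowD].
  rewrite zopN in hz; have hT := @hasderD _ (OM n) _ _ _ hgM hz.
  refine (@hasder_log _ (OM n) (mflow n j) _ _ _ _ c _ hT nc hc).
  - exact: mflow0.
  - exact: mflowD.
  - exact: nrm_mflow_le.
apply: (@hasder_sum _ OB (flow j)) => [||i]; [exact: flow0|exact: flowD|].
by exists (D i i); exact: isder_entry.
Qed.

End Density.

(** * Logarithm and density of the conformal metric *)

Section Conformal.
Variables (R : realType) (n : nat).
Local Notation B := (bop R n).
Local Notation OB := (OB R n).
Local Notation OM := (OM R n).
Local Open Scope complex_scope.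
Variables (g h : 'M[B]_n) (k k' : B).
Hypothesis pg : pos (g : OM n).
Hypothesis gh : is_inverse g h.
Hypothesis pk : pos (k : OB).
Hypothesis kk' : is_inverse k k'.
Hypothesis kg : forall i j, k * g i j = g i j * k.

Lemma conformalE : conformal k g = (k * k)%:M * g.
Proof. by apply/matrixP => i j; rewrite mxE scalar_mxMl -!mulrA kg. Qed.

Lemma conformal_inverse : is_inverse (conformal k g) (h * (k' * k')%:M).
Proof.
rewrite conformalE; apply: is_inverse_prod gh.
by apply: is_inverse_scalar_mx; exact: is_inverse_prod.
Qed.

(** The candidate 2 l + log g is selfadjoint and exponentiates to k g k. This shows at once that k g
    k is positive and, by uniqueness, what its logarithm is. *)
Lemma conformal_mxlog (l : B) : sa (l : OB) -> expA (l : OB) = k ->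
  (forall x, k * x = x * k -> l * x = x * l) ->
  pos (conformal k g : OM n) /\ mxlog (conformal k g) = (l + l)%:M + mxlog g.
Proof.
move=> sl el cl; set L := (l + l)%:M + mxlog g.
have lg i j : (l + l) * g i j = g i j * (l + l).
  by rewrite mulrDl mulrDr (cl _ (kg i j)).
have sL : sa (L : OM n).
  by apply: (@saD _ (OM n)); [apply: sa_scalar_mx; exact: (@saD _ OB)|exact: sa_mxlog pg gh].
have eL : expA (L : OM n) = conformal k g.
  rewrite /L (@expAD _ (OM n)).
    rewrite exp_scalar_mx (@expAD _ OB)// el (exp_mxlog pg gh) conformalE.
    by [].
  by apply/esym; apply: mxlog_comm pg gh _; apply/esym/scalar_mx_comm.
have pc : pos (conformal k g : OM n) by rewrite -eL; exact: (@pos_exp _ (OM n)).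
by split=> //; exact: mxlog_uniq pc conformal_inverse sL eL.
Qed.

(** The codifferential involves the square root of nu, so k^(n/2) is needed; n may be odd, and z is
    taken as exp((n/2) log k). *)
Lemma conformal_density : exists z : B,
  [/\ z * z = k ^+ n, forall x, k * x = x * k -> z * x = x * z,
      nu (conformal k g) = k ^+ n * nu g
    & sqrtop (nu (conformal k g)) = z * sqrtop (nu g)].
Proof.
have [l [sl el cl]] := exists_log (pk : @pos _ OB k) kk'.
have [pc ml] := conformal_mxlog sl el cl.
have tl : log_trace g * l = l * log_trace g.
  by apply: log_trace_comm pg gh _ _ => i j; exact: cl.
have tE : halfB (log_trace (conformal k g)) = l *+ n + halfB (log_trace g).
  by rewrite /log_trace ml mxtraceD mxtrace_scalar mulrnDl halfBD halfB_double.
have ek : expA (l *+ n : OB) = k ^+ n by rewrite (@expAMn _ OB) el.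
pose z : B := expA (halfB (l *+ n) : OB).
have c1 : (l *+ n) * halfB (log_trace g) = halfB (log_trace g) * (l *+ n).
  by apply/esym/halfB_comm; rewrite mulrnAl mulrnAr tl.
have c2 : halfB (l *+ n) * halfB (halfB (log_trace g)) =
    halfB (halfB (log_trace g)) * halfB (l *+ n).
  by apply: halfB_comm; apply/esym; apply: halfB_comm.
exists z; split.
- by rewrite -ek; exact: (@exp_half _ OB).
- move=> x kx; apply: (@expA_comm _ OB); apply: halfB_comm.
  by rewrite mulrnAl (cl _ kx) mulrnAr.
- rewrite (nuE pc conformal_inverse) tE (nuE pg gh) -ek.
  exact: (@expAD _ OB _ _ c1).
- have e := sqrt_nuE pc conformal_inverse; rewrite tE halfBD in e.
  have e' := sqrt_nuE pg gh.
  exact: (etrans e (etrans (@expAD _ OB _ _ c2) (congr1 (fun y : B => z * y) (esym e')))).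
Qed.

End Conformal.

(** * The Laplacian of the conformal metric *)

Section Assembly.
Variables (R : realType) (n : nat).
Local Notation B := (bop R n).
Local Notation OB := (OB R n).
Local Notation OM := (OM R n).
Local Open Scope complex_scope.

Lemma derivM j (x y : B) : hasder (flow j : R -> OB) x -> hasder (flow j : R -> OB) y ->
  deriv j (x * y) = deriv j x * y + x * deriv j y.
Proof.
move=> /hasder_isder hx /hasder_isder hy; apply: derivE.
by apply: (@isderM _ OB (flow j)) hx hy; [exact: flow0|exact: flowD|exact: nrm_flow_le].
Qed.

Lemma hasder_mul j (x y : B) : hasder (flow j : R -> OB) x -> hasder (flow j : R -> OB) y ->
  hasder (flow j : R -> OB) (x * y).
Proof.
by apply: (@hasderM _ OB (flow j)); [exact: flow0|exact: flowD|exact: nrm_flow_le].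
Qed.

Lemma hasder_expn j (x : B) m : hasder (flow j : R -> OB) x ->
  hasder (flow j : R -> OB) (x ^+ m).
Proof.
move=> hx; elim: m => [|m IH]; last by rewrite exprS; exact: hasder_mul.
rewrite expr0 -[1](@zop1 _ OB).
by apply: (@hasder_zop _ OB (flow j)); [exact: flow0|exact: flowD].
Qed.

Lemma hasder_halfB j (x : B) : hasder (flow j : R -> OB) x ->
  hasder (flow j : R -> OB) (halfB x).
Proof.
apply: hasder_mul.
by apply: (@hasder_zop _ OB (flow j)); [exact: flow0|exact: flowD].
Qed.

Lemma sa_deriv j (x : B) : sa (x : OB) -> hasder (flow j : R -> OB) x ->
  sa (deriv j x : OB).
Proof.
move=> sx /hasder_isder hx; apply: (@isder_sa _ OB (flow j)) sx hx;
  [exact: flow0|exact: flowD|exact: nrm_flow_le].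
Qed.

Lemma adj_sa_mul (x y : B) : sa (x : OB) -> sa (y : OB) -> adj (x * y) = y * x.
Proof.
move=> sx sy; apply/adjE/is_adjointP => xi eta.
rewrite !bopME; transitivity (L2rip (y xi) (x eta)); [exact: sx|exact: sy].
Qed.

Lemma smooth_hasder theta j (u : B) : smooth_nct theta u -> hasder (flow j : R -> OB) u.
Proof. by move=> hu; exists (deriv j u); exact: smooth_isder hu. Qed.

Variables (theta : 'M[R]_n) (g : 'M[B]_n) (k : B).
Hypothesis hg : riemannian_metric theta g.
Hypothesis hk : positive_invertible theta k.
Hypothesis hkg : forall i j, k * g i j = g i j * k.

Local Notation w := (sqrtop (nu g)).

Let pg : pos (g : OM n).
Proof. by case: hg => _ /mx_positive_pos. Qed.

Let pk : pos (k : OB).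
Proof. by case: hk => _ /op_positiveP. Qed.

Let ginv : is_inverse g (inverse g).
Proof. by case: hg => _ _ [h gh _]; rewrite (inverseE gh). Qed.

Let kinv : is_inverse k (inverse k).
Proof. by case: hk => _ _ [b _ kb]; rewrite (inverseE kb). Qed.

Let nuinv : is_inverse (nu g) (inverse (nu g)).
Proof.
have h : is_inverse (nu g) (expA (- halfB (log_trace g) : OB)).
  by rewrite (nuE pg ginv); exact: (@expA_inverse _ OB).
by rewrite (inverseE h).
Qed.

Let sa_w : sa (w : OB).
Proof.
rewrite (sqrt_nuE pg ginv); apply: (@sa_exp _ OB); do 2!apply: sa_halfB.
exact: sa_log_trace pg ginv.
Qed.

Let comm_w : k * w = w * k.
Proof.
rewrite (sqrt_nuE pg ginv); apply/esym; apply: (@expA_comm _ OB).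
by do 2!apply: halfB_comm; exact: log_trace_comm pg ginv _ hkg.
Qed.

Let comm_nu : k * nu g = nu g * k.
Proof.
rewrite (nuE pg ginv); apply/esym; apply: (@expA_comm _ OB).
by apply: halfB_comm; exact: log_trace_comm pg ginv _ hkg.
Qed.

Let comm_h i j : k * inverse g i j = inverse g i j * k.
Proof.
have /scalar_mx_comm kg := hkg.
have /esym h := comm_is_inverse ginv (esym kg).
by move: i j; apply/scalar_mx_comm.
Qed.

Let comm_inv x : k * x = x * k -> inverse k * x = x * inverse k.
Proof. exact: comm_is_inverse kinv. Qed.

Let hasder_k j : hasder (flow j : R -> OB) k.
Proof. by case: hk => sk _ _; exact: smooth_hasder sk. Qed.

Let hasder_w j : hasder (flow j : R -> OB) w.
Proof.
rewrite (sqrt_nuE pg ginv).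
apply: (@hasder_exp _ OB (flow j)); [exact: flow0|exact: flowD|exact: nrm_flow_le|].
do 2!apply: hasder_halfB.
apply: hasder_log_trace pg ginv _ _ => p q; case: hg => h _ _.
exact: smooth_hasder (h p q).1.
Qed.

Let hasder_h j p q : hasder (flow j : R -> OB) (inverse g p q).
Proof.
by case: hg => _ _ [h gh hh]; rewrite (inverseE gh); exact: smooth_hasder (hh p q).1.
Qed.

Lemma sa_k m : sa (k ^+ m : OB).
Proof. by apply: (@saX _ OB); exact: pk.1. Qed.

(** Both the square root of nu and the derivative of k^(n - 2) are selfadjoint, so taking the
    adjoint of their product reverses it: the second root lands next to the inverse metric, as in
    the codifferential. *)
Lemma pairing_conformal (u : B) :
  pairing (inverse g) (form_scale w (differential u)) (form_scale w (differential (k ^+ (n - 2))))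
  = \sum_(i < n) \sum_(j < n)
      deriv i (k ^+ (n - 2)) * (w * inverse g i j * w * deriv j u).
Proof.
apply: eq_bigr => i _; apply: eq_bigr => j _; rewrite !mxE adj_sa_mul//.
  by rewrite !mulrA.
by apply: sa_deriv (sa_k _) _; exact: hasder_expn.
Qed.

Lemma nu_conformal_inverse :
  nu (conformal k g) = k ^+ n * nu g ->
  inverse (nu (conformal k g)) = inverse (nu g) * inverse k ^+ n.
Proof.
move=> ->; apply: inverseE; apply: is_inverse_prod nuinv.
exact: is_inverse_exp.
Qed.

Lemma laplace_beltrami_conformal (u : B) : (2 <= n)%N -> smooth_nct theta u ->
  laplace_beltrami (conformal k g) u =
  inverse k ^+ 2 * laplace_beltrami g u
  - inverse (nu g) * inverse k ^+ n *
    pairing (inverse g) (form_scale w (differential u))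
      (form_scale w (differential (k ^+ (n - 2)))).
Proof.
move=> n2 su.
have [z [zz zc nuk sk]] := conformal_density pg ginv pk kinv hkg.
have ic := inverseE (conformal_inverse ginv kinv hkg).
(* k^-2 is kept as an opaque [q], so that reassociating products does not split it. *)
have [q qE] : exists q, q = inverse k * inverse k by exists (inverse k * inverse k).
have kq (x : B) : k * x = x * k -> q * x = x * q.
  by move=> /comm_inv h; rewrite qE -mulrA h !mulrA h.
pose X i j := w * inverse g i j * w * deriv j u.
have xnE (x : B) : x ^+ n = x ^+ (n - 2) * x ^+ 2 by rewrite -exprD subnK.
have xnE' (x : B) : x ^+ n = x ^+ 2 * x ^+ (n - 2) by rewrite -exprD subnKC.
have kn : k ^+ n * q = k ^+ (n - 2).
  rewrite xnE expr2 -!mulrA qE [k * (inverse k * _)]mulrA.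
  by rewrite kinv.1 mul1r kinv.1 mulr1.
(* The two factors k^(n/2) and the factor k^-2 all move to the left, where they combine into k^(n -
   2). *)
have summand i j : sqrtop (nu (conformal k g)) * inverse (conformal k g) i j *
    sqrtop (nu (conformal k g)) * differential u 0 j = k ^+ (n - 2) * X i j.
  rewrite ic scalar_mxMr sk mxE -qE /X.
  have e1 : w * (inverse g i j * q) = q * (w * inverse g i j).
    by rewrite -(kq _ (comm_h i j)) !mulrA (kq _ comm_w).
  have zwh : z * (w * inverse g i j) = w * inverse g i j * z.
    by rewrite mulrA (zc _ comm_w) -mulrA (zc _ (comm_h i j)) mulrA.
  have -> : z * w * (inverse g i j * q) * (z * w) = z * q * z * (w * inverse g i j * w).
    by rewrite -[z * w * _]mulrA e1 -!mulrA; congr (_ * (_ * _)); rewrite !mulrA -zwh !mulrA.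
  rewrite -[z * q * z]mulrA kq; last by apply/esym; apply: zc.
  by rewrite [z * (z * q)]mulrA zz kn /X -!mulrA.
have hX i j : hasder (flow i : R -> OB) (X i j).
  apply: hasder_mul; last by exists (deriv i (deriv j u)); exact: smooth_deriv_isder su.
  by apply: hasder_mul; [apply: hasder_mul|].
have leibniz i j : deriv i (k ^+ (n - 2) * X i j) =
    deriv i (k ^+ (n - 2)) * X i j + k ^+ (n - 2) * deriv i (X i j).
  by apply: derivM => //; exact: hasder_expn.
pose P := \sum_(i < n) \sum_(j < n) deriv i (k ^+ (n - 2)) * X i j.
pose D := \sum_(i < n) \sum_(j < n) deriv i (X i j).
have sumE : \sum_(i < n) \sum_(j < n) deriv i (k ^+ (n - 2) * X i j) =
    P + k ^+ (n - 2) * D.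
  rewrite mulr_sumr -big_split; apply: eq_bigr => i _.
  by rewrite mulr_sumr -big_split; apply: eq_bigr => j _; exact: leibniz.
(* Here k^-n k^(n - 2) = k^-2, which commutes with the inverse density. *)
have kD : inverse (nu g) * inverse k ^+ n * (k ^+ (n - 2) * D) =
    inverse k ^+ 2 * (inverse (nu g) * D).
  have nk : inverse (nu g) * inverse k = inverse k * inverse (nu g).
    by rewrite comm_inv//; apply/esym; apply: comm_is_inverse nuinv _.
  rewrite xnE' expr2 -!mulrA [_ ^+ (n - 2) * (_ * D)]mulrA.
  rewrite (is_inverse_exp (n - 2) kinv).2 mul1r.
  by rewrite mulrA nk -!mulrA; congr (_ * _); rewrite mulrA nk -mulrA.
have gE : laplace_beltrami g u = - (inverse (nu g) * D).
  rewrite /laplace_beltrami /codifferential; congr (- (_ * _)).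
  by apply: eq_bigr => i _; apply: eq_bigr => j _; rewrite mxE.
have cE : laplace_beltrami (conformal k g) u =
    - (inverse (nu g) * inverse k ^+ n * (P + k ^+ (n - 2) * D)).
  apply: (congr1 (fun y : B => - y)).
  apply: (congr2 (fun y y' : B => y * y') (nu_conformal_inverse nuk)).
  rewrite -sumE; apply: eq_bigr => i _; apply: eq_bigr => j _.
  exact: (congr1 (deriv i) (summand i j)).
by rewrite cE gE pairing_conformal -/P mulrDr kD opprD mulrN addrC.
Qed.

Lemma laplace_beltrami_conformal2 (u : B) : n = 2%N -> smooth_nct theta u ->
  laplace_beltrami (conformal k g) u = inverse k ^+ 2 * laplace_beltrami g u.
Proof.
move=> n2 su; rewrite laplace_beltrami_conformal//; last by rewrite n2.
rewrite pairing_conformal.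
rewrite big1 ?mulr0 ?subr0// => i _; rewrite big1// => j _.
have n20 : (n - 2)%N = 0%N by rewrite n2.
by rewrite n20 expr0 deriv1 mul0r.
Qed.

End Assembly.

Theorem proposition9p8 (R : realType) (n : nat) (hn : (2 <= n)%N)
    (theta : 'M[R]_n) (htheta : theta^T = - theta)
    (g : 'M[bop R n]_n) (hg : riemannian_metric theta g)
    (k : bop R n) (hk : positive_invertible theta k)
    (hkg : forall i j, k * g i j = g i j * k) :
  (forall u : bop R n, smooth_nct theta u ->
     laplace_beltrami (conformal k g) u =
     (inverse k) ^+ 2 * laplace_beltrami g u
     - inverse (nu g) * (inverse k) ^+ n *
       pairing (inverse g)
         (form_scale (sqrtop (nu g)) (differential u))
         (form_scale (sqrtop (nu g)) (differential (k ^+ (n - 2))))) /\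
  (n = 2%N -> forall u : bop R n, smooth_nct theta u ->
     laplace_beltrami (conformal k g) u =
     (inverse k) ^+ 2 * laplace_beltrami g u).
Proof.
split=> [u su|n2 u su]; first exact: laplace_beltrami_conformal hg hk hkg _ hn su.
exact: laplace_beltrami_conformal2 hg hk hkg _ n2 su.
Qed.
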